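(* Let $d\in\{2,3\}$ and let $\Omega\subset\mathbb{R}^d$ be a bounded domain with Lipschitz boundary, and let the boundary data be $\boldsymbol g=\boldsymbol 0$ on $\partial\Omega$. Suppose that $\alpha:[0,1]\to[\underline\alpha,\overline\alpha]$, with $0\le\underline\alpha$ and $\overline\alpha<\infty$, is convex, monotonically decreasing and twice continuously differentiable, with $\alpha(0)=\overline\alpha$, $\alpha(1)=\underline\alpha$, and that $\alpha$ is strongly convex: there exists a constant $\alpha''_{\min}>0$ such that $\alpha''(y)\ge\alpha''_{\min}>0$ for all $y\in[0,1]$. Let $(\boldsymbol u,\rho)\in H^1_{0,\mathrm{div}}(\Omega)^d\times C_\gamma$ be a local or global minimizer of $J$ over $H^1_{0,\mathrm{div}}(\Omega)^d\times C_\gamma$ such that $\boldsymbol u$ is not the zero function and such that there exist a constant $\theta>0$ and a closed subset $\bar U_\theta\subset\Omega$ with non-empty interior on which $|\boldsymbol u|^2\ge\theta$ a.e. Let $U_\theta$ be the (non-empty) open interior of $\bar U_\theta$. Then the weak gradient $\nabla\rho$ exists in $U_\theta$ and $\rho\in C_\gamma\cap H^1(U_\theta)$.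
   Context: Let $\nu>0$ be a constant (the viscosity), $\gamma\in(0,1)$ a constant (the volume fraction), and $\boldsymbol f\in L^2(\Omega)^d$. Define $$H^1_{0,\mathrm{div}}(\Omega)^d=\{\boldsymbol v\in H^1(\Omega)^d:\ \boldsymbol v|_{\partial\Omega}=\boldsymbol 0 \text{ (trace sense)},\ \mathrm{div}(\boldsymbol v)=0\text{ a.e. in }\Omega\},$$ $$C_\gamma=\Big\{\eta\in L^\infty(\Omega):\ 0\le\eta\le1\text{ a.e.},\ \int_\Omega\eta\,dx\le\gamma|\Omega|\Big\},$$ $$J(\boldsymbol v,\eta)=\frac12\int_\Omega\big(\alpha(\eta)|\boldsymbol v|^2+\nu|\nabla\boldsymbol v|^2-2\boldsymbol f\cdot\boldsymbol v\big)\,dx.$$ A pair $(\boldsymbol u,\rho)$ in the admissible set is a local minimizer if there exists $r>0$ such that $J(\boldsymbol u,\rho)\le J(\boldsymbol w,\eta)$ for all $(\boldsymbol w,\eta)$ in the admissible set with $\|\boldsymbol u-\boldsymbol w\|_{H^1(\Omega)}+\|\rho-\eta\|_{L^\infty(\Omega)}<r$. *)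

(* Defs.v *)
From HB Require Import structures.
From mathcomp Require Import all_boot all_order all_algebra.
From mathcomp Require Import all_classical all_reals all_analysis.

Set Implicit Arguments.
Unset Strict Implicit.
Unset Printing Implicit Defensive.

Import Order.TTheory GRing.Theory Num.Theory.
Import numFieldNormedType.Exports.

Local Open Scope classical_set_scope.
Local Open Scope ring_scope.

Definition rV_display : measure_display. Proof. exact. Qed.

Section rV_measurable.
Context {R : realType} (n : nat).

Definition rV_coord (i : 'I_n) (x : 'rV[R]_n) : R := x 0 i.

Let rV_set0 : g_sigma_preimage rV_coord set0.
Proof. exact: sigma_algebra0. Qed.

Let rV_setC A : g_sigma_preimage rV_coord A -> g_sigma_preimage rV_coord (~` A).
Proof. exact: sigma_algebraC. Qed.

Let rV_bigcup (F : _^nat) : (forall i, g_sigma_preimage rV_coord (F i)) ->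
  g_sigma_preimage rV_coord (\bigcup_i (F i)).
Proof. exact: sigma_algebra_bigcup. Qed.

(* The sigma-algebra generated by the coordinates coincides with the Borel one. *)
HB.instance Definition _ := @isMeasurable.Build rV_display
  'rV[R]_n (g_sigma_preimage rV_coord) rV_set0 rV_setC rV_bigcup.

End rV_measurable.

Section lebesgue_rV.
Context {R : realType}.

Lemma measurable_rV_coord n (i : 'I_n) :
  measurable_fun setT (rV_coord i : 'rV[R]_n -> R).
Proof.
case: n i => [[]//|n] i _ Y mY; apply: sub_sigma_algebra.
rewrite -bigcup_mkord_ord; exists i => //=.
by rewrite inord_val; exists Y.
Qed.

Lemma measurable_fun_rV d (T : measurableType d) n (g : T -> 'rV[R]_n) :
  (forall i, measurable_fun setT (rV_coord i \o g)) -> measurable_fun setT g.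
Proof.
case: n g => [|n] g mg.
  move=> _ Y _; rewrite setTI.
  have -> : g @^-1` Y = [set _ | Y 0].
    by apply/seteqP; split => x /=; rewrite (_ : g x = 0)//; apply/rowP => -[].
  by have [Y0|Y0] := pselect (Y 0);
    [rewrite (_ : mkset _ = setT)|rewrite (_ : mkset _ = set0)] => //;
    apply/seteqP; split.
apply: (@measurability _ _ _ _ _ _
  (\big[setU/set0]_(i < n.+1) preimage_set_system setT (rV_coord i) measurable)).
  by [].
move=> _ [B + <-]; rewrite -bigcup_mkord_ord => -[i Ii [A mA <-]].
by rewrite !setTI -comp_preimage -[X in measurable X]setTI; exact: mg.
Qed.

Definition rV_cons n (p : R * 'rV[R]_n) : 'rV[R]_n.+1 :=
  \row_i (if unlift ord0 i is Some j then p.2 0 j else p.1).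

Definition rV_uncons n (x : 'rV[R]_n.+1) : R * 'rV[R]_n :=
  (x 0 ord0, \row_j x 0 (lift ord0 j)).

Lemma rV_consK n : cancel (@rV_cons n) (@rV_uncons n).
Proof.
move=> [a v]; rewrite /rV_uncons /rV_cons mxE unlift_none/=; congr pair.
by apply/rowP => j; rewrite !mxE liftK.
Qed.

Lemma measurable_rV_cons n : measurable_fun setT (@rV_cons n).
Proof.
apply: measurable_fun_rV => i; case: (unliftP ord0 i) => [j ->|->].
  rewrite (_ : _ \o _ = rV_coord j \o snd); last first.
    by apply/funext => p; rewrite /rV_coord/= mxE liftK.
  by apply: measurableT_comp => //; exact: measurable_rV_coord.
rewrite (_ : _ \o _ = fst)//.
by apply/funext => p; rewrite /rV_coord/= mxE unlift_none.
Qed.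

Lemma measurable_rV_uncons n : measurable_fun setT (@rV_uncons n).
Proof.
apply/measurable_fun_pairP; split; first exact: measurable_rV_coord.
apply: measurable_fun_rV => j.
rewrite (_ : _ \o _ = rV_coord (lift ord0 j)); first exact: measurable_rV_coord.
by apply/funext => x; rewrite /rV_coord/= mxE.
Qed.

Section cons_measure.
Context n (mu : {sigma_finite_measure set 'rV[R]_n -> \bar R}).

Definition cons_measure : set 'rV[R]_n.+1 -> \bar R :=
  pushforward (@lebesgue_measure R \x mu)%E (@rV_cons n).

Let mcons (A : set 'rV[R]_n.+1) :
  measurable A -> measurable ((@rV_cons n) @^-1` A : set (measurableTypeR R * _)).
Proof. by move=> mA; rewrite -[X in measurable X]setTI; exact: measurable_rV_cons. Qed.

Let cons_measure0 : cons_measure set0 = 0%E.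
Proof. by rewrite /cons_measure /pushforward preimage_set0 measure0. Qed.

Let cons_measure_ge0 A : (0 <= cons_measure A)%E.
Proof. by rewrite /cons_measure /pushforward; exact: measure_ge0. Qed.

Let cons_measure_sigma_additive : semi_sigma_additive cons_measure.
Proof.
move=> F mF tF mUF; rewrite /cons_measure /pushforward preimage_bigcup.
apply: measure_semi_sigma_additive.
- by move=> k; exact: mcons.
- apply/trivIsetP => /= i j _ _ ij; rewrite -preimage_setI.
  by move/trivIsetP : tF => /(_ _ _ _ _ ij) ->//; rewrite preimage_set0.
- by rewrite -preimage_bigcup; exact: mcons.
Qed.

HB.instance Definition _ := isMeasure.Build _ _ _ cons_measure
  cons_measure0 cons_measure_ge0 cons_measure_sigma_additive.

Let cons_measure_sigma_finite : sigma_finite setT cons_measure.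
Proof.
have /sigma_finiteP[F [TF ndF Foo]] := sigma_finiteT (@lebesgue_measure R).
have /sigma_finiteP[G [TG ndG Goo]] := sigma_finiteT mu.
exists (fun k => @rV_uncons n @^-1` (F k `*` G k)).
  rewrite -preimage_bigcup (_ : \bigcup_k _ = setT) ?preimage_setT//.
  apply/seteqP; split => // -[x y] _.
  have [i _ Fix] : (\bigcup_k F k) x by rewrite -TF.
  have [j _ Gjy] : (\bigcup_k G k) y by rewrite -TG.
  exists (maxn i j) => //; split.
    by move: x Fix; exact/subsetPset/ndF/leq_maxl.
  by move: y Gjy; exact/subsetPset/ndG/leq_maxr.
move=> k; have [mF Fk] := Foo k; have [mG Gk] := Goo k; split.
  rewrite -[X in measurable X]setTI; apply: measurable_rV_uncons => //.
  exact: measurableX.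
rewrite /cons_measure /pushforward -comp_preimage.
rewrite (_ : _ \o _ = id) ?preimage_id; last first.
  by apply/funext => p; exact: rV_consK.
by rewrite product_measure1E// lte_mul_pinfty// ge0_fin_numE.
Qed.

HB.instance Definition _ := Measure_isSigmaFinite.Build _ _ _ cons_measure
  cons_measure_sigma_finite.

End cons_measure.

(* The n-fold product of the one-dimensional Lebesgue measure, transported to
   row vectors. *)
Fixpoint lebesgue_rV (n : nat) : {sigma_finite_measure set 'rV[R]_n -> \bar R} :=
  if n is n'.+1 then cons_measure (lebesgue_rV n') else \d_(0 : 'rV[R]_0).

Lemma lebesgue_rV_box n (A : 'I_n -> set R) : (forall i, measurable (A i)) ->
  lebesgue_rV n [set x | forall i, A i (x 0 i)] =
  (\prod_(i < n) @lebesgue_measure R (A i))%E.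
Proof.
elim: n A => [|n IHn] A mA /=.
  by rewrite big_ord0 diracE mem_set// => -[].
rewrite /cons_measure /pushforward big_ord_recl.
rewrite -(IHn (fun i => A (lift ord0 i))); last by move=> i; exact: mA.
set B := (X in lebesgue_rV n X).
have mB : measurable B.
  rewrite (_ : B = \bigcap_(i in setT) (rV_coord i @^-1` A (lift ord0 i))).
    apply: fin_bigcap_measurable => // i _.
    by rewrite -[X in measurable X]setTI; exact: measurable_rV_coord.
  by apply/seteqP; split => x xA i => [_|]; exact: xA.
rewrite -product_measure1E//; last exact: mA.
congr (_ _); apply/seteqP; split => -[a v] /=.
  move=> av; split=> [|i]; [have := av ord0|have := av (lift ord0 i)];
    by rewrite mxE ?unlift_none ?liftK.
by move=> [Aa Bv] i; case: (unliftP ord0 i) => [j ->|->];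
  rewrite mxE ?unlift_none ?liftK//; exact: Bv.
Qed.

End lebesgue_rV.

Section euclidean.
Context {R : realType} {d : nat}.

Definition dotmul (x y : 'rV[R]_d) : R := \sum_i x 0 i * y 0 i.
Definition sqnorm (x : 'rV[R]_d) : R := dotmul x x.
Definition vcomp (v : 'rV[R]_d -> 'rV[R]_d) (k : 'I_d) : 'rV[R]_d -> R :=
  fun x => v x 0 k.

Definition e_ (i : 'I_d) : 'rV[R]_d := delta_mx 0 i.

End euclidean.

Section sobolev.
Context {R : realType} {d : nat}.
Local Notation E := 'rV[R]_d.
Local Notation mu := (@lebesgue_rV R d).
Implicit Types (U : set E) (phi u w : E -> R) (i : 'I_d).

Fixpoint Ck (k : nat) phi : Prop :=
  if k is k'.+1 then
    continuous phi /\ forall i, (forall x, derivable phi x (e_ i)) /\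
                                Ck k' ('D_(e_ i) phi)
  else continuous phi.

Definition smooth phi := forall k, Ck k phi.

Definition tsupport phi : set E := closure [set x | phi x != 0].

Definition test_function U phi :=
  [/\ smooth phi, compact (tsupport phi) & tsupport phi `<=` U].

Definition L2 U u := u \_ U \in Lfun mu 2%:E.

Definition Linfty U u := u \_ U \in Lfun mu +oo%E.

Definition L1loc U u := measurable_fun U u /\
  forall K, compact K -> K `<=` U -> (\int[mu]_(x in K) `|u x|%:E < +oo)%E.

Definition weak_partial U i u w :=
  [/\ L1loc U u, L1loc U w &
      forall phi, test_function U phi ->
        \int[mu]_(x in U) (u x * 'D_(e_ i) phi x) =
        - \int[mu]_(x in U) (w x * phi x)].

Definition weakly_differentiable U u := forall i, exists w, weak_partial U i u w.

(* A representative of the weak partial derivative; it is only meaningful, and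
   then unique up to null sets, when such a derivative exists. *)
Definition wpartial U i u : E -> R := xget (cst 0) [set w | weak_partial U i u w].

Definition H1 U u :=
  [/\ L2 U u, weakly_differentiable U u & forall i, L2 U (wpartial U i u)].

Definition sqgrad U u (x : E) : R := \sum_i wpartial U i u x ^+ 2.

Definition H1norm2 U u : \bar R :=
  (\int[mu]_(x in U) (u x ^+ 2 + sqgrad U u x)%:E)%E.

End sobolev.

Section boundary.
Context {R : realType} {d : nat}.
Local Notation E := 'rV[R]_d.
Local Notation mu := (@lebesgue_rV R d).

Definition bdry (U : set E) : set E := closure U `\` U°.

(* Near each boundary point and in suitable orthonormal coordinates y = x Q, the
   set is the strict epigraph {y_k > g(y')} of a Lipschitz function of the d - 1
   remaining coordinates y'. *)
Definition lipschitz_boundary (U : set E) :=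
  forall x0, bdry U x0 ->
    exists (Q : 'M[R]_d) (k : 'I_d) (g : 'rV[R]_(d.-1) -> R),
      [/\ Q *m Q^T = 1%:M, lipschitz g &
          \forall x \near x0,
            U x <-> g (col' k (x *m Q)) < (x *m Q) 0 k].

Definition bounded_lipschitz_domain (U : set E) :=
  [/\ U !=set0, open U, connected U, bounded_set U & lipschitz_boundary U].

Local Open Scope ereal_scope.

(* The point 0 is added so that the empty set has diameter 0 rather than -oo. *)
Definition ediam (A : set E) : \bar R :=
  ereal_sup ([set 0] `|`
    [set (Num.sqrt (sqnorm (p.1 - p.2)%R))%:E | p in A `*` A]).

Definition hausdorff_pre (s delta : R) (A : set E) : \bar R :=
  ereal_inf [set \sum_(0 <= j <oo) ediam (F j) `^ s |
    F in [set F : (set E)^nat |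
      A `<=` \bigcup_j F j /\ forall j, ediam (F j) <= delta%:E]].

(* s-dimensional Hausdorff measure, without the normalising constant (which does
   not depend on the set). *)
Definition hausdorff (s : R) (A : set E) : \bar R :=
  ereal_sup [set hausdorff_pre s delta A | delta in [set r : R | (0 < r)%R]].

(* g is the trace of u on the boundary of U: u is the limit in H^1(U) of smooth
   functions on R^d whose restrictions to the boundary converge to g in L^2 of
   the (d-1)-dimensional surface measure. *)
Definition has_trace (U : set E) (u g : E -> R) :=
  exists phi : (E -> R)^nat,
    [/\ forall n, smooth (phi n),
        H1norm2 U (phi n \- u)%R @[n --> \oo] --> 0 &
        \int[hausdorff d.-1%:R]_(x in bdry U) ((phi n x - g x) ^+ 2)%:E
          @[n --> \oo] --> 0].

End boundary.

Section problem.
Context {R : realType} {d : nat}.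
Local Notation E := 'rV[R]_d.
Local Notation mu := (@lebesgue_rV R d).
Variable Omega : set E.
Implicit Types (u v w f : E -> E) (rho eta : E -> R).

Definition divergence v (x : E) : R := \sum_i wpartial Omega i (vcomp v i) x.

Definition H10div v :=
  [/\ forall k, H1 Omega (vcomp v k),
      forall k, has_trace Omega (vcomp v k) (cst 0) &
      \forall x \ae mu, Omega x -> divergence v x = 0].

Definition Cgamma (gamma : R) eta :=
  [/\ Linfty Omega eta,
      \forall x \ae mu, Omega x -> 0 <= eta x <= 1 &
      (\int[mu]_(x in Omega) (eta x)%:E <= gamma%:E * mu Omega)%E].

(* alpha only matters on [0, 1], where eta in C_gamma takes its values a.e. *)
Definition J (alpha : R -> R) (nu : R) f v eta : R :=
  2^-1 * \int[mu]_(x in Omega)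
    (alpha (eta x) * sqnorm (v x) +
     nu * (\sum_k sqgrad Omega (vcomp v k) x) - 2 * dotmul (f x) (v x)).

Definition H1norm v : \bar R :=
  ((\sum_k H1norm2 Omega (vcomp v k)) `^ 2^-1)%E.

Definition Linfty_norm eta : \bar R := 'N[mu]_+oo[EFin \o (eta \_ Omega)]%E.

Definition admissible gamma v eta := H10div v /\ Cgamma gamma eta.

Definition global_minimizer alpha nu f gamma u rho :=
  admissible gamma u rho /\
  forall w eta, admissible gamma w eta ->
    J alpha nu f u rho <= J alpha nu f w eta.

Definition local_minimizer alpha nu f gamma u rho :=
  admissible gamma u rho /\
  exists2 r : R, 0 < r & forall w eta, admissible gamma w eta ->
    (H1norm (u \- w)%R + Linfty_norm (rho \- eta)%R < r%:E)%E ->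
    J alpha nu f u rho <= J alpha nu f w eta.

End problem.

(* One-sided at the end points when A is an interval. *)
Definition derivative_within {R : realType} (A : set R) (f : R -> R) (x l : R) :=
  (f y - f x) / (y - x) @[y --> within A (x^')] --> l.

(* Main.v *)
(* With the velocity fixed, convexity of alpha turns local minimality in the density into
   global minimality of eta |-> int alpha(eta) |u|^2 over C_gamma.  A Lagrange multiplier
   lam for the volume constraint then makes rho a pointwise minimizer: rho = G(|u|^2) a.e.
   on U, where G(s) minimizes alpha(y) s + lam y over [0, 1].  Strong convexity of alpha
   makes v |-> G(max(theta, |v|^2)) Lipschitz, and theta <= |u|^2 on U, so rho is a
   Lipschitz function of u there.

   That such a function of u is in H^1(U) is seen as follows.  The trace condition
   provides smooth functions on R^d converging to u in H^1(Omega).  For a smooth map Phi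
   and a Lipschitz F, translating the variable in int F(Phi) (psi(. + h e_i) - psi) / h
   gives |int F(Phi) d_i psi| <= L int |d_i Phi| |psi|; in the limit
   psi |-> int_U rho d_i psi is bounded for the L^2 norm, and the Riesz representation
   theorem yields the weak derivative. *)
Require Import Defs.
From HB Require Import structures.
From mathcomp Require Import all_boot all_order all_algebra.
From mathcomp Require Import all_classical all_reals all_analysis.
From mathcomp Require Import measurable_realfun ess_sup_inf.
From mathcomp Require Import ring lra.
Import Order.TTheory GRing.Theory Num.Theory.
Import numFieldNormedType.Exports.
Local Open Scope classical_set_scope.
Local Open Scope ring_scope.

Set Implicit Arguments.
Unset Strict Implicit.
Unset Printing Implicit Defensive.

(** * Lebesgue measure on row vectors *)

(** The constraint 0 <= y <= 1 leaves G merely Lipschitz, and a Lipschitz function F of several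
    Sobolev functions has no usable chain rule: F need not be differentiable along the range of u.
    Hence no derivative of F is ever formed; only increments of F occur, inside an integral in which
    the derivative falls on the test function.

    The truncation by theta is forced by the approximation: the smooth functions close to u need not
    satisfy |v|^2 >= theta on U, so F has to be Lipschitz on all of R^d. It is, because s enters
    only through lam / s: dividing the pointwise energy by s leaves alpha(y) + (lam / s) y, so G is
    Lipschitz in 1 / s, and v |-> 1 / max(theta, |v|^2) is globally Lipschitz although |v|^2 is not.

    The pointwise form of rho is obtained without differentiating J: rho is compared with the
    density equal to G(|u|^2) on U, and strong convexity bounds the gain below by a multiple of the
    squared L^2 distance of the two, which must therefore vanish. *)

Section boxes.
Context {R : realType} (n : nat).
Local Notation E := 'rV[R]_n.

Definition open_box (a b : E) : set E := [set x | forall i, a 0 i < x 0 i < b 0 i].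

Lemma measurable_open_box a b : measurable (open_box a b).
Proof.
rewrite (_ : open_box a b =
    \bigcap_(i in setT) (rV_coord i @^-1` `]a 0 i, b 0 i[%classic)).
  apply: fin_bigcap_measurable => // i _.
  by rewrite -[X in measurable X]setTI; exact: measurable_rV_coord.
apply/seteqP; split => x xA i => [_|]; first by rewrite /= in_itv/=; exact: xA.
by have := xA i I; rewrite /= in_itv.
Qed.

Lemma open_boxI a b a' b' : open_box a b `&` open_box a' b' =
  open_box (\row_i Num.max (a 0 i) (a' 0 i)) (\row_i Num.min (b 0 i) (b' 0 i)).
Proof.
apply/seteqP; split => x /=.
  move=> [x1 x2] i; rewrite !mxE gt_max lt_min.
  by have /andP[-> ->] := x1 i; have /andP[-> ->] := x2 i.
move=> xab; split=> i; have := xab i; rewrite !mxE gt_max lt_min;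
  by move=> /andP[/andP[? ?] /andP[? ?]]; apply/andP.
Qed.

Definition open_boxes : set (set E) := [set open_box ab.1 ab.2 | ab in setT].

Lemma setI_closed_open_boxes : setI_closed open_boxes.
Proof.
move=> _ _ [[a b] _ <-] [[a' b'] _ <-] /=; rewrite open_boxI.
by eexists (_, _); last reflexivity.
Qed.

Lemma bigcup_open_cubes :
  \bigcup_k open_box (const_mx (- k%:R)) (const_mx k%:R) = setT.
Proof.
apply/seteqP; split => // x _.
exists (Num.bound (\sum_i `|x 0 i|)) => // i; rewrite !mxE -ltr_norml.
have x0 : 0 <= \sum_i `|x 0 i| by exact: sumr_ge0.
rewrite (le_lt_trans _ (archi_boundP x0))//.
by rewrite (bigD1 i)//= lerDl sumr_ge0.
Qed.

Lemma g_sigma_open_boxes : @measurable _ E = <<s open_boxes >>.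
Proof.
apply/seteqP; split; last first.
  apply: smallest_sub; first exact: sigma_algebra_measurable.
  by move=> _ [[a b] _ <-]; exact: measurable_open_box.
move=> B; apply: smallest_sub B; first exact: smallest_sigma_algebra.
move=> B.
suff H (i : 'I_n) :
    preimage_set_system setT (rV_coord i) measurable `<=` <<s open_boxes>>.
  by elim/big_ind : _ => // [C D CB DB [/CB|/DB]|i _ /H].
rewrite (_ : @measurable _ R = (@measurable_realfun.RGenOpens.G R).-sigma.-measurable); last first.
  exact: measurable_realfun.RGenOpens.measurableE.
rewrite -g_sigma_preimageE; apply: smallest_sub.
  exact: smallest_sigma_algebra.
move=> _ [_ [x [y ->]] <-].
(* A slab is not a box: it is exhausted by boxes with sides [(-k, k)] in the other coordinates. *)
rewrite setTI (_ : _ @^-1` _ = \bigcup_k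
    open_box (\row_j if j == i then x else - k%:R) (\row_j if j == i then y else k%:R)).
  have [_ _ Gbigcup] : sigma_algebra setT <<s open_boxes>>.
    exact: smallest_sigma_algebra.
  by apply: Gbigcup => k; apply: sub_sigma_algebra; eexists (_, _).
apply/seteqP; split => [z /=|z [k _] /(_ i)]; last first.
  by rewrite /rV_coord !mxE eqxx/= in_itv.
rewrite in_itv/= => zxy.
have [k _ zk] : (\bigcup_k open_box (const_mx (- k%:R)) (const_mx k%:R)) z.
  by rewrite bigcup_open_cubes.
exists k => // j; rewrite !mxE; case: eqP => [->//|_].
by have := zk j; rewrite !mxE.
Qed.

(** Open boxes form a generating pi-system and the cubes of half-width [k] exhaust the space, so
    finiteness on boxes suffices for uniqueness. *)
Lemma rV_measure_unique (m1 m2 : {measure set E -> \bar R}) :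
  (forall a b, m1 (open_box a b) = m2 (open_box a b)) ->
  (forall a b, m1 (open_box a b) < +oo)%E ->
  forall A, measurable A -> m1 A = m2 A.
Proof.
move=> m12 m1oo; apply: (measure_unique open_boxes
  (fun k => open_box (const_mx (- k%:R)) (const_mx k%:R))) => //.
- exact: g_sigma_open_boxes.
- exact: setI_closed_open_boxes.
- by move=> k; eexists (_, _).
- exact: bigcup_open_cubes.
- by move=> _ [[a b] _ <-]; exact: m12.
Qed.

Lemma lebesgue_rV_open_box (a b : E) :
  lebesgue_rV n (open_box a b) = (\prod_(i < n) lebesgue_measure `]a 0%R i, b 0%R i[%classic)%E.
Proof.
rewrite -lebesgue_rV_box//; congr (lebesgue_rV n _).
Qed.

Lemma lebesgue_rV_open_box_lty (a b : E) : (lebesgue_rV n (open_box a b) < +oo)%E.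
Proof.
rewrite lebesgue_rV_open_box.
suff : (0 <= \prod_(i < n) lebesgue_measure `]a 0%R i, b 0%R i[%classic < +oo)%E.
  by case/andP.
elim/big_ind : _ => [|x y /andP[x0 xoo] /andP[y0 yoo]|i _]; first by rewrite lee01 ltry.
  by rewrite mule_ge0// lte_mul_pinfty// ge0_fin_numE.
by rewrite measure_ge0 lebesgue_measure_itv/=; case: ifPn; rewrite // -EFinB ltry.
Qed.

End boxes.

(** * Translation invariance of Lebesgue measure *)

Section translation.
Context {R : realType} (n : nat).
Local Notation E := 'rV[R]_n.
Local Notation mu := (@lebesgue_rV R n).

Lemma measurable_rV_shift (h : E) : measurable_fun setT (fun x : E => x + h).
Proof.
apply: measurable_fun_rV => i.
rewrite (_ : _ \o _ = (fun x : R => x + h 0 i) \o rV_coord i); last first.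
  by apply/funext => x; rewrite /rV_coord/= mxE.
apply: measurableT_comp; last exact: measurable_rV_coord.
exact: measurable_funD.
Qed.

(** By uniqueness it is enough to look at boxes, where the translation subtracts the same [h 0 i]
    from both end points of each side. *)
Lemma lebesgue_rV_shift (h : E) (A : set E) : measurable A ->
  pushforward mu (fun x => x + h) A = mu A.
Proof.
pose sh := fun x : E => x + h.
have msh : measurable_fun setT sh := measurable_rV_shift h.
have [m mE] : exists m : {measure set E -> \bar R}, pushforward mu sh = m.
  by unshelve eexists; [exact: (pushforward mu sh)|].
have shE a b : sh @^-1` open_box a b = open_box (a - h) (b - h).
  by apply/seteqP; split => x + i => /(_ i); rewrite !mxE ltrBlDr ltrBrDr.
rewrite -/sh mE; apply: rV_measure_unique => [a b|a b]; last first.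
  by rewrite -mE /pushforward shE; exact: lebesgue_rV_open_box_lty.
rewrite -mE /pushforward shE lebesgue_rV_open_box [RHS]lebesgue_rV_open_box; apply: eq_bigr => i _.
rewrite !lebesgue_measure_itv/= !mxE !lte_fin ltrD2r; case: ifPn => // _.
by rewrite -!EFinB; congr (_%:E); ring.
Qed.

Lemma ge0_integral_rV_shift (h : E) (f : E -> \bar R) :
  measurable_fun setT f -> (forall x, 0 <= f x)%E ->
  (\int[mu]_x f (x + h)%R = \int[mu]_x f x)%E.
Proof.
move=> mf f0; pose sh := fun x : E => x + h.
have msh : measurable_fun setT sh := measurable_rV_shift h.
transitivity (\int[pushforward mu sh]_x f x)%E.
  by rewrite ge0_integral_pushforward.
by apply: eq_measure_integral => A mA _; exact: lebesgue_rV_shift.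
Qed.

Lemma integral_rV_shift (h : E) (f : E -> \bar R) : measurable_fun setT f ->
  (\int[mu]_x f (x + h)%R = \int[mu]_x f x)%E.
Proof.
move=> mf; rewrite integralE [RHS]integralE.
rewrite -(ge0_integral_rV_shift h (f := f^\+)%E)//; last exact: measurable_funepos.
rewrite -(ge0_integral_rV_shift h (f := f^\-)%E)//; last exact: measurable_funeneg.
by congr (_ - _)%E; apply: eq_integral => x _; rewrite ?funeposE ?funenegE.
Qed.

Lemma Rintegral_rV_shift (h : E) (f : E -> R) : measurable_fun setT f ->
  \int[mu]_x f (x + h) = \int[mu]_x f x.
Proof.
by move=> mf; congr fine; apply: (integral_rV_shift h (f := EFin \o f)); exact/measurable_EFinP.
Qed.

End translation.

(** * Open, compact and bounded sets; integrability of continuous functions *)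

Section rV_borel.
Context {R : realType} (n : nat).
Local Notation E := 'rV[R]_n.
Local Notation mu := (@lebesgue_rV R n).
Implicit Types (A : set E) (f : E -> R).

Lemma coord_le_norm (x : E) i : `|x 0 i| <= `|x|.
Proof.
have /mapP[j Hj ->] : `|x 0 i| \in [seq `|x y.1 y.2| | y : 'I_1 * 'I_n].
  by apply/mapP; exists (ord0, i) => //=; rewrite mem_enum.
by rewrite [leRHS]/Num.norm /= mx_normrE; apply/bigmax_geP; right => /=; exists j.
Qed.

Lemma ball_rVP (x y : E) e : 0 < e ->
  (forall i, `|x 0 i - y 0 i| < e) -> ball x e y.
Proof. by move=> e0 xy; split=> // i j; rewrite ord1; exact: xy. Qed.

Definition closed_box (a b : E) : set E := [set x | forall i, a 0 i <= x 0 i <= b 0 i].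

Lemma open_closed_box a b : open_box a b `<=` closed_box a b.
Proof. by move=> x xab i; have /andP[? ?] := xab i; rewrite !ltW. Qed.

(** Rational corners leave only countably many boxes, both for the measurability of open sets and
    for gluing almost-everywhere statements. The closed box is kept inside [A] so that bump
    functions of the open box are test functions on [A]. *)
Lemma open_rational_box A x : open A -> A x ->
  exists p q : 'rV[rat]_n, open_box (map_mx ratr p) (map_mx ratr q) x /\
    closed_box (map_mx ratr p) (map_mx ratr q) `<=` A.
Proof.
move=> oA Ax.
have [e /= e0 xeA] : exists2 e : R, 0 < e & ball x e `<=` A.
  by apply/nbhs_ballP; exact: open_nbhs_nbhs.
have lt1 i : x 0 i - e < x 0 i by rewrite ltrBlDr ltrDl.
have lt2 i : x 0 i < x 0 i + e by rewrite ltrDl.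
have r1 i := cid (rat_in_itvoo (lt1 i)).
have r2 i := cid (rat_in_itvoo (lt2 i)).
pose p : 'rV[rat]_n := \row_i sval (r1 i).
pose q : 'rV[rat]_n := \row_i sval (r2 i).
have pP i : x 0 i - e < (map_mx ratr p : E) 0 i < x 0 i.
  by rewrite !mxE; case: (r1 i) => /= z; rewrite in_itv.
have qP i : x 0 i < (map_mx ratr q : E) 0 i < x 0 i + e.
  by rewrite !mxE; case: (r2 i) => /= z; rewrite in_itv.
exists p, q; split=> [i|y yb].
  by have /andP[_ ->] := pP i; have /andP[-> _] := qP i.
apply: xeA; apply: ball_rVP => // i.
have /andP[? ?] := yb i; have /andP[? ?] := pP i; have /andP[? ?] := qP i.
by rewrite ltr_norml; apply/andP; split; lra.
Qed.

Lemma open_measurable_rV A : open A -> measurable A.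
Proof.
move=> oA; pose q2r (p : 'rV[rat]_n) : E := map_mx ratr p.
pose F (pq : 'rV[rat]_n * 'rV[rat]_n) : set E :=
  if `[< closed_box (q2r pq.1) (q2r pq.2) `<=` A >]
  then open_box (q2r pq.1) (q2r pq.2) else set0.
rewrite (_ : A = \bigcup_pq F pq).
  apply: countable_bigcupT_measurable => // pq; rewrite /F.
  by case: ifPn => // _; exact: measurable_open_box.
apply/seteqP; split=> [x Ax|x [pq _]]; last first.
  by rewrite /F; case: asboolP => // sA /open_closed_box /sA.
have [p [q [xpq pqA]]] := open_rational_box oA Ax.
by exists (p, q) => //; rewrite /F; case: asboolP.
Qed.

Lemma closed_measurable_rV A : closed A -> measurable A.
Proof.
move=> cA; rewrite -(setCK A); apply: measurableC; apply: open_measurable_rV.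
exact: closed_openC.
Qed.

Lemma compact_measurable_rV A : compact A -> measurable A.
Proof.
by move=> cA; apply: closed_measurable_rV; apply: compact_closed => //; exact: norm_hausdorff.
Qed.

Lemma continuous_measurable_rV f : continuous f -> measurable_fun setT f.
Proof.
move=> cf; apply: (measurability (@measurable_realfun.RGenOpens.G R)).
  exact: measurable_realfun.RGenOpens.measurableE.
move=> _ [_ [a [b ->]] <-]; rewrite setTI; apply: open_measurable_rV.
by move/continuousP : cf; apply; exact: interval_open.
Qed.

Lemma bounded_set_sub_box A : bounded_set A ->
  exists M : R, A `<=` open_box (const_mx (- M)) (const_mx M).
Proof.
move=> [M [Mreal MA]]; exists (M + 2) => x Ax i; rewrite !mxE -ltr_norml.
apply: le_lt_trans (coord_le_norm x i) _.
have M1 : M < M + 1 by rewrite ltrDl.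
by have /= := MA _ M1 x Ax; lra.
Qed.

Lemma bounded_set_lty A : measurable A -> bounded_set A -> (mu A < +oo)%E.
Proof.
move=> mA /bounded_set_sub_box[M AM].
apply: le_lt_trans (lebesgue_rV_open_box_lty (const_mx (- M)) (const_mx M)).
by apply: le_measure => //; rewrite inE//; exact: measurable_open_box.
Qed.

Lemma compact_lty A : compact A -> (mu A < +oo)%E.
Proof.
by move=> cA; apply: bounded_set_lty;
  [exact: compact_measurable_rV|exact: compact_bounded].
Qed.

(** [A] need not be closed: [f] is continuous everywhere, hence bounded on a closed cube that
    contains [A]. *)
Lemma continuous_bounded_on A f : bounded_set A -> continuous f ->
  exists2 M, 0 <= M & forall x, A x -> `|f x| <= M.
Proof.
move=> bA cf.
have [M0 AM] := bounded_set_sub_box bA.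
pose K := [set v : E | forall i, (`[- M0, M0]%classic) (v ord0 i)].
have cK : compact K.
  by apply: (rV_compact (A := fun=> `[- M0, M0]%classic)) => _; exact: segment_compact.
have AK : A `<=` K.
  move=> x /AM xM i; have /andP[] := xM i; rewrite !mxE /= in_itv/= => ? ?.
  by apply/andP; split; exact: ltW.
have : bounded_set (f @` K).
  apply: compact_bounded; apply: continuous_compact => //.
  exact: continuous_subspaceT.
move=> [M [_ MK]]; exists (`|M| + 1); first by rewrite addr_ge0.
move=> x Ax; apply: MK; last by exists x => //; exact: AK.
by rewrite ltr_pwDr// ler_norm.
Qed.

Lemma continuous_integrable A f : measurable A -> bounded_set A -> continuous f ->
  mu.-integrable A (EFin \o f).
Proof.
move=> mA bA cf; apply: measurable_bounded_integrable => //.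
- exact: bounded_set_lty.
- by apply: measurable_funTS; exact: continuous_measurable_rV.
- have [M M0 fM] := continuous_bounded_on bA cf.
  exists M; split; first exact: ger0_real.
  by move=> y My x Ax; exact: (le_trans (fM _ Ax) (ltW My)).
Qed.

End rV_borel.

(** * Difference quotients and test functions *)

Section continuity.
Context {R : realType} {V : normedModType R}.
Implicit Types f g : V -> R.

Lemma continuous_cst (c : R) : continuous (fun _ : V => c).
Proof. by move=> x; exact: cvg_cst. Qed.

Lemma continuous_addf f g : continuous f -> continuous g ->
  continuous (fun x => f x + g x).
Proof. by move=> cf cg x; apply: cvgD; [exact: cf|exact: cg]. Qed.

Lemma continuous_subf f g : continuous f -> continuous g ->
  continuous (fun x => f x - g x).
Proof. by move=> cf cg x; apply: cvgB; [exact: cf|exact: cg]. Qed.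

Lemma continuous_mulf f g : continuous f -> continuous g ->
  continuous (fun x => f x * g x).
Proof. by move=> cf cg x; apply: cvgM; [exact: cf|exact: cg]. Qed.

Lemma continuous_compf f (h : R -> R) : continuous f -> continuous h ->
  continuous (fun x => h (f x)).
Proof. by move=> cf ch x; apply: (@continuous_comp _ _ _ f h); [exact: cf|exact: ch]. Qed.

Lemma continuous_normf f : continuous f -> continuous (fun x => `|f x|).
Proof. by move=> cf x; apply: cvg_norm; exact: cf. Qed.

Lemma continuous_sumf m (G : 'I_m -> V -> R) : (forall k, continuous (G k)) ->
  continuous (fun x => \sum_k G k x).
Proof.
move=> cG x; apply: cvg_big; first exact: add_continuous.
by move=> k _; exact: cG.
Qed.

Lemma continuous_addl_comp f w : continuous f -> continuous (fun x => f (w + x)).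
Proof.
move=> cf x; apply: (@cvg_comp _ _ _ (fun y => w + y) f _ (nbhs (w + x))); last exact: cf.
by apply: cvgD; [exact: cvg_cst|exact: cvg_id].
Qed.

(** This gives the continuity of a Lipschitz function of finitely many continuous functions without
    a topology on ['I_m -> R]; the case [m = 1] serves for scalar Lipschitz functions. *)
Lemma continuous_of_increments m (G : V -> R) (P : 'I_m -> V -> R) (L : R) : 0 <= L ->
  (forall k, continuous (P k)) ->
  (forall x y, `|G x - G y| <= L * \sum_k `|P k x - P k y|) -> continuous G.
Proof.
move=> L0 cP GL x; apply/cvgrPdist_le => e e0.
have cS : continuous (fun y => \sum_k `|P k x - P k y|).
  apply: continuous_sumf => k; apply: continuous_normf.
  by apply: continuous_subf => //; exact: continuous_cst.
have := cS x; rewrite /continuous_at big1; last by move=> k _; rewrite subrr normr0.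
have e1 : 0 < e / (L + 1) by rewrite divr_gt0// ltr_wpDl.
move=> /cvgrPdist_lt/(_ _ e1).
apply: filterS => y; rewrite sub0r normrN ger0_norm ?sumr_ge0// => H.
apply: le_trans (GL _ _) _.
apply: (@le_trans _ _ ((L + 1) * \sum_k `|P k x - P k y|)).
  by rewrite ler_wpM2r ?sumr_ge0// lerDl.
by rewrite mulrC -ler_pdivlMr ?ltr_wpDl// ltW.
Qed.

End continuity.

Section difference_quotient.
Context {R : realType} {V : normedModType R}.
Implicit Types (g : V -> R) (v x : V).

(** The order [h *: v + x] is the one in the quotient that defines ['D_v], so [dq_cvg] only changes
    the filter. *)
Definition dq g v (h : R) x : R := h^-1 * (g (h *: v + x) - g x).

Lemma continuous_dq g v h : continuous g -> continuous (dq g v h).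
Proof.
move=> cg; apply: continuous_mulf; first exact: continuous_cst.
by apply: continuous_subf => //; exact: continuous_addl_comp.
Qed.

Lemma dq_cvg g v x (h : R^nat) : derivable g x v ->
  h @ \oo --> 0 -> (forall n, h n != 0) ->
  dq g v (h n) x @[n --> \oo] --> 'D_v g x.
Proof.
move=> dg h0 hn0.
have h0' : h n @[n --> \oo] --> 0^'.
  move=> A A0; have : \forall n \near \oo, h n != 0 -> A (h n) by exact: (h0 _ A0).
  by apply: filterS => n; exact.
apply: (@cvg_comp _ _ _ h (fun k => dq g v k x) _ _ _ h0'); exact: dg.
Qed.

(** The mean value theorem on the segment from [x] to [h *: v + x]. Both signs of [h] are needed:
    discrete integration by parts reverses the step. *)
Lemma dq_bound g v (h : R) x (M : R) : (forall y, derivable g y v) ->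
  (forall t : R, `|t| <= `|h| -> `|'D_v g (t *: v + x)| <= M) ->
  `|g (h *: v + x) - g x| <= M * `|h|.
Proof.
move=> dg DM.
pose f (t : R) := g (t *: v + x).
have df (t : R) : is_derive t (1 : R) f ('D_v g (t *: v + x)).
  have E : (fun k : R => k^-1 *: ((f \o shift t) (k *: 1) - f t)) =
      (fun k : R => k^-1 *: ((g \o shift (t *: v + x)) (k *: v) - g (t *: v + x))).
    by apply/funext => k; rewrite /f /= scalerDl -[k *: 1]/(k * 1) mulr1 addrA.
  split.
  - by rewrite /derivable E; exact: (dg (t *: v + x)).
  - by rewrite /derive E.
have cf : continuous f.
  move=> t; apply: differentiable_continuous; apply/derivable1_diffP.
  by have [] := df t.
have fE : f 0 = g x by rewrite /f scale0r add0r.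
have [h0|h0] := leP 0 h.
  have [c /[!in_itv]/= /andP[c0 ch]] :=
    MVT_segment h0 (fun t _ => df t) (continuous_subspaceT cf).
  rewrite fE subr0 => ->; rewrite normrM ler_wpM2r// DM//.
  by rewrite !ger0_norm.
have [c /[!in_itv]/= /andP[hc c0]] :=
  MVT_segment (ltW h0) (fun t _ => df t) (continuous_subspaceT cf).
rewrite fE sub0r distrC => ->; rewrite normrM normrN ler_wpM2r// DM//.
by rewrite !ler0_norm ?lerN2// ltW.
Qed.

End difference_quotient.

Section dominated.
Context d (T : measurableType d) (R : realType) (mu : {measure set T -> \bar R}).

Lemma integrable_addf (D : set T) (f g : T -> R) : measurable D ->
  mu.-integrable D (EFin \o f) -> mu.-integrable D (EFin \o g) ->
  mu.-integrable D (EFin \o (fun x => f x + g x)).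
Proof. by move=> mD fi gi; exact: (integrableD mD fi gi). Qed.

Lemma integrable_subf (D : set T) (f g : T -> R) : measurable D ->
  mu.-integrable D (EFin \o f) -> mu.-integrable D (EFin \o g) ->
  mu.-integrable D (EFin \o (fun x => f x - g x)).
Proof. by move=> mD fi gi; exact: (integrableB mD fi gi). Qed.

Lemma integrable_scalef (D : set T) (c : R) (f : T -> R) : measurable D ->
  mu.-integrable D (EFin \o f) -> mu.-integrable D (EFin \o (fun x => c * f x)).
Proof. by move=> mD fi; exact: (integrableZl mD c fi). Qed.

Lemma integrable_measurable (D : set T) (f : T -> R) :
  mu.-integrable D (EFin \o f) -> measurable_fun D f.
Proof. by move=> /(measurable_int mu) /measurable_EFinP. Qed.

Lemma le_integrablef (D : set T) (f g : T -> R) : measurable D ->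
  measurable_fun D f -> (forall x, D x -> `|f x| <= g x) ->
  mu.-integrable D (EFin \o g) -> mu.-integrable D (EFin \o f).
Proof.
move=> mD mf fg; apply: le_integrable => //; first exact/measurable_EFinP.
by move=> x Dx /=; rewrite lee_fin (le_trans (fg x Dx))// ler_norm.
Qed.

Lemma Rintegral_dominated_cvg (D : set T) (f_ : (T -> R)^nat) (f g : T -> R) :
  measurable D ->
  (forall n, measurable_fun D (f_ n)) -> measurable_fun D f ->
  (forall x, D x -> f_ ^~ x @ \oo --> f x) ->
  mu.-integrable D (EFin \o g) ->
  (forall n x, D x -> `|f_ n x| <= g x) ->
  mu.-integrable D (EFin \o f) /\
  \int[mu]_(x in D) f_ n x @[n --> \oo] --> \int[mu]_(x in D) f x.
Proof.
move=> mD mf_ mf f_f ig f_g.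
have [If _ cvgI] := @dominated_convergence _ _ _ mu D mD
  (fun n => EFin \o f_ n) (EFin \o f) (EFin \o g)
  (fun n => measurableT_comp (@EFin_measurable _ setT) (mf_ n))
  (measurableT_comp (@EFin_measurable _ setT) mf)
  ltac:(by apply: aeW => x Dx; apply: cvg_EFin; [exact: nearW|exact: f_f])
  ig ltac:(by apply: aeW => x n Dx /=; rewrite lee_fin f_g).
split=> //; apply: fine_cvg; rewrite fineK//; exact: integrable_fin_num.
Qed.

Lemma bounded_support_integrable (B : set T) (f : T -> R) (M : R) :
  measurable B -> (mu B < +oo)%E -> measurable_fun setT f ->
  (forall x, `|f x| <= M * \1_B x) -> mu.-integrable setT (EFin \o f).
Proof.
move=> mB Boo mf fM.
have : mu.-integrable setT (EFin \o (fun x => M * \1_B x)).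
  apply: (eq_integrable _ (fun x => M%:E * (EFin \o \1_B) x)%E) => //.
  apply: integrableZl => //; apply/integrableP; split.
    by apply/measurable_EFinP; exact: measurable_indic.
  rewrite (eq_integral (fun x => (\1_B x)%:E)); last first.
    by move=> t _; rewrite gee0_abs// lee_fin.
  by rewrite integral_indic// setIT.
apply: le_integrable => //; first exact/measurable_EFinP.
by move=> x _ /=; rewrite lee_fin (le_trans (fM x))// ler_norm.
Qed.

End dominated.

(** * Integration by parts for difference quotients *)

Section translation_estimate.
Context {R : realType} (n : nat).
Local Notation E := 'rV[R]_n.
Local Notation mu := (@lebesgue_rV R n).

Definition cube (M : R) : set E := open_box (const_mx (- M)) (const_mx M).

Lemma cubeP M (x : E) : cube M x <-> forall i, `|x 0 i| < M.
Proof. by split=> xM i; have := xM i; rewrite !mxE ltr_norml. Qed.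

Lemma bounded_cube M : bounded_set (cube M).
Proof.
exists `|M|; split; first by rewrite normr_real.
move=> x My y /cubeP xM; change (mx_norm y <= x); rewrite mx_normrE.
apply/bigmax_leP; split=> [|[i j] _ /=]; first by rewrite (le_trans _ (ltW My)).
by rewrite ord1 ltW// (lt_trans (xM j))// (le_lt_trans _ My)// ler_norm.
Qed.

Lemma measurable_cube M : measurable (cube M).
Proof. exact: measurable_open_box. Qed.

Lemma cube_shift M v t x : `|t| <= 1 -> cube M x -> cube (M + `|v|) (t *: v + x).
Proof.
move=> t1 /cubeP xM; apply/cubeP => i; rewrite !mxE addrC.
apply: le_lt_trans (ler_normD _ _) _; apply: ltr_leD => //.
by rewrite normrM -[leRHS]mul1r ler_pM// coord_le_norm.
Qed.

(** Discrete integration by parts: substituting [x - h *: v] for [x] in the translated term moves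
    the increment to [F], with the step reversed. *)
Lemma Rintegral_mul_dq (F phi : E -> R) (v : E) (h : R) :
  mu.-integrable setT (EFin \o (fun x => F x * phi (h *: v + x))) ->
  mu.-integrable setT (EFin \o (fun x => F x * phi x)) ->
  mu.-integrable setT (EFin \o (fun x => F (- h *: v + x) * phi x)) ->
  \int[mu]_x (F x * dq phi v h x) = - \int[mu]_x (dq F v (- h) x * phi x).
Proof.
move=> i1 i2 i3.
have i12 := integrable_subf measurableT i1 i2.
have i32 := integrable_subf measurableT i3 i2.
transitivity (h^-1 * \int[mu]_x (F x * phi (h *: v + x) - F x * phi x)).
  by rewrite -RintegralZl//; apply: eq_Rintegral => x _; rewrite /dq; ring.
rewrite RintegralB// (_ : \int[mu]_x (F x * phi (h *: v + x)) =
    \int[mu]_x (F (- h *: v + x) * phi x)); last first.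
  rewrite -[RHS](Rintegral_rV_shift (h *: v)).
    by apply: eq_Rintegral => x _; rewrite (addrC x) scaleNr addKr.
  exact: (integrable_measurable i3).
rewrite -RintegralB// -[LHS]opprK -mulNr -RintegralZl//; congr (- _).
by apply: eq_Rintegral => x _; rewrite /dq invrN; ring.
Qed.

(* Translation invariance moves the difference quotient of [phi] to [F], which need not be
   differentiable. *)
Lemma Rintegral_mul_derive_le m (F phi : E -> R) (Phi : 'I_m -> E -> R) (v : E)
    (L : R) (B : set E) :
  continuous F -> continuous phi -> (forall x, derivable phi x v) ->
  continuous ('D_v phi) -> bounded_set B -> (forall x, ~ B x -> phi x = 0) ->
  (forall k, continuous (Phi k)) -> (forall k x, derivable (Phi k) x v) ->
  (forall k, continuous ('D_v (Phi k))) -> 0 <= L ->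
  (forall x y, `|F x - F y| <= L * \sum_k `|Phi k x - Phi k y|) ->
  `|\int[mu]_x (F x * 'D_v phi x)| <=
    \int[mu]_x (L * (\sum_k `|'D_v (Phi k) x|) * `|phi x|).
Proof.
move=> cF cphi dphi cDphi bB phi0 cPhi dPhi cDPhi L0 FL.
have [M0 BM0] := bounded_set_sub_box bB.
(* The cube [M0] contains the support of [phi], [M1] the supports of its translates by [t *: v] with
   [|t| <= 1], and [M2] all points reached from [M1] by such a translation, where the derivatives
   must be bounded. *)
pose M1 := M0 + `|v|; pose M2 := M1 + `|v|.
have M01 : M0 <= M1 by rewrite lerDl.
have M12 : M1 <= M2 by rewrite lerDl.
have cubeS a b : a <= b -> cube a `<=` cube b.
  by move=> ab x /cubeP xa; apply/cubeP => i; exact: lt_le_trans ab.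
have phi0s t x : `|t| <= 1 -> ~ cube M1 x -> phi (t *: v + x) = 0.
  move=> t1 xM1; apply: phi0 => /BM0 H; apply: xM1.
  have := @cube_shift M0 v (- t) _ _ H.
  by rewrite normrN => /(_ t1); rewrite scaleNr addKr.
have [Mp Mp0 Mphi] := continuous_bounded_on (@bounded_cube M2) cphi.
have [MD MD0 MDphi] := continuous_bounded_on (@bounded_cube M2) cDphi.
have [MF MF0 MFF] := continuous_bounded_on (@bounded_cube M2) cF.
pose S x := \sum_k `|'D_v (Phi k) x|.
have cS : continuous S by apply: continuous_sumf => k; exact: continuous_normf.
have [MS MS0 MSS] := continuous_bounded_on (@bounded_cube M2) cS.
pose h (j : nat) : R := j.+1%:R^-1.
have h0 j : h j != 0 by rewrite invr_eq0 pnatr_eq0.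
have h1 j : `|h j| <= 1 by rewrite ger0_norm ?invr_ge0// invf_le1// ler1n.
have hcvg : h @ \oo --> 0 by exact: cvg_harmonic.
have dq_le g t x M : (forall y, derivable g y v) ->
    (forall y, cube M2 y -> `|'D_v g y| <= M) -> `|t| <= 1 -> t != 0 ->
    cube M1 x -> `|dq g v t x| <= M.
  move=> dg DM t1 t0 xM1; rewrite /dq normrM normfV ler_pdivrMl ?normr_gt0//.
  rewrite mulrC; apply: dq_bound => // s st; apply: DM; apply: cube_shift => //.
  exact: le_trans t1.
have mc (g : E -> R) : continuous g -> measurable_fun setT g.
  exact: continuous_measurable_rV.
have cM (f g : E -> R) : continuous f -> continuous g -> continuous (fun x => f x * g x).
  exact: continuous_mulf.
have bsi (f : E -> R) M : continuous f -> (forall x, cube M1 x -> `|f x| <= M) ->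
    (forall x, ~ cube M1 x -> f x = 0) -> mu.-integrable setT (EFin \o f).
  move=> cf fM f0; apply: (@bounded_support_integrable _ _ _ _ (cube M1) _ M).
  - exact: measurable_cube.
  - exact: lebesgue_rV_open_box_lty.
  - exact: mc.
  - move=> x; rewrite indicE; have [xM|xM] := pselect (cube M1 x).
      by rewrite mem_set// mulr1 fM.
    by rewrite memNset// mulr0 f0// normr0.
have cshift (f : E -> R) (w : E) : continuous f -> continuous (fun x : E => f (w + x)).
  exact: continuous_addl_comp.
have phi0' x : ~ cube M1 x -> phi x = 0.
  by move=> xM; have := phi0s 0 x; rewrite normr0 scale0r add0r; apply.
have iM1 : mu.-integrable setT (EFin \o (\1_(cube M1) : E -> R)).
  apply: (@bounded_support_integrable _ _ _ _ (cube M1) _ 1).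
  - exact: measurable_cube.
  - exact: lebesgue_rV_open_box_lty.
  - by apply: measurable_indic; exact: measurable_cube.
  - by move=> x; rewrite mul1r ger0_norm.
have icM (M : R) : mu.-integrable setT (EFin \o (fun x => M * \1_(cube M1) x)).
  exact: integrable_scalef.
pose f1 j x := F x * dq phi v (h j) x.
have f1_cvg x : setT x -> f1 ^~ x @ \oo --> F x * 'D_v phi x.
  by move=> _; apply: cvgM; [exact: cvg_cst|exact: (dq_cvg (dphi x))].
have f1_le j x : setT x -> `|f1 j x| <= MF * MD * \1_(cube M1) x.
  move=> _; rewrite indicE; have [xM|xM] := pselect (cube M1 x).
    rewrite mem_set// mulr1 normrM ler_pM//; last exact: dq_le.
    by apply: MFF; exact: cubeS xM.
  by rewrite memNset// mulr0 /f1 /dq phi0s// phi0'// subrr !mulr0 normr0.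
have [_ cvg1] := Rintegral_dominated_cvg measurableT
  (fun j => mc _ (cM _ _ cF (continuous_dq cphi)))
  (mc _ (cM _ _ cF cDphi)) f1_cvg (icM _) f1_le.
pose bnd j x := L * (\sum_k `|dq (Phi k) v (- h j) x|) * `|phi x|.
have cnorm (g : E -> R) : continuous g -> continuous (fun x => `|g x|).
  exact: continuous_normf.
have cc (c : R) : continuous (fun _ : E => c) by exact: continuous_cst.
have cbnd j : continuous (bnd j).
  apply: (cM); last exact: cnorm.
  by apply: (cM) => //; apply: continuous_sumf => k; apply: continuous_normf; exact: continuous_dq.
have bnd_le j x : cube M1 x -> `|bnd j x| <= L * (m%:R * MS) * Mp.
  move=> xM; rewrite /bnd !normrM normr_id ler_pM ?mulr_ge0//; last first.
    by apply: Mphi; exact: (cubeS _ _ M12).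
  rewrite (ger0_norm L0) ler_wpM2l// ger0_norm ?sumr_ge0//.
  rewrite -[m in leRHS]card_ord mulrC mulr_natr -sumr_const ler_sum// => k _.
  apply: dq_le => //; rewrite ?normrN ?oppr_eq0// => y yM.
  apply: le_trans (MSS _ yM); rewrite [leRHS]ger0_norm ?sumr_ge0//.
  by rewrite /S (bigD1 k)//= lerDl sumr_ge0.
have bnd0 j x : ~ cube M1 x -> bnd j x = 0.
  by move=> xM; rewrite /bnd phi0'// normr0 mulr0.
have bnd_cvg x : setT x -> bnd ^~ x @ \oo --> L * S x * `|phi x|.
  move=> _; apply: cvgM; last exact: cvg_cst.
  apply: cvgM; first exact: cvg_cst.
  apply: cvg_big; first exact: add_continuous.
  move=> k _; apply: cvg_norm; apply: (dq_cvg (dPhi k x)).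
    by rewrite -oppr0; exact: cvgN.
  by move=> j; rewrite oppr_eq0.
have bnd_le' j x : setT x -> `|bnd j x| <= L * (m%:R * MS) * Mp * \1_(cube M1) x.
  move=> _; rewrite indicE; have [xM|xM] := pselect (cube M1 x).
    by rewrite mem_set// mulr1; exact: bnd_le.
  by rewrite memNset// mulr0 bnd0// normr0.
have [_ cvg2] := Rintegral_dominated_cvg measurableT (fun j => mc _ (cbnd j))
  (mc _ (cM _ _ (cM _ _ (cc L) cS) (cnorm _ cphi))) bnd_cvg (icM _) bnd_le'.
(* Both sides are limits of their difference-quotient versions. For a fixed step the inequality
   follows from discrete integration by parts and the increment bound on [F], the factor [|h|^-1]
   being common to both sides. *)
apply: ler_cvg_to (cvg_norm cvg1) cvg2 _; apply: nearW => j.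
rewrite Rintegral_mul_dq ?normrN; last 3 first.
- apply: (bsi _ (MF * Mp)).
  + by apply: (cM) => //; exact: cshift.
  + move=> x xM; rewrite normrM ler_pM//; first by apply: MFF; exact: (cubeS _ _ M12).
    by apply: Mphi; exact: cube_shift.
  + by move=> x xM; rewrite phi0s// mulr0.
- apply: (bsi _ (MF * Mp)).
  + exact: (cM).
  + move=> x xM; rewrite normrM ler_pM//; first by apply: MFF; exact: (cubeS _ _ M12).
    by apply: Mphi; exact: (cubeS _ _ M12).
  + by move=> x xM; rewrite phi0'// mulr0.
- apply: (bsi _ (MF * Mp)).
  + by apply: (cM) => //; exact: cshift.
  + move=> x xM; rewrite normrM ler_pM//.
      by apply: MFF; apply: cube_shift => //; rewrite normrN.
    by apply: Mphi; exact: (cubeS _ _ M12).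
  + by move=> x xM; rewrite phi0'// mulr0.
have le1 x : `|dq F v (- h j) x * phi x| <= bnd j x.
  rewrite normrM ler_wpM2r// /dq normrM.
  under eq_bigr do rewrite normrM.
  by rewrite -mulr_sumr mulrCA ler_wpM2l.
have ibnd : mu.-integrable setT (EFin \o bnd j).
  by apply: (bsi _ (L * (m%:R * MS) * Mp)) => //; [exact: bnd_le|exact: bnd0].
have idq : mu.-integrable setT (EFin \o (fun x => dq F v (- h j) x * phi x)).
  apply: le_integrablef ibnd => //.
  by apply: mc; apply: (cM) => //; exact: continuous_dq.
apply: le_trans (le_normr_Rintegral _ idq) _ => //; apply: le_Rintegral => //.
by move/integrable_norm : idq.
Qed.

End translation_estimate.

(** * Test functions and classical derivatives *)

Section test_functions.
Context {R : realType} (n : nat).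
Local Notation E := 'rV[R]_n.
Local Notation mu := (@lebesgue_rV R n).
Implicit Types (U : set E) (f g phi psi : E -> R) (i : 'I_n).

Lemma smooth_continuous f : smooth f -> continuous f.
Proof. by move=> /(_ 0%N). Qed.

Lemma smooth_derivable f i x : smooth f -> derivable f x (e_ i).
Proof. by move=> /(_ 1%N)[_ /(_ i)[]]. Qed.

Lemma smooth_partial f i : smooth f -> smooth ('D_(e_ i) f).
Proof. by move=> sf k; have [_ /(_ i)[]] := sf k.+1. Qed.

Lemma continuous_partial f i : smooth f -> continuous ('D_(e_ i) f).
Proof. by move=> /smooth_partial => /(_ i) /smooth_continuous. Qed.

Lemma smooth_measurable f : smooth f -> measurable_fun setT f.
Proof. by move=> /smooth_continuous; exact: continuous_measurable_rV. Qed.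

Lemma derivable_lin f g (c : R) x v : derivable f x v -> derivable g x v ->
  derivable (fun x => f x + c * g x) x v /\
  'D_v (fun x => f x + c * g x) x = 'D_v f x + c * 'D_v g x.
Proof.
move=> df dg; have dcg : derivable (c *: g) x v by exact: derivableZ.
split; first exact: (derivableD df dcg).
by rewrite (deriveD df dcg) deriveZ.
Qed.

Lemma Ck_lin k f g (c : R) : Ck k f -> Ck k g -> Ck k (fun x => f x + c * g x).
Proof.
have contl f' g' : continuous f' -> continuous g' -> continuous (fun x => f' x + c * g' x).
  move=> cf cg; apply: continuous_addf => //.
  by apply: continuous_mulf => //; exact: continuous_cst.
elim: k f g => [|k IH] f g /=; first exact: contl.
move=> [cf Hf] [cg Hg]; split; first exact: contl.
move=> i; have [df Cf] := Hf i; have [dg Cg] := Hg i; split.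
  by move=> x; have [] := derivable_lin c (df x) (dg x).
rewrite (_ : 'D_(e_ i) (fun x => f x + c * g x) =
  (fun x => 'D_(e_ i) f x + c * 'D_(e_ i) g x)); first exact: IH.
by apply/funext => x; have [] := derivable_lin c (df x) (dg x).
Qed.

Lemma smooth_lin f g (c : R) : smooth f -> smooth g -> smooth (fun x => f x + c * g x).
Proof. by move=> sf sg k; exact: Ck_lin. Qed.

Lemma Ck_cst0 k : Ck k (cst 0 : E -> R).
Proof.
elim: k => [|k IH]; first exact: continuous_cst.
split; first exact: continuous_cst.
move=> i; split; first by move=> x; exact: derivable_cst.
rewrite (_ : 'D_(e_ i) _ = cst 0)//.
by apply/funext => x; rewrite derive_cst.
Qed.

Lemma tsupport_out phi x : ~ tsupport phi x -> phi x = 0.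
Proof.
move=> /(contra_not (@subset_closure _ _ x)) /negP.
by rewrite negbK => /eqP.
Qed.

Lemma derive_tsupport_out phi v x : ~ tsupport phi x -> 'D_v phi x = 0.
Proof.
move=> nx; have : nbhs x (~` tsupport phi).
  by apply: open_nbhs_nbhs; split => //; exact/closed_openC/closed_closure.
move=> nbx.
rewrite (@near_eq_derive _ _ _ phi (cst 0))//; first by rewrite derive_cst.
by near do [apply: tsupport_out].
Unshelve. all: by end_near. Qed.

Section test.
Variables (U : set E) (phi : E -> R).
Hypothesis tphi : test_function U phi.

Let smphi : smooth phi. Proof. by case: tphi. Qed.

Lemma test_smooth : smooth phi. Proof. exact: smphi. Qed.

Lemma test_compact : compact (tsupport phi). Proof. by case: tphi. Qed.

Lemma test_sub : tsupport phi `<=` U. Proof. by case: tphi. Qed.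

Lemma test_bounded_support : bounded_set (tsupport phi).
Proof. exact/compact_bounded/test_compact. Qed.

Lemma test_out x : ~ U x -> phi x = 0.
Proof. by move=> Ux; apply: tsupport_out => /test_sub. Qed.

Lemma test_partial_out i x : ~ U x -> 'D_(e_ i) phi x = 0.
Proof. by move=> Ux; apply: derive_tsupport_out => /test_sub. Qed.

Lemma test_bounded : exists2 M, 0 <= M & forall x, `|phi x| <= M * \1_(tsupport phi) x.
Proof.
have [M M0 MP] := continuous_bounded_on test_bounded_support (smooth_continuous smphi).
exists M => // x; rewrite indicE; have [xs|xs] := pselect (tsupport phi x).
  by rewrite mem_set// mulr1 MP.
by rewrite memNset// mulr0 tsupport_out// normr0.
Qed.

Lemma test_partial_bounded i :
  exists2 M, 0 <= M & forall x, `|'D_(e_ i) phi x| <= M * \1_(tsupport phi) x.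
Proof.
have [M M0 MP] := continuous_bounded_on test_bounded_support (continuous_partial (i := i) smphi).
exists M => // x; rewrite indicE; have [xs|xs] := pselect (tsupport phi x).
  by rewrite mem_set// mulr1 MP.
by rewrite memNset// mulr0 derive_tsupport_out// normr0.
Qed.

End test.

Lemma test_lin U phi psi (c : R) : test_function U phi -> test_function U psi ->
  test_function U (fun x => phi x + c * psi x).
Proof.
move=> tp tq.
have S : tsupport (fun x => phi x + c * psi x) `<=` tsupport phi `|` tsupport psi.
  rewrite /tsupport -closureU; apply: closureS => x /= /eqP H.
  have [p0|p0] := eqVneq (phi x) 0; last by left.
  by right; apply/eqP => q0; apply: H; rewrite p0 q0 mulr0 addr0.
split.
- by apply: smooth_lin; [exact: test_smooth tp|exact: test_smooth tq].
- apply: subclosed_compact S; first exact: closed_closure.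
  by apply: compactU; [exact: test_compact tp|exact: test_compact tq].
- by move=> x /S[/(test_sub tp)|/(test_sub tq)].
Qed.

Lemma test_cst0 U : test_function U (cst 0).
Proof.
have E0 : tsupport (cst 0 : E -> R) = set0.
  by rewrite /tsupport (_ : mkset _ = set0) ?closure0//; apply/seteqP; split => x //=; rewrite eqxx.
split; first by move=> k; exact: Ck_cst0.
  by rewrite E0; exact: compact0.
by rewrite E0.
Qed.

Lemma Rintegral_support U f : (forall x, ~ U x -> f x = 0) ->
  \int[mu]_(x in U) f x = \int[mu]_x f x.
Proof.
move=> f0; rewrite Rintegral_mkcond; apply: eq_Rintegral => x _.
by rewrite patchE; case: ifPn => // /negP; rewrite inE => /f0 ->.
Qed.

Lemma continuous_test_integrable U f phi : continuous f -> test_function U phi ->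
  mu.-integrable setT (EFin \o (fun x => f x * phi x)).
Proof.
move=> cf tp.
have [M M0 MP] := test_bounded tp.
have [Mf Mf0 MfP] := continuous_bounded_on (test_bounded_support tp) cf.
apply: (@bounded_support_integrable _ _ _ _ (tsupport phi) _ (Mf * M)).
- exact: (compact_measurable_rV (test_compact tp)).
- exact: (compact_lty (test_compact tp)).
- apply: continuous_measurable_rV; apply: continuous_mulf => //.
  exact: (smooth_continuous (test_smooth tp)).
- move=> x; have := MP x; rewrite indicE; have [xs|xs] := pselect (tsupport phi x).
    by rewrite mem_set// !mulr1 normrM => ?; rewrite ler_pM// MfP.
  by rewrite memNset// !mulr0 tsupport_out// mulr0 normr0.
Qed.

Lemma continuous_test_partial_integrable U f phi i : continuous f -> test_function U phi ->
  mu.-integrable setT (EFin \o (fun x => f x * 'D_(e_ i) phi x)).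
Proof.
move=> cf tp.
have [M M0 MP] := test_partial_bounded tp i.
have [Mf Mf0 MfP] := continuous_bounded_on (test_bounded_support tp) cf.
apply: (@bounded_support_integrable _ _ _ _ (tsupport phi) _ (Mf * M)).
- exact: (compact_measurable_rV (test_compact tp)).
- exact: (compact_lty (test_compact tp)).
- apply: continuous_measurable_rV; apply: continuous_mulf => //.
  exact: (continuous_partial (test_smooth tp)).
- move=> x; have := MP x; rewrite indicE; have [xs|xs] := pselect (tsupport phi x).
    by rewrite mem_set// !mulr1 normrM => ?; rewrite ler_pM// MfP.
  by rewrite memNset// !mulr0 derive_tsupport_out// mulr0 normr0.
Qed.

(** The translation estimate with the constant 1 as [F]: its increments vanish, so the Lipschitz
    constant may be taken to be 0. *)
Lemma Rintegral_partial0 f i (B : set E) : continuous f ->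
  (forall x, derivable f x (e_ i)) -> continuous ('D_(e_ i) f) ->
  bounded_set B -> (forall x, ~ B x -> f x = 0) ->
  \int[mu]_x ('D_(e_ i) f x) = 0.
Proof.
move=> cf df cDf bB f0; apply/eqP; rewrite -normr_le0.
have D0 : 'D_(e_ i) (cst 0 : E -> R) = cst 0 by apply/funext => x; rewrite derive_cst.
have cE (c : R) : continuous (cst c : E -> R) by exact: continuous_cst.
have H : `|\int[mu]_x (1 * 'D_(e_ i) f x)| <=
    \int[mu]_x (0 * (\sum_(k < 1) `|'D_(e_ i) (cst 0 : E -> R) x|) * `|f x|).
  apply: (@Rintegral_mul_derive_le R n 1 (cst 1) f (fun _ => cst 0) (e_ i) 0 B
    (cE 1) cf df cDf bB f0 (fun=> cE 0)).
  - by move=> _ x; exact: derivable_cst.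
  - by move=> _; rewrite D0.
  - exact: lexx.
  - by move=> x y; rewrite subrr normr0 mul0r.
rewrite (_ : (fun x => 1 * 'D_(e_ i) f x) = 'D_(e_ i) f) in H; last first.
  by apply/funext => x; rewrite mul1r.
apply: le_trans H _; rewrite (_ : (fun x => _ * _ * _) = cst 0).
  by rewrite Rintegral_cst// mul0r.
by apply/funext => x; rewrite !mul0r.
Qed.

(** Classical integration by parts: the product [f * phi] vanishes off a bounded set, so its partial
    derivative has integral zero. *)
Lemma smooth_weak_partial U f i : open U -> smooth f -> weak_partial U i f ('D_(e_ i) f).
Proof.
move=> oU sf.
have L g : continuous g -> L1loc U g.
  move=> cg; split; first by apply: measurable_funTS; exact: continuous_measurable_rV.
  move=> K cK KU; have := continuous_integrable (compact_measurable_rV cK) (compact_bounded cK) cg.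
  by move=> /integrableP[].
split; [exact/L/smooth_continuous|exact/L/continuous_partial|move=> phi tp].
have sp := test_smooth tp.
rewrite Rintegral_support; last by move=> x Ux; rewrite (test_partial_out tp)// mulr0.
rewrite [X in _ = - X]Rintegral_support; last by move=> x Ux; rewrite (test_out tp)// mulr0.
have i1 := continuous_test_partial_integrable i (smooth_continuous sf) tp.
have i2 := continuous_test_integrable (continuous_partial (i := i) sf) tp.
apply/eqP; rewrite -addr_eq0 -RintegralD//; apply/eqP.
have dM x : 'D_(e_ i) (f * phi) x = f x * 'D_(e_ i) phi x + 'D_(e_ i) f x * phi x.
  rewrite deriveM; [|exact: smooth_derivable|exact: smooth_derivable].
  by rewrite [in RHS](mulrC _ (phi x)).
rewrite -(@Rintegral_partial0 (f * phi) i (tsupport phi)).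
- by apply: eq_Rintegral => x _; rewrite dM.
- by apply: continuous_mulf; exact: smooth_continuous.
- by move=> x; apply: derivableM; exact: smooth_derivable.
- rewrite (_ : 'D_(e_ i) (f * phi) = fun x => f x * 'D_(e_ i) phi x + 'D_(e_ i) f x * phi x).
    apply: continuous_addf; apply: continuous_mulf;
      by [exact: smooth_continuous|exact: continuous_partial].
  by apply/funext.
- exact: test_bounded_support tp.
- by move=> x xs; change (f x * phi x = 0); rewrite (tsupport_out xs) mulr0.
Qed.

End test_functions.

(** * Bump functions and uniqueness of weak derivatives *)

Section flat.
Context {R : realType}.
Implicit Types (P : {poly R}) (x y : R).

Definition flat P x : R := if 0 < x then P.[x^-1] * expR (- x^-1) else 0.

Lemma flat_le0 P x : x <= 0 -> flat P x = 0.
Proof. by move=> x0; rewrite /flat ltNge x0. Qed.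

(** For [k > 0], raise [y / k <= expR (y / k)] to the power [k]. *)
Lemma exprn_expRN_le k y : 0 <= y -> y ^+ k * expR (- y) <= k%:R ^+ k.
Proof.
case: k => [|k] y0; first by rewrite !expr0 mul1r expR_le1 oppr_le0.
rewrite expRN ler_pdivrMr ?expR_gt0//.
have k0 : 0 < k.+1%:R :> R by [].
rewrite (_ : expR y = expR (y / k.+1%:R) ^+ k.+1); last first.
  by rewrite -expRM_natl mulrCA divff ?mulr1 ?gt_eqF.
rewrite -exprMn lerXn2r// ?nnegrE ?mulr_ge0 ?expR_ge0//.
rewrite -ler_pdivrMl// mulrC (le_trans _ (expR_ge1Dx _))// ?lerDr//.
Qed.

Lemma poly_norm_le P y : 1 <= y ->
  `|P.[y]| <= (\sum_(i < size P) `|P`_i|) * y ^+ size P.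
Proof.
move=> y1; rewrite horner_coef (le_trans (ler_norm_sum _ _ _))// mulr_suml.
apply: ler_sum => i _; rewrite normrM ler_wpM2l// normrX ger0_norm; last lra.
by apply: ler_weXn2l => //; exact: ltnW.
Qed.

(** The exponential absorbs two powers of [x^-1] beyond the size of [P]. A quadratic bound is what
    makes the difference quotient at 0 tend to 0; [x <= 1] ensures [x^-1 >= 1], where the polynomial
    is bounded by its top power. *)
Lemma flat_le_sqr P : exists2 C, 0 <= C & forall x, x <= 1 -> `|flat P x| <= C * x ^+ 2.
Proof.
pose S := \sum_(i < size P) `|P`_i|.
have S0 : 0 <= S by exact: sumr_ge0.
exists (S * (size P).+2%:R ^+ (size P).+2); first by rewrite mulr_ge0// exprn_ge0.
move=> x x1; rewrite /flat; case: ifPn => x0; last first.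
  by rewrite normr0 mulr_ge0 ?sqr_ge0// mulr_ge0// exprn_ge0.
have y1 : 1 <= x^-1 by rewrite invf_ge1.
have y0 : 0 < x^-1 by rewrite invr_gt0.
rewrite normrM (ger0_norm (expR_ge0 _)) -mulrA.
apply: (@le_trans _ _ (S * (x^-1 ^+ size P * expR (- x^-1)))).
  by rewrite mulrA ler_wpM2r ?expR_ge0// poly_norm_le.
rewrite ler_wpM2l// -ler_pdivrMr ?exprn_gt0//.
apply: le_trans (exprn_expRN_le _ (ltW y0)).
by rewrite mulrAC -exprVn -exprD addn2.
Qed.

(* The family [flat P] is closed under derivation, which reduces smoothness of the bump
   functions to an induction on the order. *)
Lemma is_derive_flat P x :
  is_derive x 1 (flat P) (flat ('X^2 * (P - P^`())) x).
Proof.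
have [x0|x0|->] := ltgtP x 0.
- rewrite flat_le0 ?ltW//; apply: (near_eq_is_derive _ (is_derive_cst 0 x 1)).
  by near=> y; rewrite flat_le0//; near: y; exact: lt_le_nbhsl.
- rewrite [X in is_derive _ _ _ X]/flat x0.
  pose g t := P.[t^-1] * expR (- t^-1).
  have dV : is_derive x 1 (fun t : R => t^-1) (- x ^- 2).
    apply: (is_derive_eq (@is_deriveV R id x 1 1 _ (is_derive_id x 1))).
      by rewrite gt_eqF.
    by rewrite [LHS]mulr1.
  have dP := @is_derive1_comp R (horner P) _ x _ _ (is_derive_poly P x^-1) dV.
  have dE := @is_derive1_comp R expR _ x _ _ (is_derive_expR (- x^-1)) (is_deriveN dV).
  apply: (@near_eq_is_derive _ _ _ ((horner P \o (fun t => t^-1)) *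
     (expR \o (- (fun t => t^-1)))) ).
    by near=> t; rewrite /flat ifT//; near: t; exact: lt_nbhsr.
  apply: (is_derive_eq (is_deriveM dP dE)).
  rewrite !hornerE /= -!exprVn /GRing.scale /=.
  set y := x^-1; ring.
- rewrite (flat_le0 _ (lexx 0)).
  have [C C0 CP] := flat_le_sqr P.
  have Hc : h^-1 *: ((flat P \o shift 0) (h *: (1 : R)) - flat P 0) @[h --> 0^'] --> (0 : R).
    apply/cvgrPdist_le => e e0; near=> h.
    rewrite sub0r normrN /= (flat_le0 _ (lexx 0)) subr0 addr0 [h *: 1]mulr1.
    have h0 : h != 0 by near: h; exact: nbhs_dnbhs_neq.
    have hC : `|h| < Num.min 1 (e / (C + 1)).
      by near: h; apply: dnbhs0_lt; rewrite lt_min ltr01 divr_gt0// ltr_wpDl.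
    move: hC; rewrite lt_min => /andP[h1 he].
    rewrite [_ *: _]/(_ * _) normrM normfV ler_pdivrMl ?normr_gt0//.
    rewrite (le_trans (CP _ _))//; first by rewrite (le_trans (ler_norm _))// ltW.
    rewrite (_ : h ^+ 2 = `|h| * `|h|); last by rewrite -expr2 real_normK ?num_real.
    rewrite mulrA [leRHS]mulrC ler_wpM2r//.
    rewrite (@le_trans _ _ ((C + 1) * `|h|))// ?ler_wpM2r// ?lerDl//.
    by rewrite mulrC -ler_pdivlMr ?ltr_wpDl// ltW.
  split; first by apply/cvg_ex; exists 0.
  exact: cvg_lim Hc.
Unshelve. all: by end_near. Qed.

Lemma flat1_ge0 x : 0 <= flat 1 x.
Proof. by rewrite /flat hornerC mul1r; case: ifP => // _; exact: expR_ge0. Qed.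

Lemma flat1_le1 x : flat 1 x <= 1.
Proof.
rewrite /flat hornerC mul1r; case: ifPn => // x0.
by rewrite expR_le1 oppr_le0 invr_ge0 ltW.
Qed.

Lemma flat1_scale_cvg x : 0 < x -> flat 1 (k.+1%:R * x) @[k --> \oo] --> (1 : R).
Proof.
move=> x0.
have E : (fun k : nat => flat 1 (k.+1%:R * x)) = expR \o (fun k : nat => - (harmonic k * x^-1)).
  apply/funext => k; rewrite /flat hornerC mul1r mulr_gt0// /=.
  by rewrite invfM.
rewrite E -expR0; apply: continuous_cvg; first exact: continuous_expR.
rewrite -oppr0; apply: cvgN; rewrite -(mul0r x^-1); apply: cvgM; last exact: cvg_cst.
exact: cvg_harmonic.
Qed.

End flat.

Section smooth_bumps.
Context {R : realType} (n : nat).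
Local Notation E := 'rV[R]_n.
Implicit Types (f g : E -> R).

(** A class that contains the bump functions and is stable under partial derivatives, so that
    smoothness follows by induction on the order with no explicit formula for higher derivatives. *)
Inductive flat_form : (E -> R) -> Prop :=
| flat_form_cst c : flat_form (fun _ => c)
| flat_form_flat (a b : R) (i : 'I_n) P : flat_form (fun x => flat P (a * x 0 i + b))
| flat_form_add f g : flat_form f -> flat_form g -> flat_form (fun x => f x + g x)
| flat_form_mul f g : flat_form f -> flat_form g -> flat_form (fun x => f x * g x).

Lemma is_derive_line f (x v : E) (l : R) :
  is_derive (0 : R) (1 : R) (fun t : R => f (t *: v + x)) l -> is_derive x v f l.
Proof.
have E : (fun h : R => h^-1 *:
      (((fun t : R => f (t *: v + x)) \o shift 0) (h *: (1 : R)) - f (0 *: v + x))) =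
    (fun h : R => h^-1 *: ((f \o shift x) (h *: v) - f x)).
  by apply/funext => h /=; rewrite addr0 [h *: 1]mulr1 scale0r add0r.
move=> [d l_]; split.
- by move: d; rewrite /derivable E.
- by move: l_; rewrite /derive E.
Qed.

Lemma flat_form_partial f i : flat_form f ->
  exists2 g, flat_form g & forall x, is_derive x (e_ i) f (g x).
Proof.
elim=> [c|a b j P|f1 g1 Ff [f1' Ff' df] Fg [g1' Fg' dg]|f1 g1 Ff [f1' Ff' df] Fg [g1' Fg' dg]].
- exists (fun _ => 0); first exact: flat_form_cst.
  by move=> x; exact: is_derive_cst.
- set c : R := (e_ i : E) 0 j.
  exists (fun x => flat ('X^2 * (P - P^`())) (a * x 0 j + b) * (a * c)).
    by apply: flat_form_mul; [exact: flat_form_flat|exact: flat_form_cst].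
  move=> x; apply: is_derive_line.
  pose l (t : R) := a * (t * c + x 0 j) + b.
  have dl : is_derive (0 : R) (1 : R) l (a * c).
    have -> : l = (a * c) *: id + cst (a * x 0 j + b).
      by apply/funext => t; change (l t = (a * c) * t + (a * x 0 j + b)); rewrite /l; ring.
    apply: (is_derive_eq (is_deriveD (is_deriveZ _ (is_derive_id _ _)) (is_derive_cst _ _ _))).
    by rewrite addr0 [LHS]mulr1.
  have l0 : l 0 = a * x 0 j + b by rewrite /l mul0r add0r.
  have E2 : flat P \o l = (fun t : R => flat P (a * (t *: e_ i + x) 0 j + b)).
    by apply/funext => t; rewrite /= /l [in RHS]mxE [in RHS]mxE.
  by rewrite -E2 -l0; exact: is_derive1_comp (is_derive_flat P (l 0)) dl.
- exists (fun x => f1' x + g1' x); first exact: flat_form_add.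
  by move=> x; exact: (is_deriveD (df x) (dg x)).
- exists (fun x => f1 x * g1' x + g1 x * f1' x).
    by apply: flat_form_add; apply: flat_form_mul.
  by move=> x; exact: (is_deriveM (df x) (dg x)).
Qed.

Lemma continuous_coord i : continuous (fun x : E => x 0 i).
Proof. exact: coord_continuous. Qed.

Lemma continuous_flat (P : {poly R}) : continuous (flat P).
Proof.
move=> t; apply: differentiable_continuous; apply/derivable1_diffP.
by have [] := is_derive_flat P t.
Qed.

Lemma flat_form_continuous f : flat_form f -> continuous f.
Proof.
elim=> [c|a b i P|f1 g1 _ cf _ cg|f1 g1 _ cf _ cg].
- exact: continuous_cst.
- have cl : continuous (fun x : E => a * x 0 i + b).
    apply: continuous_addf; last exact: continuous_cst.
    apply: continuous_mulf; first exact: continuous_cst.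
    exact: continuous_coord.
  by apply: continuous_compf => //; exact: continuous_flat.
- exact: continuous_addf.
- exact: continuous_mulf.
Qed.

Lemma flat_form_smooth f : flat_form f -> smooth f.
Proof.
move=> + k; elim: k f => [|k IH] f Ff /=; first exact: flat_form_continuous.
split=> [|i]; first exact: flat_form_continuous.
have [g Fg dg] := flat_form_partial i Ff; split; first by move=> x; have [] := dg x.
rewrite (_ : 'D_(e_ i) f = g); first exact: IH.
by apply/funext => x; have [] := dg x.
Qed.

(** Each face of the box contributes a one-sided flat factor; the dilation by [k.+1] makes the
    product tend to the indicator of the open box as [k] grows. *)
Definition bump (a b : E) (k : nat) (x : E) : R :=
  \prod_i (flat 1 (k.+1%:R * (x 0 i - a 0 i)) * flat 1 (k.+1%:R * (b 0 i - x 0 i))).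

Lemma bump_smooth a b k : smooth (bump a b k).
Proof.
apply: flat_form_smooth.
pose h i (x : E) := flat 1 (k.+1%:R * (x 0 i - a 0 i)) * flat 1 (k.+1%:R * (b 0 i - x 0 i)).
have Fh i : flat_form (h i).
  have -> : h i = (fun x : E => flat 1 (k.+1%:R * x 0 i + - (k.+1%:R * a 0 i)) *
      flat 1 (- k.+1%:R * x 0 i + k.+1%:R * b 0 i)).
    by apply/funext => x; rewrite /h; congr (flat _ _ * flat _ _); ring.
  by apply: flat_form_mul; exact: flat_form_flat.
suff H s : flat_form (fun x => \prod_(i <- s) h i x) by exact: H.
elim: s => [|i s IH].
  have -> : (fun x => \prod_(i <- [::]) h i x) = (fun _ => 1).
    by apply/funext => x; rewrite big_nil.
  exact: flat_form_cst.
have -> : (fun x => \prod_(j <- i :: s) h j x) = (fun x => h i x * \prod_(j <- s) h j x).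
  by apply/funext => x; rewrite big_cons.
exact: flat_form_mul.
Qed.

Lemma bump_ge0 a b k x : 0 <= bump a b k x.
Proof. by apply: prodr_ge0 => i _; rewrite mulr_ge0// flat1_ge0. Qed.

Lemma bump_le1 a b k x : bump a b k x <= 1.
Proof.
by apply: prodr_ile1 => i _; rewrite mulr_ge0 ?flat1_ge0//= mulr_ile1 ?flat1_ge0 ?flat1_le1.
Qed.

Lemma bump_out a b k x : ~ open_box a b x -> bump a b k x = 0.
Proof.
move=> /existsNP[i /negP]; rewrite negb_and => H.
apply/eqP; rewrite prodf_seq_eq0; apply/hasP; exists i; first by rewrite mem_index_enum.
rewrite /= mulf_eq0; move: H; rewrite -!leNgt => /orP[H|H].
- by rewrite flat_le0 ?eqxx// pmulr_rle0// subr_le0.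
- by rewrite [X in _ || (X == _)]flat_le0 ?eqxx ?orbT// pmulr_rle0// subr_le0.
Qed.

Lemma bump_cvg a b x : open_box a b x -> bump a b k x @[k --> \oo] --> (1 : R).
Proof.
move=> xab; have E1 : (1 : R) = \prod_(i < n) 1 by rewrite big1.
rewrite [X in _ --> X]E1.
apply: cvg_big; first exact: mul_continuous.
move=> i _; rewrite -[X in _ --> X]mulr1; have /andP[ax xb] := xab i.
by apply: cvgM; apply: flat1_scale_cvg; rewrite subr_gt0.
Qed.

Lemma compact_closed_box (a b : E) : compact (closed_box a b).
Proof.
have -> : closed_box a b = [set x : E | forall i, `[a 0 i, b 0 i]%classic (x ord0 i)].
  by apply/seteqP; split => x H i; have := H i; rewrite /= in_itv.
by apply: (rV_compact (A := fun i => `[a 0 i, b 0 i]%classic)) => i; exact: segment_compact.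
Qed.

Lemma closed_closed_box (a b : E) : closed (closed_box a b).
Proof. by apply: compact_closed; [exact: norm_hausdorff|exact: compact_closed_box]. Qed.

Lemma bump_test (U : set E) (a b : E) k : closed_box a b `<=` U -> test_function U (bump a b k).
Proof.
move=> bU.
have S : tsupport (bump a b k) `<=` closed_box a b.
  rewrite [X in _ `<=` X](closure_id _).1; last exact: closed_closed_box.
  apply: closureS => x /eqP xb; apply: open_closed_box.
  by apply: contrapT => /bump_out.
split; first exact: bump_smooth.
- by apply: subclosed_compact S; [exact: closed_closure|exact: compact_closed_box].
- by move=> x /S /bU.
Qed.

End smooth_bumps.

(** * Fundamental lemma of the calculus of variations *)

Section fundamental_lemma.
Context {R : realType} (n : nat).
Local Notation E := 'rV[R]_n.
Local Notation mu := (@lebesgue_rV R n).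
Implicit Types (U K : set E) (u w phi : E -> R) (i : 'I_n).

(** The sets over which [w] integrates to zero form a Dynkin system, the hypothesis on [D] itself
    providing complements; the pi-lambda theorem applies since boxes are stable under
    intersection. *)
Lemma integral_boxes_eq0 (D : set E) w : measurable D ->
  mu.-integrable D (EFin \o w) ->
  (forall a b, \int[mu]_(x in D `&` open_box a b) (w x)%:E = 0)%E ->
  (\int[mu]_(x in D) (w x)%:E = 0)%E ->
  forall A, measurable A -> (\int[mu]_(x in D `&` A) (w x)%:E = 0)%E.
Proof.
move=> mD iw w0 wD0 A mA.
have sub B : measurable B -> mu.-integrable (D `&` B) (EFin \o w).
  move=> mB; apply: integrableS iw => //; exact: measurableI.
move: (mA); rewrite [X in X A]g_sigma_open_boxes.
apply: (dynkin_induction (P := fun A => (\int[mu]_(x in D `&` A) (w x)%:E = 0)%E)).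
- exact: g_sigma_open_boxes.
- exact: setI_closed_open_boxes.
- by rewrite setIT.
- by move=> _ [[a b] _ <-]; exact: w0.
- move=> S mS S0; move: wD0; rewrite -{1}(setIT D) -(setUv S) setIUr integral_setU_EFin//.
  + by rewrite S0 add0e.
  + exact: measurableI.
  + by apply: measurableI => //; exact: measurableC.
  + rewrite -setIUr setUv setIT; exact: (integrable_measurable iw).
  + by apply/disj_setPLR => x [_ ?] [_]; exact.
- move=> F mF tF F0; rewrite setI_bigcupr integral_bigcup.
  + by apply: eseries0 => k _ _; exact: F0.
  + apply/trivIsetP => i j _ _ ij; rewrite setIACA setIid.
    by move/trivIsetP : tF => /(_ i j I I ij) ->; rewrite setI0.
  + by move=> k; exact: measurableI.
  + rewrite -setI_bigcupr; apply: sub; exact: bigcupT_measurable.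
Qed.

(** Integrating over [w >= 0] and over its complement shows that [|w|] has integral zero. *)
Lemma ae_eq0_of_boxes (D : set E) w : measurable D ->
  mu.-integrable D (EFin \o w) ->
  (forall a b, \int[mu]_(x in D `&` open_box a b) (w x)%:E = 0)%E ->
  (\int[mu]_(x in D) (w x)%:E = 0)%E ->
  \forall x \ae mu, D x -> w x = 0.
Proof.
move=> mD iw w0 wD0; have mw := integrable_measurable iw.
have H := integral_boxes_eq0 mD iw w0 wD0.
pose wD := w \_ D.
have mwD : measurable_fun setT wD.
  by apply/(measurable_restrictT _ mD).
pose P := [set x | 0 <= wD x].
have mP : measurable P by rewrite -[P]setTI; exact: measurable_fun_le.
have I1 : (\int[mu]_(x in D `&` P) `|(w x)%:E| = 0)%E.
  rewrite -(H P mP); apply: eq_integral => x; rewrite inE => -[Dx].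
  by rewrite /P /= /wD patchE mem_set//= => w_ge0; rewrite ger0_norm.
have I2 : (\int[mu]_(x in D `&` ~` P) `|(w x)%:E| = 0)%E.
  transitivity (\int[mu]_(x in D `&` ~` P) (-1%:E * (w x)%:E))%E.
    apply: eq_integral => x; rewrite inE => -[Dx].
    rewrite /P /= /wD patchE mem_set//= => /negP; rewrite -ltNge => wlt0.
    by rewrite ltr0_norm// EFinN mulN1e.
  rewrite integralZl//; last 2 first.
  - by apply: measurableI => //; exact: measurableC.
  - apply: integrableS iw => //.
    by apply: measurableI => //; exact: measurableC.
  by rewrite H ?mule0//; exact: measurableC.
have I0 : (\int[mu]_(x in D) `|(w x)%:E| = 0)%E.
  rewrite -{1}(setIT D) -(setUv P) setIUr ge0_integral_setU//.
  - by rewrite I1 I2 adde0.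
  - exact: measurableI.
  - by apply: measurableI => //; exact: measurableC.
  - rewrite -setIUr setUv setIT; apply: measurableT_comp => //.
    exact/measurable_EFinP.
  - by apply/disj_setPLR => x [_ ?] [_]; exact.
move/ae_eq_integral_abs : I0 => /(_ mD) H0.
have /H0 : measurable_fun D (fun x => (w x)%:E) by exact/measurable_EFinP.
by apply: filterS => x /[apply] -[].
Qed.

Lemma subset_integrable U K w : measurable U -> measurable K -> K `<=` U ->
  measurable_fun U w -> (forall x, U x -> ~ K x -> w x = 0) ->
  mu.-integrable K (EFin \o w) -> mu.-integrable U (EFin \o w).
Proof.
move=> mU mK KU mw w0 iK.
apply: (eq_integrable mU ((EFin \o w) \_ K)).
  move=> x; rewrite inE => Ux; rewrite patchE; case: ifPn => //.
  by move=> /negP; rewrite inE => Kx; rewrite /= w0.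
have [+ _] := integrable_restrict mu mK mU (EFin \o w); apply; rewrite setIidr//.
Qed.

Lemma subset_Rintegral U K w : K `<=` U -> (forall x, U x -> ~ K x -> w x = 0) ->
  \int[mu]_(x in U) w x = \int[mu]_(x in K) w x.
Proof.
move=> KU w0; rewrite Rintegral_mkcond [RHS]Rintegral_mkcond.
apply: eq_Rintegral => x _; rewrite !patchE; case: ifPn => [|].
  rewrite inE => Ux; case: ifPn => // /negP; rewrite inE; exact: w0.
move=> /negP; rewrite inE => Ux; rewrite ifF//; apply/negP; rewrite inE.
by move=> /KU.
Qed.

Lemma L1loc_integrable U w K : open U -> L1loc U w -> compact K -> K `<=` U ->
  mu.-integrable K (EFin \o w).
Proof.
move=> oU [mw wK] cK KU; apply/integrableP; split; last exact: wK.
apply/measurable_EFinP; apply: measurable_funS mw => //.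
exact: open_measurable_rV.
Qed.

Lemma L1loc_mul_integrable U w phi K M : open U -> L1loc U w -> compact K -> K `<=` U ->
  measurable_fun setT phi -> (forall x, `|phi x| <= M * \1_K x) ->
  mu.-integrable U (EFin \o (fun x => w x * phi x)).
Proof.
move=> oU lw cK KU mphi phiM.
have mU := open_measurable_rV oU; have mK := compact_measurable_rV cK.
have [mw _] := lw.
have mwphi : measurable_fun U (fun x => w x * phi x).
  by apply: measurable_funM => //; exact: measurable_funTS.
apply: (subset_integrable mU mK KU mwphi).
  move=> x _ Kx; have := phiM x; rewrite indicE memNset// mulr0 normr_le0 => /eqP ->.
  by rewrite mulr0.
have iw := L1loc_integrable oU lw cK KU.
apply: (le_integrablef mK (g := fun x => M * `|w x|)).
- exact: measurable_funS mwphi.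
- move=> x Kx; have := phiM x; rewrite indicE mem_set// mulr1 => H.
  by rewrite normrM mulrC ler_wpM2r.
- by apply: integrable_scalef => //; exact: integrable_norm.
Qed.

Lemma L1loc_test_integrable U w phi : open U -> L1loc U w -> test_function U phi ->
  mu.-integrable U (EFin \o (fun x => w x * phi x)).
Proof.
move=> oU lw tp; have [M _ MP] := test_bounded tp.
apply: L1loc_mul_integrable MP => //.
- exact: test_compact tp.
- exact: test_sub tp.
- exact: smooth_measurable (test_smooth tp).
Qed.

Lemma L1loc_test_partial_integrable U w phi i : open U -> L1loc U w -> test_function U phi ->
  mu.-integrable U (EFin \o (fun x => w x * 'D_(e_ i) phi x)).
Proof.
move=> oU lw tp; have [M _ MP] := test_partial_bounded tp i.
apply: L1loc_mul_integrable MP => //.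
- exact: test_compact tp.
- exact: test_sub tp.
- exact: continuous_measurable_rV (continuous_partial (test_smooth tp)).
Qed.

(** The bumps of the box are test functions because the closed box lies in [U]. They tend to its
    indicator, and [|w|], integrable on the compact box, dominates the products. *)
Lemma Rintegral_open_box_eq0 U w a b : open U -> L1loc U w ->
  (forall phi, test_function U phi -> \int[mu]_(x in U) (w x * phi x) = 0) ->
  closed_box a b `<=` U -> (\int[mu]_(x in open_box a b) (w x)%:E = 0)%E.
Proof.
move=> oU lw w0 abU; set K := closed_box a b; set O := open_box a b.
have cK : compact K := @compact_closed_box R n a b.
have mK := compact_measurable_rV cK.
have mO : measurable O := @measurable_open_box R n a b.
have OK : O `<=` K := @open_closed_box R n a b.
have iw := L1loc_integrable oU lw cK abU.
have mw := integrable_measurable iw.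
have iwO : mu.-integrable O (EFin \o w) by exact: integrableS iw.
pose f k x := w x * bump a b k x.
have mf k : measurable_fun K (f k).
  apply: measurable_funM => //; apply: measurable_funTS.
  exact: smooth_measurable (bump_smooth _ _ _).
have f_cvg x : K x -> f ^~ x @ \oo --> w x * \1_O x.
  move=> Kx; apply: cvgM; first exact: cvg_cst.
  rewrite indicE; have [Ox|Ox] := pselect (O x).
    by rewrite mem_set//; exact: bump_cvg.
  rewrite memNset// (_ : (fun k => bump a b k x) = cst 0); first exact: cvg_cst.
  by apply/funext => k; rewrite bump_out.
have f_le k x : K x -> `|f k x| <= `|w x|.
  move=> _; rewrite normrM -[leRHS]mulr1 ler_wpM2l//.
  by rewrite ger0_norm ?bump_ge0 ?bump_le1.
have mwO : measurable_fun K (fun x => w x * \1_O x).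
  by apply: measurable_funM => //; apply: measurable_funTS; exact: measurable_indic.
have [_] := Rintegral_dominated_cvg mK mf mwO f_cvg (integrable_norm iw) f_le.
rewrite (_ : (fun k => _) = cst 0); last first.
  apply/funext => k; rewrite -(w0 (bump a b k)); last exact: bump_test.
  rewrite [RHS](@subset_Rintegral _ K)// => x _ Kx.
  by rewrite bump_out ?mulr0// => /OK.
move=> /(cvg_lim (@Rhausdorff R)); rewrite lim_cst// => H.
have : \int[mu]_(x in K) (w x * \1_O x) = \int[mu]_(x in O) w x.
  rewrite (@subset_Rintegral K O)//.
    by apply: eq_Rintegral => x; rewrite inE => Ox; rewrite indicE mem_set// mulr1.
  by move=> x _ Ox; rewrite indicE memNset// mulr0.
rewrite -H => /esym wO0.
by rewrite -[LHS]fineK; [congr EFin|exact: integrable_fin_num].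
Qed.

(** In a box whose closure lies in [U], every smaller box has the same property, so [w] vanishes
    almost everywhere there; countably many rational boxes cover [U]. *)
Lemma weak_zero_ae U w : open U -> L1loc U w ->
  (forall phi, test_function U phi -> \int[mu]_(x in U) (w x * phi x) = 0) ->
  \forall x \ae mu, U x -> w x = 0.
Proof.
move=> oU lw w0.
have box_ae a b : closed_box a b `<=` U -> \forall x \ae mu, open_box a b x -> w x = 0.
  move=> abU; apply: ae_eq0_of_boxes.
  - exact: measurable_open_box.
  - apply: integrableS (L1loc_integrable oU lw (@compact_closed_box R n a b) abU).
    + exact: (compact_measurable_rV (@compact_closed_box R n a b)).
    + exact: measurable_open_box.
    + exact: open_closed_box.
  - move=> a' b'; rewrite open_boxI; apply: Rintegral_open_box_eq0 w0 _ => //.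
    apply: subset_trans abU => x xab i; have := xab i; rewrite !mxE ge_max le_min.
    by move=> /andP[/andP[-> _] /andP[-> _]].
  - exact: Rintegral_open_box_eq0 w0 _.
pose q2r (p : 'rV[rat]_n) : E := map_mx ratr p.
(* The codes [k] enumerate the pairs of rational corners; a code of no pair imposes no condition. *)
pose Q k x := if @unpickle ('rV[rat]_n * 'rV[rat]_n)%type k is Some (p, q) then
  closed_box (q2r p) (q2r q) `<=` U -> open_box (q2r p) (q2r q) x -> w x = 0 else True.
have : \forall x \ae mu, forall k, Q k x.
  apply: ae_foralln => k; rewrite /Q; case: unpickle => [[p q]|]; last exact: aeW.
  have [abU|abU] := pselect (closed_box (q2r p) (q2r q) `<=` U).
    by have := box_ae _ _ abU; apply: filterS => x H _.
  by apply: aeW => x /abU.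
apply: filterS => x HQ Ux.
have [p [q [xpq pqU]]] := open_rational_box oU Ux.
by have := HQ (pickle (p, q)); rewrite /Q pickleK; apply.
Qed.

Lemma L1loc_sub U u w : open U -> L1loc U u -> L1loc U w -> L1loc U (fun x => u x - w x).
Proof.
move=> oU lu lw; have [mu_ _] := lu; have [mw _] := lw.
split; first exact: measurable_funB.
move=> K cK KU; have mK := compact_measurable_rV cK.
have := integrable_subf mK (L1loc_integrable oU lu cK KU) (L1loc_integrable oU lw cK KU).
by move=> /integrableP[].
Qed.

Lemma weak_partial_uniq U i u w1 w2 : open U ->
  weak_partial U i u w1 -> weak_partial U i u w2 ->
  \forall x \ae mu, U x -> w1 x = w2 x.
Proof.
move=> oU [_ l1 H1] [_ l2 H2].
have mU := open_measurable_rV oU.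
have : \forall x \ae mu, U x -> w1 x - w2 x = 0.
  apply: weak_zero_ae => //; first exact: L1loc_sub.
  move=> phi tp.
  under eq_Rintegral do rewrite mulrBl.
  rewrite RintegralB//; try exact: L1loc_test_integrable.
  by apply/eqP; rewrite subr_eq0 -eqr_opp -H1// -H2.
by apply: filterS => x /[apply] /eqP; rewrite subr_eq0 => /eqP.
Qed.

Lemma weak_partial_sub U i u1 u2 w1 w2 : open U ->
  weak_partial U i u1 w1 -> weak_partial U i u2 w2 ->
  weak_partial U i (fun x => u1 x - u2 x) (fun x => w1 x - w2 x).
Proof.
move=> oU [lu1 l1 H1] [lu2 l2 H2].
have mU := open_measurable_rV oU.
split; [exact: L1loc_sub|exact: L1loc_sub|move=> phi tp].
under eq_Rintegral do rewrite mulrBl.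
under [in RHS]eq_Rintegral do rewrite mulrBl.
rewrite RintegralB//; try exact: L1loc_test_partial_integrable.
rewrite [in RHS]RintegralB//; try exact: L1loc_test_integrable.
by rewrite H1// H2//; ring.
Qed.

Lemma wpartialP U i u : (exists w, weak_partial U i u w) ->
  weak_partial U i u (wpartial U i u).
Proof. by move=> [w uw]; rewrite /wpartial; case: xgetP => // /(_ w). Qed.

Lemma wpartial_ae U i u w : open U -> weak_partial U i u w ->
  \forall x \ae mu, U x -> wpartial U i u x = w x.
Proof.
move=> oU uw; apply: (weak_partial_uniq oU _ uw).
by apply: wpartialP; exists w.
Qed.

End fundamental_lemma.

(** * Riesz representation on test functions *)

Section summable_limit.
Context d (T : measurableType d) (R : realType) (mu : {measure set T -> \bar R}).

(** The classical completeness argument for L^1: the telescoping series converges absolutely almost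
    everywhere. Its sum of absolute values dominates the whole sequence; it may be infinite on a
    null set, hence the extended-real [S]. *)
Lemma summable_increments_limit (D : set T) (f : (T -> R)^nat) (c : R) : measurable D ->
  (forall k, mu.-integrable D (EFin \o f k)) ->
  (\sum_(0 <= k <oo) \int[mu]_(x in D) (`|f k.+1 x - f k x|)%:E <= c%:E)%E ->
  exists w : T -> R, exists S : T -> \bar R,
    [/\ measurable_fun D w, mu.-integrable D S,
        forall k x, D x -> ((`|f k x|)%:E <= S x)%E &
        \forall x \ae mu, D x -> f ^~ x @ \oo --> w x].
Proof.
move=> mD fi fc.
have mf k := integrable_measurable (fi k).
pose g k x : \bar R := (`|f k.+1 x - f k x|)%:E.
have mg k : measurable_fun D (g k).
  by apply/measurable_EFinP; apply: measurableT_comp => //; exact: measurable_funB.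
pose S x : \bar R := ((`|f 0 x|)%:E + \sum_(0 <= k <oo) g k x)%E.
have g0 k x : (0 <= g k x)%E by rewrite lee_fin.
have sg0 x : (0 <= \sum_(0 <= k <oo) g k x)%E by exact: nneseries_ge0.
have mS0 : measurable_fun D (fun x => \sum_(0 <= k <oo) g k x)%E.
  by apply: ge0_emeasurable_sum.
have iS0 : mu.-integrable D (fun x => \sum_(0 <= k <oo) g k x)%E.
  apply/integrableP; split=> //.
  under eq_integral do rewrite gee0_abs//.
  by rewrite integral_nneseries//; exact: le_lt_trans fc (ltry _).
have iS : mu.-integrable D S.
  by apply: (integrableD mD) => //; exact: integrable_norm.
have teleE k x : f k x = f 0 x + \sum_(0 <= i < k) (f i.+1 x - f i x).
  by rewrite telescope_sumr// addrC subrK.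
(* The upper limit is measurable and exists everywhere, and it is the limit wherever the sequence
   converges. *)
exists (fun x => fine (limn_esup (fun k => (f k x)%:E))), S; split.
- apply: measurableT_comp => //; apply: measurable_fun_limn_esup => k.
  exact/measurable_EFinP.
- exact: iS.
- move=> k x Dx; rewrite (teleE k).
  apply: (@le_trans _ _ ((`|f 0 x|)%:E + (\sum_(0 <= i < k) `|f i.+1 x - f i x|)%:E)%E).
    by rewrite -EFinD lee_fin (le_trans (ler_normD _ _))// lerD2l ler_norm_sum.
  rewrite leeD2l// -sumEFin; exact: nneseries_lim_ge.
- have := integrable_ae mD iS0; apply: filterS => x /[apply] sfin.
  have cs : cvgn (series (telescope (f ^~ x))).
    apply: normed_cvg; apply: nondecreasing_is_cvgn.
      by apply: nondecreasing_series => k _ _ /=.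
    exists (fine (\sum_(0 <= k <oo) g k x)%E) => _ [k _ <-].
    rewrite -lee_fin fineK//.
    apply: (@le_trans _ _ (\sum_(0 <= i < k) g i x)%E); last exact: nneseries_lim_ge.
    by rewrite sumEFin.
  have cf : cvgn (f ^~ x).
    rewrite (_ : f ^~ x = (fun k => f 0 x + series (telescope (f ^~ x)) k)).
      by apply: is_cvgD => //; exact: is_cvg_cst.
    by apply/funext => k; exact: (eq_sum_telescope (f ^~ x)).
  have cfE : (fun k => (f k x)%:E) @ \oo --> (limn (f ^~ x))%:E.
    by apply: cvg_EFin => //; exact: nearW.
  have -> : limn_esup (fun k => (f k x)%:E) = (limn (f ^~ x))%:E.
    rewrite is_cvg_limn_esupE; last by apply/cvg_ex; eexists; exact: cfE.
    exact/cvg_lim.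
  exact: cf.
Qed.

End summable_limit.

Section riesz.
Context {R : realType} (n : nat).
Local Notation E := 'rV[R]_n.
Local Notation mu := (@lebesgue_rV R n).

Lemma quadratic_ge0_discr (a b c : R) : 0 <= c ->
  (forall t, 0 <= a + 2 * t * b + t ^+ 2 * c) -> b ^+ 2 <= a * c.
Proof.
move=> c0 H; have [c_eq0|c_neq0] := eqVneq c 0.
  rewrite c_eq0 mulr0; have [->|b0] := eqVneq b 0; first by rewrite expr0n.
  (* With [c = 0] the polynomial is affine, and this [t] gives it the value -1. *)
  have := H (- (a + 1) / (2 * b)); rewrite c_eq0 mulr0 addr0.
  rewrite (_ : 2 * (- (a + 1) / (2 * b)) * b = - (a + 1)); last by field.
  lra.
have c_gt0 : 0 < c by rewrite lt_neqAle eq_sym c_neq0.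
have := H (- b / c).
rewrite (_ : a + 2 * (- b / c) * b + (- b / c) ^+ 2 * c = a - b ^+ 2 / c); last by field.
by rewrite subr_ge0 ler_pdivrMr.
Qed.

Implicit Types (f g h phi psi : E -> R) (c t : R) (k : nat).
Variables (U : set E) (l : (E -> R) -> R) (C : R).
Hypotheses (oU : open U) (bU : bounded_set U) (C0 : 0 <= C).
Hypothesis l_lin : forall phi psi (c : R), test_function U phi -> test_function U psi ->
  l (fun x => phi x + c * psi x) = l phi + c * l psi.
Let B (f g : E -> R) : R := \int[mu]_(x in U) (f x * g x).
Hypothesis l_bounded : forall phi, test_function U phi -> l phi ^+ 2 <= C * B phi phi.

Let mU : measurable U. Proof. exact: open_measurable_rV. Qed.

Let B_integrable f g : continuous f -> continuous g ->
  mu.-integrable U (EFin \o (fun x => f x * g x)).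
Proof. by move=> cf cg; apply: continuous_integrable => //; exact: continuous_mulf. Qed.

Let test_continuous phi : test_function U phi -> continuous phi.
Proof. by move=> /test_smooth /smooth_continuous. Qed.

Let B_linl f g h c : continuous f -> continuous g -> continuous h ->
  B (fun x => f x + c * g x) h = B f h + c * B g h.
Proof.
move=> cf cg ch; rewrite /B -RintegralZl//; last exact: B_integrable.
rewrite -RintegralD//; last 2 first.
- exact: B_integrable.
- by apply: integrable_scalef => //; exact: B_integrable.
by apply: eq_Rintegral => x _; rewrite mulrDl mulrA.
Qed.

Let BC f g : B f g = B g f.
Proof. by apply: eq_Rintegral => x _; rewrite mulrC. Qed.

Let B_ge0 f : 0 <= B f f.
Proof. by apply: Rintegral_ge0 => x _; rewrite -expr2 sqr_ge0. Qed.

(* A minimizing sequence of the energy converges a.e. to the representative of [l]; an a.e.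
   limit and Fatou's lemma replace the completeness of L^2. *)
Let energy phi := B phi phi - 2 * l phi.

Let energy_expand phi psi t : test_function U phi -> test_function U psi ->
  energy (fun x => phi x + t * psi x) =
  energy phi + 2 * t * (B phi psi - l psi) + t ^+ 2 * B psi psi.
Proof.
move=> tp tq; have cp := test_continuous tp; have cq := test_continuous tq.
have cpq := test_continuous (test_lin t tp tq).
rewrite /energy l_lin// B_linl// [B phi _]BC [B psi (fun _ => _)]BC !B_linl//.
by rewrite [B psi phi]BC; ring.
Qed.

(** Young's inequality: from [l phi ^+ 2 <= C * N] one gets [2 * |l phi| <= 2 * C + N / 2]. The
    bound makes the energy bounded below and controls [B phi phi] along a minimizing sequence. *)
Let energy_ge phi : test_function U phi -> B phi phi / 2 - 2 * C <= energy phi.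
Proof.
move=> tp; rewrite /energy; have l2 := l_bounded tp.
set N := B phi phi in l2 *; have N0 : 0 <= N := B_ge0 phi.
have : `|2 * l phi| <= 2 * C + N / 2.
  rewrite -[leRHS]ger0_norm ?addr_ge0 ?mulr_ge0 ?divr_ge0// -ler_sqr ?nnegrE//.
  rewrite !real_normK ?num_real// -subr_ge0.
  have -> : (2 * C + N / 2) ^+ 2 - (2 * l phi) ^+ 2 =
    (2 * C - N / 2) ^+ 2 + 4 * (C * N - l phi ^+ 2) by field.
  by rewrite addr_ge0 ?sqr_ge0// mulr_ge0// subr_ge0.
by rewrite ler_norml => /andP[_ ?]; lra.
Qed.

Let energies := [set energy phi | phi in test_function U].

Let has_inf_energies : has_inf energies.
Proof.
split; first by exists (energy (cst 0)), (cst 0) => //; exact: test_cst0.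
exists (- (2 * C)) => _ [phi tp <-]; apply: le_trans (energy_ge tp).
by rewrite lerDr divr_ge0// B_ge0.
Qed.

Let m := inf energies.

Let energy_inf phi : test_function U phi -> m <= energy phi.
Proof. by move=> tp; apply: (ge_inf has_inf_energies.2); exists phi. Qed.

(** A geometric tolerance makes the increments of the minimizing sequence summable; the exponent
    [k.+1] is the one for which the powers of 1/2 sum to 1. *)
Let delta k : R := (2 ^ k.+1)%:R^-1.

Let delta_gt0 k : 0 < delta k.
Proof. by rewrite invr_gt0 ltr0n expn_gt0. Qed.

Let minseq k : {phi | test_function U phi & energy phi <= m + delta k ^+ 2}.
Proof.
have d0 : 0 < delta k ^+ 2 by rewrite exprn_gt0.
apply: cid2; have [_ [phi tp <-] /ltW ep] := inf_adherent d0 has_inf_energies.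
by exists phi.
Qed.

Let phi_ k : E -> R := s2val (minseq k).

Let tphi_ k : test_function U (phi_ k).
Proof. exact: s2valP (minseq k). Qed.

Let ephi_ k : energy (phi_ k) <= m + delta k ^+ 2.
Proof. exact: s2valP' (minseq k). Qed.

(** An approximate Euler-Lagrange equation. Along [phi_ k + t * psi] the energy never falls below
    [m], so [delta k ^+ 2 + 2 * t * (B (phi_ k) psi - l psi) + t ^+ 2 * B psi psi] is nonnegative in
    [t] and its discriminant is not positive. *)
Let defect k psi : test_function U psi ->
  (B (phi_ k) psi - l psi) ^+ 2 <= delta k ^+ 2 * B psi psi.
Proof.
move=> tq; apply: quadratic_ge0_discr => // t.
have := energy_inf (test_lin t (tphi_ k) tq).
rewrite (energy_expand t (tphi_ k) tq).
by have := ephi_ k; lra.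
Qed.

Let delta_le k : delta k.+1 <= delta k.
Proof. by rewrite lef_pV2 ?posrE ?ltr0n ?expn_gt0// ler_nat leq_exp2l. Qed.

Let step k (x : E) := phi_ k.+1 x + (-1) * phi_ k x.

Let tstep k : test_function U (step k).
Proof. exact: test_lin. Qed.

(** Tested against the step itself, the two defects differ by exactly [N]; squaring gives
    [N ^+ 2 <= 4 * delta k ^+ 2 * N], and [N] cancels. *)
Let step_le k : B (step k) (step k) <= 4 * delta k ^+ 2.
Proof.
have ts := tstep k; set N := B (step k) (step k).
have [N0|N0] := eqVneq N 0; first by rewrite N0 mulr_ge0// exprn_ge0// ltW.
have Ngt0 : 0 < N by rewrite lt_neqAle eq_sym N0 B_ge0.
have NE : N = (B (phi_ k.+1) (step k) - l (step k)) - (B (phi_ k) (step k) - l (step k)).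
  rewrite /N {1}/step B_linl; last 3 first.
  - exact: test_continuous.
  - exact: test_continuous.
  - exact: test_continuous.
  by ring.
have H1 := defect k.+1 ts; have H2 := defect k ts.
have H3 : delta k.+1 ^+ 2 * N <= delta k ^+ 2 * N.
  by rewrite ler_wpM2r ?B_ge0// lerXn2r// nnegrE ltW.
rewrite -(ler_pM2r Ngt0) -expr2 {1}NE.
move: H1 H2; rewrite -/N; set a := B _ _ - _; set b := B _ _ - _ => H1 H2.
have : 0 <= (a + b) ^+ 2 by exact: sqr_ge0.
have -> : (a - b) ^+ 2 = 2 * a ^+ 2 + 2 * b ^+ 2 - (a + b) ^+ 2 by ring.
lra.
Qed.

Let M0 := fine (mu U).

Let mu_cst c : mu.-integrable U (EFin \o (fun _ => c)).
Proof. by apply: continuous_integrable => //; exact: continuous_cst. Qed.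

(** Young's inequality with weight [delta k]: [|s| <= (delta k + s ^+ 2 / delta k) / 2]. The first
    term integrates to a finite number because [U] is bounded. *)
Let step_L1 k : \int[mu]_(x in U) `|step k x| <= (M0 + 4) / 2 * delta k.
Proof.
have d0 := delta_gt0 k.
have cs : continuous (step k) by exact: test_continuous.
have is2 := integrable_scalef (delta k)^-1 mU (B_integrable cs cs).
have iall := integrable_scalef 2^-1 mU (integrable_addf mU (mu_cst (delta k)) is2).
apply: (@le_trans _ _ (\int[mu]_(x in U)
    (2^-1 * (delta k + (delta k)^-1 * (step k x * step k x))))).
  apply: le_Rintegral => //.
    by apply: continuous_integrable => //; exact: continuous_normf.
  move=> x _; rewrite -subr_ge0.
  have -> : 2^-1 * (delta k + (delta k)^-1 * (step k x * step k x)) - `|step k x| =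
      (2 * delta k)^-1 * (delta k - `|step k x|) ^+ 2.
    rewrite -[step k x * step k x]ger0_norm -?expr2 ?sqr_ge0// normrX.
    by field; rewrite gt_eqF.
  by rewrite mulr_ge0 ?sqr_ge0// invr_ge0 mulr_ge0// ltW.
rewrite RintegralZl//; last exact: integrable_addf.
rewrite RintegralD// Rintegral_cst// RintegralZl//; last exact: B_integrable.
rewrite -/(B (step k) (step k)) -/M0.
have H : (delta k)^-1 * B (step k) (step k) <= 4 * delta k.
  by rewrite ler_pdivrMl// mulrC -mulrA -expr2.
by rewrite mulrAC mulrDl; lra.
Qed.

Let step_sum : (\sum_(0 <= k <oo) \int[mu]_(x in U) (`|phi_ k.+1 x - phi_ k x|)%:E <=
  ((M0 + 4) / 2)%:E)%E.
Proof.
have c0 : 0 <= (M0 + 4) / 2 by rewrite divr_ge0// addr_ge0// fine_ge0.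
apply: le_trans (epsilon_trick0 xpredT c0); apply: lee_nneseries => [k _ _|k _].
  by apply: integral_ge0 => x _; rewrite lee_fin.
have -> : (\int[mu]_(x in U) (`|phi_ k.+1 x - phi_ k x|)%:E =
    (\int[mu]_(x in U) `|step k x|)%:E)%E.
  rewrite [RHS]fineK.
    by apply: eq_integral => x _; rewrite /step mulN1r.
  apply: integrable_fin_num => //; apply: continuous_integrable => //.
  by apply: continuous_normf; exact: test_continuous.
by rewrite lee_fin; exact: step_L1.
Qed.

Lemma riesz_test_functions : exists w : E -> R,
  [/\ measurable_fun U w, mu.-integrable U (EFin \o (fun x => w x ^+ 2)) &
      forall psi, test_function U psi -> l psi = \int[mu]_(x in U) (w x * psi x)].
Proof.
have iphi k : mu.-integrable U (EFin \o phi_ k).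
  by apply: continuous_integrable => //; exact: test_continuous.
have [w [S [mw iS phiS phiw]]] := summable_increments_limit mU iphi step_sum.
have mphi k := integrable_measurable (iphi k).
exists w; split => //.
- pose f k x := (phi_ k x ^+ 2)%:E.
  have mf k : measurable_fun U (f k) by apply/measurable_EFinP; exact: measurable_funX.
  have := @fatou _ _ _ mu U mU f mf (fun k x _ => sqr_ge0 (phi_ k x)).
  (* Solve [N / 2 - 2 * C <= energy (phi_ k) <= m + 1] for [N], the squared norm of [phi_ k]. *)
  pose K := 2 * (m + 1 + 2 * C).
  have NK k : (\int[mu]_(x in U) f k x <= K%:E)%E.
    have -> : (\int[mu]_(x in U) f k x = (B (phi_ k) (phi_ k))%:E)%E.
      rewrite [RHS]fineK.
        by apply: eq_integral => x _; rewrite /f expr2.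
      by apply: integrable_fin_num => //; apply: B_integrable; exact: test_continuous.
    rewrite lee_fin /K; have := energy_ge (tphi_ k); have := ephi_ k.
    have : delta k ^+ 2 <= 1.
      rewrite exprn_ile1//; first exact/ltW/delta_gt0.
      by rewrite /delta invf_le1 ?ltr0n ?expn_gt0// ler1n expn_gt0.
    lra.
  have limK : (limn_einf (fun k => \int[mu]_(x in U) f k x) <= K%:E)%E.
    rewrite limn_einf_lim; apply: lime_le; first exact: is_cvg_einfs.
    apply: nearW => k; apply: le_trans (NK k).
    by apply: ereal_inf_lbound; exists k => /=.
  move=> /le_trans/(_ limK) H; apply/integrableP; split.
    by apply/measurable_EFinP; exact: measurable_funX.
  apply: le_lt_trans (ltry K); apply: le_trans H.
  rewrite le_eqVlt; apply/orP; left; apply/eqP; apply: ge0_ae_eq_integral => //.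
  + by do 2 apply: measurableT_comp => //; apply: measurable_funX.
  (* The lower limit is rewritten as an upper limit of negated functions, for which measurability is
     available. *)
  + rewrite (_ : (fun x => _) = (fun x => - limn_esup (fun k => - f k x))%E); last first.
      by apply/funext => x; rewrite limn_esupN oppeK.
    apply: measurableT_comp => //; apply: measurable_fun_limn_esup => k.
    exact: measurableT_comp.
  + move=> x Ux; rewrite limn_einf_lim; apply: lime_ge; first exact: is_cvg_einfs.
    by apply: nearW => k; apply: le_ereal_inf_tmp => _ [j _ <-]; rewrite lee_fin sqr_ge0.
  + move: phiw; apply: filterS => x /[apply] phiwx.
    have fw : f ^~ x @ \oo --> (w x ^+ 2)%:E.
      apply: cvg_EFin; first exact: nearW.
      by apply: cvgM.
    rewrite is_cvg_limn_einfE; last by apply/cvg_ex; eexists; exact: fw.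
    rewrite (cvg_lim _ fw)//= ger0_norm ?sqr_ge0//.
(* [B (phi_ k) psi] has two limits: the integral of [w * psi] by domination by [Mq * S], and [l psi]
   by [defect]. *)
- move=> psi tq; have [Mq Mq0 MqP] := continuous_bounded_on bU (test_continuous tq).
  have mq : measurable_fun U psi.
    by apply: measurable_funTS; exact: smooth_measurable (test_smooth tq).
  have [iw _ cvg1] := @dominated_convergence _ _ _ mu U mU
    (fun k x => (phi_ k x * psi x)%:E) (fun x => (w x * psi x)%:E) (fun x => Mq%:E * S x)%E
    ltac:(by move=> k; apply/measurable_EFinP; exact: measurable_funM)
    ltac:(by apply/measurable_EFinP; exact: measurable_funM)
    ltac:(by move: phiw; apply: filterS => x /[apply] H; apply: cvg_EFin;
      [exact: nearW|apply: cvgM => //; exact: cvg_cst])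
    (integrableZl mU Mq iS)
    ltac:(by apply: aeW => x k Ux; rewrite /= normrM mulrC EFinM lee_pmul// ?lee_fin// ?MqP// phiS).
  have cvg2 : B (phi_ k) psi @[k --> \oo] --> \int[mu]_(x in U) (w x * psi x).
    by apply: fine_cvg; rewrite fineK//; exact: integrable_fin_num.
  have cvg3 : B (phi_ k) psi @[k --> \oo] --> l psi.
    set N := B psi psi; have N0 : 0 <= N := B_ge0 psi.
    (* [N + 1] stands in for the square root of [N], since [N <= (N + 1) ^+ 2]. *)
    have dcvg : delta k * (N + 1) @[k --> \oo] --> (0 : R).
      rewrite -(mul0r (N + 1)); apply: cvgM; last exact: cvg_cst.
      have := @cvg_expr R 2^-1; rewrite ger0_norm// => /(_ _) H.
      rewrite (_ : delta = fun k => 2^-1 * 2^-1 ^+ k); last first.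
        by apply/funext => k; rewrite /delta natrX -exprVn exprS.
      rewrite -(mulr0 2^-1); apply: cvgM; first exact: cvg_cst.
      by apply: H; rewrite invf_lt1// ltr1n.
    apply/subr_cvg0; apply/norm_cvg0P.
    apply: (squeeze_cvgr _ (cvg_cst 0) dcvg); apply: nearW => k; rewrite normr_ge0/=.
    have dN : 0 <= delta k * (N + 1) by rewrite mulr_ge0 ?addr_ge0// ltW.
    rewrite -(ger0_norm dN).
    rewrite -ler_sqr ?nnegrE// !real_normK ?num_real//.
    apply: le_trans (defect k tq) _; rewrite exprMn ler_wpM2l ?sqr_ge0// -/N.
    by rewrite sqrrD1; have := sqr_ge0 N; lra.
  exact: cvg_unique cvg3 cvg2.
Qed.

End riesz.

(** * Lipschitz functions of Sobolev functions *)

Section L2_tools.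
Context d (T : measurableType d) (R : realType) (mu : {measure set T -> \bar R}).
Implicit Types (D : set T) (f g : T -> R).

Lemma L2_sqr_integrable D f : measurable D -> f \_ D \in Lfun mu 2%:E ->
  measurable_fun D f /\ mu.-integrable D (EFin \o (fun x => f x ^+ 2)).
Proof.
move=> mD Lf; have := Lfun2_integrable_sqr Lf.
move: Lf; rewrite inE => /andP[/[!inE]/= mf _] i2; split.
  exact/(measurable_restrictT _ mD).
move: (integrableS measurableT mD (@subsetT _ D) i2).
apply: (eq_integrable mD) => x xD /=.
by rewrite patchE xD.
Qed.

Lemma sqr_integrable_L2 D f : measurable D -> measurable_fun D f ->
  mu.-integrable D (EFin \o (fun x => f x ^+ 2)) -> f \_ D \in Lfun mu 2%:E.
Proof.
move=> mD mf /integrableP[_ i2].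
have mfD : measurable_fun setT (f \_ D) by exact/(measurable_restrictT _ mD).
rewrite inE; apply/andP; split; rewrite inE//=.
rewrite /finite_norm unlock poweR_lty//.
apply: le_lt_trans i2; rewrite [leRHS]integral_mkcond.
rewrite le_eqVlt; apply/orP; left; apply/eqP; apply: eq_integral => x _.
rewrite /= !patchE; case: ifPn => _ /=; last by rewrite normr0 powR0.
by rewrite powR_mulrn// normrX.
Qed.

Lemma sqr_integrable_mul D f g : measurable D -> measurable_fun D f -> measurable_fun D g ->
  mu.-integrable D (EFin \o (fun x => f x ^+ 2)) ->
  mu.-integrable D (EFin \o (fun x => g x ^+ 2)) ->
  mu.-integrable D (EFin \o (fun x => f x * g x)).
Proof.
move=> mD mf mg if2 ig2.
apply: (le_integrablef mD _ _ (integrable_addf mD if2 ig2)); first exact: measurable_funM.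
move=> x _; rewrite ler_norml; have := sqr_ge0 (f x + g x); have := sqr_ge0 (f x - g x).
have := sqr_ge0 (f x); have := sqr_ge0 (g x).
have -> : (f x - g x) ^+ 2 = f x ^+ 2 - 2 * (f x * g x) + g x ^+ 2 by ring.
have -> : (f x + g x) ^+ 2 = f x ^+ 2 + 2 * (f x * g x) + g x ^+ 2 by ring.
lra.
Qed.

Lemma sqr_integrable_sub D f g : measurable D -> measurable_fun D f -> measurable_fun D g ->
  mu.-integrable D (EFin \o (fun x => f x ^+ 2)) ->
  mu.-integrable D (EFin \o (fun x => g x ^+ 2)) ->
  mu.-integrable D (EFin \o (fun x => (f x - g x) ^+ 2)).
Proof.
move=> mD mf mg if2 ig2.
have ifg := sqr_integrable_mul mD mf mg if2 ig2.
have := integrable_addf mD (integrable_addf mD if2 (integrable_scalef (-2) mD ifg)) ig2.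
apply: eq_integrable => // x _ /=; congr EFin; ring.
Qed.

Lemma Rintegral_cauchy_schwarz D f g : measurable D ->
  measurable_fun D f -> measurable_fun D g ->
  mu.-integrable D (EFin \o (fun x => f x ^+ 2)) ->
  mu.-integrable D (EFin \o (fun x => g x ^+ 2)) ->
  (\int[mu]_(x in D) (f x * g x)) ^+ 2 <=
    (\int[mu]_(x in D) (f x ^+ 2)) * (\int[mu]_(x in D) (g x ^+ 2)).
Proof.
move=> mD mf mg if2 ig2; have ifg := sqr_integrable_mul mD mf mg if2 ig2.
apply: quadratic_ge0_discr; first by apply: Rintegral_ge0 => x _; exact: sqr_ge0.
move=> t; rewrite -RintegralZl// -RintegralZl//.
rewrite -RintegralD//; last exact: integrable_scalef.
rewrite -RintegralD//; [|apply: integrable_addf => //|]; try exact: integrable_scalef.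
apply: Rintegral_ge0 => x _.
rewrite (_ : _ + _ = (f x + t * g x) ^+ 2) ?sqr_ge0//; ring.
Qed.

Lemma sqr_integrable_L1 D f : measurable D -> (mu D < +oo)%E -> measurable_fun D f ->
  mu.-integrable D (EFin \o (fun x => f x ^+ 2)) -> mu.-integrable D (EFin \o f).
Proof.
move=> mD Doo mf if2.
have i1 : mu.-integrable D (EFin \o (fun _ => 1 : R)).
  apply: measurable_bounded_integrable => //.
  by exists 1; split => // y y1 x _; rewrite normr1 ltW.
apply: (le_integrablef mD mf _ (integrable_addf mD i1 if2)) => x _.
rewrite ler_norml; have := sqr_ge0 (f x + 1); have := sqr_ge0 (f x - 1).
have := sqr_ge0 (f x).
have -> : (f x - 1) ^+ 2 = f x ^+ 2 - 2 * f x + 1 by ring.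
have -> : (f x + 1) ^+ 2 = f x ^+ 2 + 2 * f x + 1 by ring.
lra.
Qed.

End L2_tools.

Lemma sqr_sum_le (R : realType) m (a : 'I_m -> R) :
  (\sum_k a k) ^+ 2 <= m%:R * \sum_k a k ^+ 2.
Proof.
rewrite mulrC; apply: quadratic_ge0_discr => // t.
rewrite (_ : _ + _ = \sum_k (a k + t) ^+ 2); first by apply: sumr_ge0 => k _; exact: sqr_ge0.
rewrite [RHS](eq_bigr (fun k => a k ^+ 2 + (2 * t) * a k + t ^+ 2)); last first.
  by move=> k _; ring.
by rewrite !big_split /= -mulr_sumr sumr_const card_ord mulr_natr.
Qed.

(** * Smooth approximation in H^1 *)

Section H1_approximation.
Context {R : realType} (n : nat).
Local Notation E := 'rV[R]_n.
Local Notation mu := (@lebesgue_rV R n).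
Variables (U : set E) (f : E -> R) (phi : (E -> R)^nat).
Hypotheses (oU : open U) (bU : bounded_set U).
Hypotheses (Hf : H1 U f) (sphi : forall k, smooth (phi k)).
Hypothesis phi_cvg : H1norm2 U (phi k \- f)%R @[k --> \oo] --> 0%E.

Let mU : measurable U. Proof. exact: open_measurable_rV. Qed.

Let mf : measurable_fun U f.
Proof. by case: Hf => /(L2_sqr_integrable mU)[]. Qed.

Let if2 : mu.-integrable U (EFin \o (fun x => f x ^+ 2)).
Proof. by case: Hf => /(L2_sqr_integrable mU)[]. Qed.

Let mw i : measurable_fun U (wpartial U i f).
Proof. by case: Hf => _ _ /(_ i) /(L2_sqr_integrable mU)[]. Qed.

Let iw2 i : mu.-integrable U (EFin \o (fun x => wpartial U i f x ^+ 2)).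
Proof. by case: Hf => _ _ /(_ i) /(L2_sqr_integrable mU)[]. Qed.

Let wf i : weak_partial U i f (wpartial U i f).
Proof. by apply: wpartialP; case: Hf => _ /(_ i). Qed.

Let csqr (g : E -> R) : continuous g -> mu.-integrable U (EFin \o (fun x => g x ^+ 2)).
Proof.
move=> cg; apply: continuous_integrable => //.
exact: (continuous_mulf cg cg).
Qed.

Let mc (g : E -> R) : continuous g -> measurable_fun U g.
Proof. by move=> cg; apply: measurable_funTS; exact: continuous_measurable_rV. Qed.

Lemma approx_diff_integrable k : mu.-integrable U (EFin \o (fun x => (phi k x - f x) ^+ 2)).
Proof.
have cphi := smooth_continuous (sphi k).
by apply: sqr_integrable_sub => //; [exact: mc|exact: csqr].
Qed.

Let wdiff k i : weak_partial U i (phi k \- f) (fun x => 'D_(e_ i) (phi k) x - wpartial U i f x).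
Proof. by apply: weak_partial_sub => //; exact: smooth_weak_partial. Qed.

Let mwdiff k i : measurable_fun U (wpartial U i (phi k \- f)).
Proof.
by have [_ []] : weak_partial U i (phi k \- f) (wpartial U i (phi k \- f));
  first by apply: wpartialP; eexists; exact: wdiff.
Qed.

Let msum k : measurable_fun U (fun x => (((phi k \- f) x) ^+ 2 + sqgrad U (phi k \- f) x)%:E).
Proof.
apply/measurable_EFinP; apply: measurable_funD.
  apply: measurable_funX; apply: measurable_funB => //.
  exact: (mc (smooth_continuous (sphi k))).
by apply: measurable_sum => i; exact: measurable_funX.
Qed.

Let diff_le k : ((\int[mu]_(x in U) (phi k x - f x) ^+ 2)%R%:E <= H1norm2 U (phi k \- f)%R)%E.
Proof.
rewrite fineK; last by apply: integrable_fin_num => //; exact: approx_diff_integrable.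
apply: ge0_le_integral => //.
- by move=> x _; rewrite lee_fin sqr_ge0.
- exact: measurable_int (approx_diff_integrable k).
- move=> x _; rewrite lee_fin lerDl; by apply: sumr_ge0 => i _; exact: sqr_ge0.
Qed.

Let dpartial_integrable k i :
  mu.-integrable U (EFin \o (fun x => ('D_(e_ i) (phi k) x - wpartial U i f x) ^+ 2)).
Proof.
have cphi := continuous_partial (i := i) (sphi k).
by apply: sqr_integrable_sub => //; [exact: mc|exact: csqr].
Qed.

(** [H1norm2] is computed from the representative that [wpartial] chooses for the difference;
    uniqueness of weak derivatives identifies it almost everywhere with the difference of the
    derivatives. *)
Let dpartial_le k i : ((\int[mu]_(x in U) ('D_(e_ i) (phi k) x - wpartial U i f x) ^+ 2)%R%:E
  <= H1norm2 U (phi k \- f)%R)%E.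
Proof.
rewrite fineK; last by apply: integrable_fin_num => //; exact: dpartial_integrable.
rewrite (@ge0_ae_eq_integral _ _ _ mu U _ (fun x => (wpartial U i (phi k \- f) x ^+ 2)%:E))//.
- apply: ge0_le_integral => //.
  + by move=> x _; rewrite lee_fin sqr_ge0.
  + by apply/measurable_EFinP; exact: measurable_funX.
  + move=> x _; rewrite lee_fin (le_trans _ (_ : sqgrad U (phi k \- f) x <= _))//.
      by rewrite /sqgrad (bigD1 i)//= lerDl sumr_ge0// => j _; exact: sqr_ge0.
    by rewrite lerDr sqr_ge0.
- exact: measurable_int (dpartial_integrable k i).
- by apply/measurable_EFinP; exact: measurable_funX.
- by move=> x _; rewrite lee_fin sqr_ge0.
- by move=> x _; rewrite lee_fin sqr_ge0.
- have := wpartial_ae oU (wdiff k i); apply: filterS => x /[apply] ->.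
  by [].
Qed.

Lemma approx_diff_cvg : \int[mu]_(x in U) ((phi k x - f x) ^+ 2) @[k --> \oo] --> (0 : R).
Proof.
apply: fine_cvg; apply: (squeeze_cvge _ (cvg_cst 0%E) phi_cvg).
apply: nearW => k; have := diff_le k; rewrite [X in (X <= _)%E]fineK; last first.
  by apply: integrable_fin_num => //; exact: approx_diff_integrable.
move=> ->; rewrite andbT; apply: integral_ge0 => x _.
by rewrite lee_fin sqr_ge0.
Qed.

(** For large [k] the derivatives are within 1 of the limit in squared L^2 norm, and
    [a ^+ 2 <= 2 * (a - b) ^+ 2 + 2 * b ^+ 2] yields the constant. *)
Lemma approx_partial_bounded i : exists C : R, \forall k \near \oo,
  \int[mu]_(x in U) ('D_(e_ i) (phi k) x ^+ 2) <= C.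
Proof.
exists (2 + 2 * \int[mu]_(x in U) (wpartial U i f x ^+ 2)).
have H1lt : \forall k \near \oo, (H1norm2 U (phi k \- f)%R < 1%:E)%E.
  have : nbhs (0%E : \bar R) [set x | (x < 1%:E)%E].
    by apply: open_nbhs_nbhs; split; [exact: open_ereal_lt_ereal|rewrite /= lte_fin].
  exact: phi_cvg.
apply: filterS H1lt => k /ltW k1.
have D1 : \int[mu]_(x in U) ('D_(e_ i) (phi k) x - wpartial U i f x) ^+ 2 <= 1.
  by rewrite -lee_fin (le_trans (dpartial_le k i)).
have i1 := dpartial_integrable k i.
apply: (@le_trans _ _ (\int[mu]_(x in U)
    (2 * ('D_(e_ i) (phi k) x - wpartial U i f x) ^+ 2 + 2 * wpartial U i f x ^+ 2))).
  apply: le_Rintegral => //.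
  - by apply: csqr; exact: continuous_partial.
  - by apply: integrable_addf => //; exact: integrable_scalef.
  - move=> x _; set a := 'D_(e_ i) (phi k) x; set b := wpartial U i f x.
    rewrite -subr_ge0 (_ : _ - _ = (a - 2 * b) ^+ 2) ?sqr_ge0//; ring.
rewrite RintegralD//; [|exact: integrable_scalef|exact: integrable_scalef].
rewrite !RintegralZl//.
by rewrite lerD2r -[leRHS]mulr1 ler_wpM2l.
Qed.

End H1_approximation.

Section Rintegral_sum.
Context d (T : measurableType d) (R : realType) (mu : {measure set T -> \bar R}).

Lemma integrable_sumf (D : set T) m (f : 'I_m -> T -> R) : measurable D ->
  (forall k, mu.-integrable D (EFin \o f k)) ->
  mu.-integrable D (EFin \o (fun x => \sum_k f k x)).
Proof.
move=> mD fi; have := integrable_sum mD (index_enum 'I_m) (P := xpredT)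
  (h := fun k => EFin \o f k) (fun k _ => fi k).
by apply: eq_integrable => // x _ /=; rewrite sumEFin.
Qed.

Lemma Rintegral_sum (D : set T) m (f : 'I_m -> T -> R) : measurable D ->
  (forall k, mu.-integrable D (EFin \o f k)) ->
  \int[mu]_(x in D) (\sum_k f k x) = \sum_k \int[mu]_(x in D) f k x.
Proof.
move=> mD; elim: m f => [|m IH] f fi.
  rewrite big_ord0 -[RHS](mul0r (fine (mu D))) -Rintegral_cst//.
  by apply: eq_Rintegral => x _; rewrite big_ord0.
rewrite big_ord_recl -IH// -RintegralD//; last exact: integrable_sumf.
by apply: eq_Rintegral => x _; rewrite big_ord_recl.
Qed.

Lemma Rintegral_subset_le (A B : set T) (f : T -> R) : measurable A -> measurable B ->
  A `<=` B -> (forall x, 0 <= f x) -> mu.-integrable B (EFin \o f) ->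
  \int[mu]_(x in A) f x <= \int[mu]_(x in B) f x.
Proof.
move=> mA mB AB f0 iB; rewrite -lee_fin fineK; last first.
  by apply: integrable_fin_num => //; exact: integrableS iB.
rewrite fineK; last exact: integrable_fin_num.
apply: ge0_subset_integral => //; first exact: measurable_int iB.
by move=> x _; rewrite lee_fin.
Qed.

End Rintegral_sum.

(** * Weak derivatives of a Lipschitz composition *)

Section lipschitz_composition.
Context {R : realType} (n m : nat).
Local Notation E := 'rV[R]_n.
Local Notation mu := (@lebesgue_rV R n).
Variables (O U : set E) (u : 'I_m -> E -> R) (F : ('I_m -> R) -> R) (L : R) (rho : E -> R).
Hypotheses (oO : open O) (bO : bounded_set O) (oU : open U) (UO : U `<=` O).
Hypothesis Hu : forall k, H1 O (u k).
Variable phi : 'I_m -> (E -> R)^nat.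
Hypothesis sphi : forall k j, smooth (phi k j).
Hypothesis phi_cvg : forall k, H1norm2 O (phi k j \- u k)%R @[j --> \oo] --> 0%E.
Hypothesis L0 : 0 <= L.
Hypothesis FL : forall a b, `|F a - F b| <= L * \sum_k `|a k - b k|.
Hypothesis lrho : L1loc U rho.
Hypothesis rhoE : \forall x \ae mu, U x -> rho x = F (u ^~ x).

Let mO : measurable O. Proof. exact: open_measurable_rV. Qed.
Let mU : measurable U. Proof. exact: open_measurable_rV. Qed.
Let bU : bounded_set U.
Proof.
by move: bO => [M [Mr HM]]; exists M; split => // x /HM H y /UO; exact: H.
Qed.

Let Fphi j x := F (fun k => phi k j x).

Let cphi k j : continuous (phi k j). Proof. exact: smooth_continuous. Qed.

Let cFphi j : continuous (Fphi j).
Proof.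
apply: (@continuous_of_increments _ _ m (Fphi j) (fun k => phi k j) L L0).
  by move=> k; exact: cphi.
by move=> x y; exact: FL.
Qed.

Variable i : 'I_n.

Let cD k j : continuous ('D_(e_ i) (phi k j)). Proof. exact: continuous_partial. Qed.

Let S j x := \sum_k `|'D_(e_ i) (phi k j) x|.
Let cS j : continuous (S j).
Proof. by apply: continuous_sumf => k; exact: continuous_normf. Qed.

Let ci (A : set E) (g : E -> R) : measurable A -> bounded_set A -> continuous g ->
  mu.-integrable A (EFin \o g) := fun mA bA cg => continuous_integrable mA bA cg.

Let csq (g : E -> R) : continuous g -> continuous (fun x => g x ^+ 2).
Proof. by move=> cg; exact: (continuous_mulf cg cg). Qed.

Let mc (A : set E) (g : E -> R) : continuous g -> measurable_fun A g.
Proof. by move=> cg; apply: measurable_funTS; exact: continuous_measurable_rV. Qed.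

(** The translation estimate followed by Cauchy-Schwarz. The domain is then enlarged from [U] to
    [O], where the derivatives of the approximants are bounded; [m] is the price of squaring a sum
    of [m] terms. *)
Lemma lipschitz_comp_partial_le j psi : test_function U psi ->
  (\int[mu]_(x in U) (Fphi j x * 'D_(e_ i) psi x)) ^+ 2 <=
  L ^+ 2 * (m%:R * \sum_k \int[mu]_(x in O) ('D_(e_ i) (phi k j) x ^+ 2)) *
    \int[mu]_(x in U) (psi x * psi x).
Proof.
move=> tp; have sp := test_smooth tp; have cp := smooth_continuous sp.
have H : `|\int[mu]_x (Fphi j x * 'D_(e_ i) psi x)| <= \int[mu]_x (L * S j x * `|psi x|).
  apply: (@Rintegral_mul_derive_le _ _ m (Fphi j) psi (fun k => phi k j) (e_ i) L (tsupport psi)).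
  - exact: cFphi.
  - exact: cp.
  - by move=> x; exact: smooth_derivable.
  - exact: continuous_partial.
  - exact: test_bounded_support tp.
  - by move=> x; exact: tsupport_out.
  - by move=> k; exact: cphi.
  - by move=> k x; exact: smooth_derivable.
  - by move=> k; exact: cD.
  - exact: L0.
  - by move=> x y; exact: FL.
rewrite Rintegral_support; last by move=> x Ux; rewrite (test_partial_out tp)// mulr0.
rewrite -(@Rintegral_support _ _ U (fun x => L * S j x * `|psi x|)) in H; last first.
  by move=> x Ux; rewrite (test_out tp)// normr0 mulr0.
have cSp : continuous (fun x => S j x * `|psi x|).
  by apply: continuous_mulf => //; exact: continuous_normf.
have H2 : \int[mu]_(x in U) (L * S j x * `|psi x|) = L * \int[mu]_(x in U) (S j x * `|psi x|).
  by rewrite -RintegralZl//; [apply: eq_Rintegral => x _; rewrite mulrA|exact: ci].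
rewrite H2 in H.
have Sp0 : 0 <= \int[mu]_(x in U) (S j x * `|psi x|).
  by apply: Rintegral_ge0 => x _; rewrite mulr_ge0// sumr_ge0.
rewrite -real_normK ?num_real//.
apply: (@le_trans _ _ ((L * \int[mu]_(x in U) (S j x * `|psi x|)) ^+ 2)).
  by rewrite lerXn2r// ?nnegrE ?mulr_ge0.
rewrite exprMn -mulrA ler_wpM2l ?sqr_ge0//.
apply: (le_trans (Rintegral_cauchy_schwarz mU _ _ _ _)).
- exact: mc.
- by apply: mc; exact: continuous_normf.
- by apply: ci => //; exact: csq.
- by apply: ci => //; apply: csq; exact: continuous_normf.
have -> : \int[mu]_(x in U) (`|psi x| ^+ 2) = \int[mu]_(x in U) (psi x * psi x).
  by apply: eq_Rintegral => x _; rewrite real_normK ?num_real.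
rewrite ler_wpM2r//; first by apply: Rintegral_ge0 => x _; rewrite -expr2 sqr_ge0.
have cDs k : continuous (fun x => 'D_(e_ i) (phi k j) x ^+ 2) by exact: csq.
apply: (@le_trans _ _ (\int[mu]_(x in O) (m%:R * \sum_k 'D_(e_ i) (phi k j) x ^+ 2))).
  apply: (@le_trans _ _ (\int[mu]_(x in O) (S j x ^+ 2))).
    apply: Rintegral_subset_le => //; first by move=> x; exact: sqr_ge0.
    by apply: ci => //; exact: csq.
  apply: le_Rintegral => //.
  - by apply: ci => //; exact: csq.
  - apply: ci => //; apply: continuous_mulf; first exact: continuous_cst.
    exact: continuous_sumf.
  - move=> x _; apply: le_trans (sqr_sum_le _) _; rewrite ler_wpM2l//.
    by apply: ler_sum => k _; rewrite real_normK ?num_real.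
rewrite RintegralZl//; last by apply: ci => //; exact: continuous_sumf.
by rewrite Rintegral_sum// => k; exact: ci.
Qed.

Let mrho : measurable_fun U rho. Proof. by case: lrho. Qed.

Let dphi k j x := phi k j x - u k x.

Let idphi k j : mu.-integrable O (EFin \o (fun x => dphi k j x ^+ 2)).
Proof. exact: approx_diff_integrable. Qed.

Let mu_k k : measurable_fun O (u k).
Proof. by case: (Hu k) => /(L2_sqr_integrable mO)[]. Qed.

Let T j x := \sum_k `|dphi k j x|.

Let mdphi k j : measurable_fun U (dphi k j).
Proof.
apply: measurable_funB; first exact: mc.
exact: measurable_funS (mu_k k).
Qed.

Let mT j : measurable_fun U (T j).
Proof. by apply: measurable_sum => k; apply: measurableT_comp. Qed.

Let iT2b j : mu.-integrable O (EFin \o (fun x => m%:R * \sum_k dphi k j x ^+ 2)).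
Proof. by apply: integrable_scalef => //; exact: integrable_sumf. Qed.

Let T2_le j x : T j x ^+ 2 <= m%:R * \sum_k dphi k j x ^+ 2.
Proof.
apply: le_trans (sqr_sum_le _) _; rewrite ler_wpM2l//.
by apply: ler_sum => k _; rewrite real_normK ?num_real.
Qed.

Let iT2 j : mu.-integrable U (EFin \o (fun x => T j x ^+ 2)).
Proof.
apply: (le_integrablef mU _ _ (integrableS mO mU UO (iT2b j))).
  exact: measurable_funX.
by move=> x _; rewrite ger0_norm ?sqr_ge0//; exact: T2_le.
Qed.

(** Almost everywhere on [U], [rho] and [Fphi j] differ by at most [L * T j], so L^2 convergence of
    the approximants suffices to pass to the limit against a fixed test function. *)
Lemma lipschitz_comp_cvg_le j psi : test_function U psi ->
  (\int[mu]_(x in U) (Fphi j x * 'D_(e_ i) psi x) -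
   \int[mu]_(x in U) (rho x * 'D_(e_ i) psi x)) ^+ 2 <=
  L ^+ 2 * (m%:R * \sum_k \int[mu]_(x in O) (dphi k j x ^+ 2)) *
    \int[mu]_(x in U) ('D_(e_ i) psi x ^+ 2).
Proof.
move=> tp; have sp := test_smooth tp.
have cDp : continuous ('D_(e_ i) psi) by exact: continuous_partial.
have i1 : mu.-integrable U (EFin \o (fun x => Fphi j x * 'D_(e_ i) psi x)).
  by apply: ci => //; exact: continuous_mulf.
have i2 := L1loc_test_partial_integrable i oU lrho tp.
have i12 := integrable_subf mU i1 i2.
have iD2 : mu.-integrable U (EFin \o (fun x => 'D_(e_ i) psi x ^+ 2)).
  by apply: ci => //; exact: csq.
have mnD : measurable_fun U (fun x => `|'D_(e_ i) psi x|).
  by apply: mc; exact: continuous_normf.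
have inD2 : mu.-integrable U (EFin \o (fun x => `|'D_(e_ i) psi x| ^+ 2)).
  by apply: ci => //; apply: csq; exact: continuous_normf.
have iTD : mu.-integrable U (EFin \o (fun x => T j x * `|'D_(e_ i) psi x|)).
  exact: sqr_integrable_mul.
rewrite -RintegralB//.
have H : `|\int[mu]_(x in U) (Fphi j x * 'D_(e_ i) psi x - rho x * 'D_(e_ i) psi x)| <=
    L * \int[mu]_(x in U) (T j x * `|'D_(e_ i) psi x|).
  apply: le_trans (le_normr_Rintegral mU i12) _.
  rewrite -RintegralZl// -lee_fin fineK; last first.
    by apply: integrable_fin_num => //; exact: integrable_norm.
  rewrite fineK; last by apply: integrable_fin_num => //; exact: integrable_scalef.
  apply: ae_ge0_le_integral => //.
  - exact: measurable_int (integrable_norm i12).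
  - by move=> x _; rewrite lee_fin mulr_ge0// mulr_ge0// sumr_ge0.
  - exact: measurable_int (integrable_scalef L mU iTD).
  - move: rhoE; apply: filterS => x /[apply] rhox.
    rewrite lee_fin -mulrBl normrM rhox mulrA ler_wpM2r//.
    exact: FL.
have TD0 : 0 <= \int[mu]_(x in U) (T j x * `|'D_(e_ i) psi x|).
  by apply: Rintegral_ge0 => x _; rewrite mulr_ge0// sumr_ge0.
rewrite -real_normK ?num_real//.
apply: (@le_trans _ _ ((L * \int[mu]_(x in U) (T j x * `|'D_(e_ i) psi x|)) ^+ 2)).
  by rewrite lerXn2r// ?nnegrE ?mulr_ge0.
rewrite exprMn -mulrA ler_wpM2l ?sqr_ge0//.
apply: (le_trans (Rintegral_cauchy_schwarz mU _ _ _ _)) => //.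
have -> : \int[mu]_(x in U) (`|'D_(e_ i) psi x| ^+ 2) = \int[mu]_(x in U) ('D_(e_ i) psi x ^+ 2).
  by apply: eq_Rintegral => x _; rewrite real_normK ?num_real.
rewrite ler_wpM2r//; first by apply: Rintegral_ge0 => x _; rewrite sqr_ge0.
rewrite -Rintegral_sum// -RintegralZl//; last exact: integrable_sumf.
apply: (@le_trans _ _ (\int[mu]_(x in U) (m%:R * \sum_k dphi k j x ^+ 2))).
  by apply: le_Rintegral => //; exact: integrableS (iT2b j).
apply: Rintegral_subset_le => // x.
by rewrite mulr_ge0// sumr_ge0// => k _; exact: sqr_ge0.
Qed.

(** The bound for the approximants has a constant that eventually depends neither on [j] nor on the
    test function, so it survives the limit. *)
Lemma lipschitz_comp_bounded : exists2 C, 0 <= C &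
  forall psi, test_function U psi ->
    (\int[mu]_(x in U) (rho x * 'D_(e_ i) psi x)) ^+ 2 <=
    C * \int[mu]_(x in U) (psi x * psi x).
Proof.
have HC k : {C : R | \forall j \near \oo,
    \int[mu]_(x in O) ('D_(e_ i) (phi k j) x ^+ 2) <= C}.
  by apply: cid; exact: approx_partial_bounded.
(* The eventual bounds come without a sign, hence the absolute values. *)
pose K := L ^+ 2 * (m%:R * \sum_k `|sval (HC k)|).
exists K; first by rewrite mulr_ge0 ?sqr_ge0// mulr_ge0// sumr_ge0.
move=> psi tp; set A := \int[mu]_(x in U) (rho x * _).
pose Aj j := \int[mu]_(x in U) (Fphi j x * 'D_(e_ i) psi x).
have psi0 : 0 <= \int[mu]_(x in U) (psi x * psi x).
  by apply: Rintegral_ge0 => x _; rewrite -expr2 sqr_ge0.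
have AjK : \forall j \near \oo, Aj j ^+ 2 <= K * \int[mu]_(x in U) (psi x * psi x).
  have : \forall j \near \oo, forall k : 'I_m,
      \int[mu]_(x in O) ('D_(e_ i) (phi k j) x ^+ 2) <= sval (HC k).
    by apply: filter_forall => k; case: (HC k).
  apply: filterS => j Hj; apply: le_trans (lipschitz_comp_partial_le j tp) _.
  rewrite ler_wpM2r// ler_wpM2l ?sqr_ge0// ler_wpM2l//.
  by apply: ler_sum => k _; rewrite (le_trans (Hj k))// ler_norm.
have AjA : Aj j @[j --> \oo] --> A.
  have e_cvg : L ^+ 2 * (m%:R * \sum_k \int[mu]_(x in O) (dphi k j x ^+ 2)) *
      \int[mu]_(x in U) ('D_(e_ i) psi x ^+ 2) @[j --> \oo] --> (0 : R).
    rewrite -[X in _ --> X](mul0r (\int[mu]_(x in U) ('D_(e_ i) psi x ^+ 2))).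
    apply: cvgM; last exact: cvg_cst.
    rewrite -[X in _ --> X](mulr0 (L ^+ 2)); apply: cvgM; first exact: cvg_cst.
    rewrite -[X in _ --> X](mulr0 (m%:R : R)); apply: cvgM; first exact: cvg_cst.
    have s0 : \sum_(k < m) (0 : R) = 0 by rewrite big1.
    rewrite -[X in _ --> X]s0; apply: cvg_big; first exact: add_continuous.
    by move=> k _; exact: approx_diff_cvg.
  apply/cvgrPdist_lt => e e0.
  have e20 : 0 < e ^+ 2 by rewrite exprn_gt0.
  move/cvgrPdist_lt : e_cvg => /(_ _ e20); apply: filterS => j.
  rewrite sub0r normrN => /(le_lt_trans (ler_norm _)).
  move=> /(le_lt_trans (lipschitz_comp_cvg_le j tp)).
  rewrite -/A -/(Aj j) distrC -(@real_normK _ (Aj j - A)) ?num_real//.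
  by rewrite ltr_sqr ?nnegrE//; exact: ltW.
exact: (ler_cvg_to (cvgM AjA AjA) (cvg_cst _) AjK).
Qed.

Lemma lipschitz_comp_weak_partial : exists w, weak_partial U i rho w /\ L2 U w.
Proof.
have [C C0 HC] := lipschitz_comp_bounded.
pose l psi := - \int[mu]_(x in U) (rho x * 'D_(e_ i) psi x).
have l_lin psi1 psi2 (c : R) : test_function U psi1 -> test_function U psi2 ->
    l (fun x => psi1 x + c * psi2 x) = l psi1 + c * l psi2.
  move=> t1 t2; rewrite /l mulrN -opprD; congr (- _).
  have i1 := L1loc_test_partial_integrable i oU lrho t1.
  have i2 := L1loc_test_partial_integrable i oU lrho t2.
  rewrite -RintegralZl// -RintegralD//; last exact: integrable_scalef.
  apply: eq_Rintegral => x _.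
  have [_ ->] := derivable_lin c (smooth_derivable (i := i) (x := x) (test_smooth t1))
    (smooth_derivable (i := i) (x := x) (test_smooth t2)).
  ring.
have l_bnd psi : test_function U psi -> l psi ^+ 2 <= C * \int[mu]_(x in U) (psi x * psi x).
  by move=> tp; rewrite sqrrN; exact: HC.
have [w [mw iw2 lw]] := riesz_test_functions oU bU C0 l_lin l_bnd.
exists w; split; last exact: sqr_integrable_L2.
split => //.
- split => // K cK KU; have mK := compact_measurable_rV cK.
  have := sqr_integrable_L1 mK (compact_lty cK) (measurable_funS mU KU mw)
    (integrableS mU mK KU iw2).
  by move=> /integrableP[].
- by move=> psi tp; rewrite -lw// opprK.
Qed.

End lipschitz_composition.

(** * The optimal density *)

Section derivative_within.
Context {R : realType}.
Implicit Types (f : R -> R) (A : set R) (x y l : R).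

(** A first-order expansion equivalent to the quotient form, with no division and with [y = x]
    allowed. *)
Lemma derivative_within_near A f x l : derivative_within A f x l ->
  forall e, 0 < e -> \forall y \near x, A y -> `|f y - f x - l * (y - x)| <= e * `|y - x|.
Proof.
move=> /cvgrPdist_lt H e e0.
have : \forall y \near x, y != x -> A y -> `|l - (f y - f x) / (y - x)| < e by exact: H.
apply: filterS => y Hy Ay; have [->|yx] := eqVneq y x.
  by rewrite !subrr mulr0 subr0 normr0 mulr0.
have yx0 : y - x != 0 by rewrite subr_eq0.
have := Hy yx Ay => /ltW.
rewrite distrC (_ : (f y - f x) / (y - x) - l = (f y - f x - l * (y - x)) / (y - x)); last by field.
by rewrite normrM normfV ler_pdivrMr ?normr_gt0.
Qed.

Lemma near_derivative_within A f x l :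
  (forall e, 0 < e -> \forall y \near x, A y -> `|f y - f x - l * (y - x)| <= e * `|y - x|) ->
  derivative_within A f x l.
Proof.
move=> H; apply/cvgrPdist_le => e e0.
suff : \forall y \near x, y != x -> A y -> `|l - (f y - f x) / (y - x)| <= e by [].
have := H _ e0; apply: filterS => y Hy yx Ay.
have yx0 : y - x != 0 by rewrite subr_eq0.
rewrite distrC (_ : (f y - f x) / (y - x) - l = (f y - f x - l * (y - x)) / (y - x)); last by field.
by rewrite normrM normfV ler_pdivrMr ?normr_gt0// Hy.
Qed.

Lemma derivative_within_continuous A f x l : derivative_within A f x l ->
  f y @[y --> within A (nbhs x)] --> f x.
Proof.
move=> dl; apply/cvgrPdist_le => e e0; rewrite near_withinE.
have k0 : 0 < `|l| + 1 by rewrite ltr_wpDl.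
near=> y => Ay; rewrite distrC.
have H : `|f y - f x - l * (y - x)| <= 1 * `|y - x|.
  by move: Ay; near: y; exact: derivative_within_near dl _ ltr01.
have yx : `|x - y| < e / (`|l| + 1).
  near: y; move: (divr_gt0 e0 k0) => e1.
  exact: (nbhsx_ballx x _ e1).
have -> : f y - f x = (f y - f x - l * (y - x)) + l * (y - x) by ring.
rewrite (le_trans (ler_normD _ _))// normrM.
rewrite distrC ltr_pdivlMr// in yx.
by move: H yx; lra.
Unshelve. all: by end_near. Qed.

Lemma derivative_within_is_derive A f x l : (\forall y \near x, A y) ->
  derivative_within A f x l -> is_derive x 1 f l.
Proof.
move=> Ax dl.
have Hc : h^-1 *: ((f \o shift x) (h *: (1 : R)) - f x) @[h --> 0^'] --> l.
  apply/cvgrPdist_le => e e0.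
  have H : \forall y \near x, `|f y - f x - l * (y - x)| <= e * `|y - x|.
    by near=> y; apply: (near (derivative_within_near dl e0) y) => //; near: y.
  have sh : (fun h : R => h + x) @ (0 : R) --> x.
    by rewrite -[X in _ --> X]add0r; apply: cvgD; [exact: cvg_id|exact: cvg_cst].
  have /sh H' := H.
  near=> h; rewrite /= [h *: 1]mulr1.
  have h0 : h != 0 by near: h; exact: nbhs_dnbhs_neq.
  have : `|f (h + x) - f x - l * (h + x - x)| <= e * `|h + x - x|.
    by near: h; exact: nbhs_dnbhs.
  rewrite addrK => Hh; rewrite distrC.
  have -> : h^-1 *: (f (h + x) - f x) - l = h^-1 * (f (h + x) - f x - l * h).
    by rewrite [RHS]mulrBr [X in _ = _ - X]mulrCA mulVf// mulr1.
  by rewrite normrM normfV ler_pdivrMl ?normr_gt0// [leRHS]mulrC.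
split; first by apply/cvg_ex; exists l.
exact: cvg_lim Hc.
Unshelve. all: by end_near. Qed.

(** Inside []a, b[] the derivative is two-sided; at [a] and [b], which may be 0 and 1, only
    continuity is required. *)
Lemma derivative_within_MVT (f f' : R -> R) a b :
  (forall y, y \in `[0, 1] -> derivative_within `[0, 1] f y (f' y)) ->
  0 <= a -> a < b -> b <= 1 ->
  exists2 c, a < c < b & f b - f a = f' c * (b - a).
Proof.
move=> df a0 ab b1.
have [c cab E] : exists2 c, c \in `]a, b[%R & f b - f a = f' c * (b - a).
  apply: MVT => //.
  - move=> x /[!in_itv]/= /andP[ax xb]; apply: (@derivative_within_is_derive `[0, 1]%classic).
      near=> y; rewrite /= in_itv/=; apply/andP; split.
        by near: y; apply: lt_le_nbhsr; exact: le_lt_trans ax.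
      by near: y; apply: lt_le_nbhsl; exact: lt_le_trans b1.
    apply: df; rewrite in_itv/=; apply/andP; split.
      exact: le_trans (ltW ax).
    exact: le_trans (ltW xb) _.
  - apply: (@continuous_subspaceW _ _ `[a, b]%classic `[0, 1]%classic).
      move=> x /=; rewrite !in_itv/= => /andP[ax xb].
      by rewrite (le_trans a0 ax) (le_trans xb b1).
    apply/subspace_continuousP => x x01.
    exact: derivative_within_continuous (df x x01).
by exists c => //; move: cab; rewrite in_itv.
Unshelve. all: by end_near. Qed.

End derivative_within.

(** * Strong convexity and the pointwise minimizer *)

Section strong_convexity.
Context {R : realType}.
Variables (al al' al'' : R -> R) (ka : R).
Hypothesis dal : forall y, y \in `[0, 1] -> derivative_within `[0, 1] al y (al' y).
Hypothesis dal' : forall y, y \in `[0, 1] -> derivative_within `[0, 1] al' y (al'' y).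
Hypothesis al''_ge : forall y, y \in `[0, 1] -> ka <= al'' y.

Lemma strongly_monotone x y : 0 <= x -> x < y -> y <= 1 -> ka * (y - x) <= al' y - al' x.
Proof.
move=> x0 xy y1; have [c /andP[xc cy] ->] := derivative_within_MVT dal' x0 xy y1.
rewrite ler_wpM2r ?subr_ge0 ?(ltW xy)//; apply: al''_ge; rewrite in_itv/=.
by apply/andP; split; lra.
Qed.

(** Taylor's formula is replaced by the mean value theorem for [al z - ka / 2 * z ^+ 2 - al' x * z]:
    strong monotonicity of [al'] compares the derivative of this function at the intermediate point
    with its value at [x]. *)
Lemma quadratic_minorant x y : 0 <= x <= 1 -> 0 <= y <= 1 ->
  al x + al' x * (y - x) + ka / 2 * (y - x) ^+ 2 <= al y.
Proof.
move=> /andP[x0 x1] /andP[y0 y1].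
pose k z := al z - ka / 2 * z ^+ 2 - al' x * z.
have dk z : z \in `[0, 1] -> derivative_within `[0, 1] k z (al' z - ka * z - al' x).
  move=> z01; apply: near_derivative_within => e e0.
  have e2 : 0 < e / 2 by rewrite divr_gt0.
  have e3 : 0 < e / (`|ka| + 1) by rewrite divr_gt0// ltr_wpDl.
  near=> t => At.
  have H : `|al t - al z - al' z * (t - z)| <= e / 2 * `|t - z|.
    by move: At; near: t; exact: derivative_within_near (dal z01) _ e2.
  have tz : `|z - t| < e / (`|ka| + 1).
    by near: t; exact: (nbhsx_ballx z _ e3).
  have -> : k t - k z - (al' z - ka * z - al' x) * (t - z) =
    (al t - al z - al' z * (t - z)) - ka / 2 * (t - z) * (t - z) by rewrite /k; field.
  rewrite (le_trans (ler_normB _ _))// [X in _ + X]normrM.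
  have H2 : `|ka / 2 * (t - z)| <= e / 2.
    rewrite distrC in tz; rewrite normrM normrM normfV (@ger0_norm _ 2)//.
    rewrite mulrAC ler_pM2r ?invr_gt0//.
    apply: (@le_trans _ _ ((`|ka| + 1) * `|t - z|)).
      by rewrite ler_wpM2r// lerDl.
    by rewrite mulrC -ler_pdivlMr ?ltr_wpDl// ltW.
  rewrite [leRHS](_ : _ = e / 2 * `|t - z| + e / 2 * `|t - z|); last by field.
  by rewrite lerD// ler_wpM2r.
have E t : k t = al t - ka / 2 * t ^+ 2 - al' x * t by [].
have [xy|yx|->] := ltgtP x y.
- have [c /andP[xc cy]] := derivative_within_MVT dk x0 xy y1.
  have := strongly_monotone x0 xc (le_trans (ltW cy) y1).
  rewrite !E => H1 H2.
  (* The derivative of [k] at [x] is [- (ka * x)]. *)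
  have : 0 <= (al' c - ka * c - al' x - - (ka * x)) * (y - x).
    by rewrite mulr_ge0 ?subr_ge0 ?(ltW xy)//; lra.
  rewrite mulrBl -H2; lra.
- have [c /andP[yc cx]] := derivative_within_MVT dk y0 yx x1.
  have := strongly_monotone (le_trans y0 (ltW yc)) cx x1.
  rewrite !E => H1 H2.
  have : 0 <= (- (ka * x) - (al' c - ka * c - al' x)) * (x - y).
    by rewrite mulr_ge0 ?subr_ge0 ?(ltW yx)//; lra.
  rewrite mulrBl -H2; lra.
- by rewrite subrr expr0n !mulr0 !addr0.
Unshelve. all: by end_near. Qed.

(** Average the quadratic minorants based at the intermediate point: the first-order terms cancel
    and the squares combine to [t * (1 - t)]. *)
Lemma strongly_convex x y t : 0 <= x <= 1 -> 0 <= y <= 1 -> 0 <= t <= 1 ->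
  al ((1 - t) * x + t * y) <=
  (1 - t) * al x + t * al y - ka / 2 * t * (1 - t) * (x - y) ^+ 2.
Proof.
move=> /andP[x0 x1] /andP[y0 y1] /andP[t0 t1].
set z := (1 - t) * x + t * y.
have z01 : 0 <= z <= 1 by rewrite /z; apply/andP; split; nra.
have x01 : 0 <= x <= 1 by rewrite x0.
have y01 : 0 <= y <= 1 by rewrite y0.
have Hx := quadratic_minorant z01 x01; have Hy := quadratic_minorant z01 y01.
have t1' : 0 <= 1 - t by rewrite subr_ge0.
have := lerD (ler_wpM2l t1' Hx) (ler_wpM2l t0 Hy).
have E A A' : (1 - t) * (A + A' * (x - z) + ka / 2 * (x - z) ^+ 2) +
    t * (A + A' * (y - z) + ka / 2 * (y - z) ^+ 2) =
    A + ka / 2 * t * (1 - t) * (x - y) ^+ 2 by rewrite /z; field.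
by rewrite E; lra.
Qed.

Lemma strongly_convex_continuous : {within `[0, 1], continuous al}.
Proof.
by apply/subspace_continuousP => x x01; exact: derivative_within_continuous (dal x01).
Qed.

Hypothesis ka_gt0 : 0 < ka.
Variables (lam theta : R).
Hypotheses (lam0 : 0 <= lam) (theta0 : 0 < theta).

Let argmin (s : R) : {y | 0 <= y <= 1 &
  forall z, 0 <= z <= 1 -> al y * s + lam * y <= al z * s + lam * z}.
Proof.
apply: cid2.
have cf : {within `[0, 1], continuous (fun y => al y * s + lam * y)}.
  move=> x; apply: cvgD.
    by apply: cvgM; [exact: strongly_convex_continuous|exact: cvg_cst].
  apply: cvgM; first exact: cvg_cst.
  by apply: continuous_subspaceT => z; exact: cvg_id.
have [y + ymin] := EVT_min (@ler01 R) cf.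
by rewrite in_itv/= => y01; exists y.
Qed.

(** When [s > 0], strong convexity makes the minimizer unique; otherwise some minimizer is
    picked. *)
Definition argmin_density s : R := s2val (argmin s).
Local Notation G := argmin_density.

Lemma argmin_density01 s : 0 <= G s <= 1.
Proof. exact: s2valP (argmin s). Qed.

Lemma argmin_densityP s z : 0 <= z <= 1 -> al (G s) * s + lam * G s <= al z * s + lam * z.
Proof. exact: s2valP' (argmin s) z. Qed.

(** Compare [G s] with its midpoint to [z]: strong convexity at 1/2 gains [s * ka / 8] times the
    squared distance, and doubling produces the factor 1/4. *)
Lemma argmin_density_growth s z : 0 <= s -> 0 <= z <= 1 ->
  al (G s) * s + lam * G s + s * ka / 4 * (z - G s) ^+ 2 <= al z * s + lam * z.
Proof.
move=> s0 z01; have G01 := argmin_density01 s.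
have h01 : 0 <= (2^-1 : R) <= 1 by apply/andP; split; lra.
have H := strongly_convex G01 z01 h01.
set w := (1 - 2^-1) * G s + 2^-1 * z in H.
have w01 : 0 <= w <= 1.
  by move: G01 z01 => /andP[? ?] /andP[? ?]; rewrite /w; apply/andP; split; lra.
have M := argmin_densityP s w01.
have Hs := ler_wpM2r s0 H.
have E : ((1 - 2^-1) * al (G s) + 2^-1 * al z - ka / 2 * 2^-1 * (1 - 2^-1) * (G s - z) ^+ 2) * s =
  2^-1 * (al (G s) * s) + 2^-1 * (al z * s) - s * ka / 8 * (z - G s) ^+ 2 by field.
rewrite E in Hs.
have Ew : lam * w = 2^-1 * (lam * G s) + 2^-1 * (lam * z) by rewrite /w; field.
rewrite Ew in M.
have -> : s * ka / 4 * (z - G s) ^+ 2 = 2 * (s * ka / 8 * (z - G s) ^+ 2) by field.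
lra.
Qed.

(** After division by [s], [G s] minimizes [al y + lam / s * y]. Test each of the two minimality
    statements with the other minimizer and add: the values of [al] cancel and [ka / 2 * D ^+ 2 <=
    lam * (s^-1 - t^-1) * D] remains. *)
Lemma argmin_density_inv_lip s t : 0 < s -> 0 < t ->
  `|G s - G t| <= 2 * lam / ka * `|s^-1 - t^-1|.
Proof.
move=> s0 t0.
have H1 := argmin_density_growth (ltW s0) (argmin_density01 t).
have H2 := argmin_density_growth (ltW t0) (argmin_density01 s).
set D := G t - G s in H1.
have H1' : al (G s) + lam * G s / s + ka / 4 * D ^+ 2 <= al (G t) + lam * G t / s.
  rewrite -(ler_pM2r s0).
  have -> : (al (G s) + lam * G s / s + ka / 4 * D ^+ 2) * s =
    al (G s) * s + lam * G s + s * ka / 4 * D ^+ 2 by field; rewrite gt_eqF.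
  by have -> : (al (G t) + lam * G t / s) * s = al (G t) * s + lam * G t by field; rewrite gt_eqF.
have H2' : al (G t) + lam * G t / t + ka / 4 * D ^+ 2 <= al (G s) + lam * G s / t.
  rewrite -(ler_pM2r t0).
  have -> : (al (G t) + lam * G t / t + ka / 4 * D ^+ 2) * t =
    al (G t) * t + lam * G t + t * ka / 4 * (G s - G t) ^+ 2 by rewrite /D; field; rewrite gt_eqF.
  by have -> : (al (G s) + lam * G s / t) * t = al (G s) * t + lam * G s by field; rewrite gt_eqF.
have H3 : ka / 2 * D ^+ 2 <= lam * (s^-1 - t^-1) * D by rewrite /D in H1' H2' *; lra.
have c0 : 0 <= 2 * lam / ka by rewrite divr_ge0 ?mulr_ge0// ltW.
have [D_eq0|D0] := eqVneq D 0.
  by rewrite distrC -/D D_eq0 normr0 mulr_ge0.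
have nD : 0 < `|D| by rewrite normr_gt0.
rewrite distrC -/D -(ler_pM2r nD) -expr2 real_normK ?num_real//.
rewrite -[leRHS]mulrA -normrM.
have H4 : D ^+ 2 <= 2 * lam / ka * ((s^-1 - t^-1) * D).
  rewrite (_ : 2 * lam / ka * _ = (2 / ka) * (lam * (s^-1 - t^-1) * D)); last by ring.
  have ka2 : 0 <= 2 / ka by rewrite divr_ge0// ltW.
  have := ler_wpM2l ka2 H3.
  by have -> : 2 / ka * (ka / 2 * D ^+ 2) = D ^+ 2 by field; rewrite gt_eqF.
by apply: le_trans H4 _; rewrite ler_wpM2l// ler_norm.
Qed.

(** The truncation keeps the arguments above [theta], where the inverse has Lipschitz constant
    [theta ^- 2]. It serves the measurability of the optimal density. *)
Lemma argmin_density_trunc_continuous : continuous (fun s => G (Num.max theta s)).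
Proof.
have th s : 0 < Num.max theta s by rewrite lt_max theta0.
have c0 : 0 <= 2 * lam / ka by rewrite divr_ge0 ?mulr_ge0// ltW.
pose K := 2 * lam / ka / theta ^+ 2.
have K0 : 0 <= K by rewrite /K divr_ge0// exprn_ge0// ltW.
apply: (@continuous_of_increments R R^o 1 _ (fun _ => id) K K0).
  by move=> _ x; exact: cvg_id.
move=> s t; rewrite big_ord1 (le_trans (argmin_density_inv_lip _ _))//.
rewrite /K -[leRHS]mulrA ler_wpM2l//.
set a := Num.max theta s; set b := Num.max theta t.
have a0 : 0 < a := th s; have b0 : 0 < b := th t.
have ta : theta <= a by rewrite le_max lexx.
have tb : theta <= b by rewrite le_max lexx.
have -> : a^-1 - b^-1 = (a * b)^-1 * (b - a) by field; rewrite !gt_eqF.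
have ab0 : 0 <= (a * b)^-1 by rewrite invr_ge0 mulr_ge0// ltW.
rewrite normrM (ger0_norm ab0); apply: ler_pM => //.
  by rewrite lef_pV2 ?posrE ?exprn_gt0 ?mulr_gt0// expr2 ler_pM// ltW.
rewrite /a /b distrC; case: (leP theta s) => ?; case: (leP theta t) => ? //;
  by rewrite ler_norml; apply/andP; split; rewrite ?subrr; have := ler_norm (s - t);
     have := ler_norm (t - s); rewrite distrC; lra.
Qed.

(** With [p] and [q] the square roots of the truncated values, the sums of squares differ by at most
    [p + q] times the l^1 distance, and passing to inverses divides by [s * t = p ^+ 2 * q ^+ 2].
    The quotient is at most [2 / (theta * Num.sqrt theta)], uniformly in [a] and [b]. *)
Lemma argmin_density_lipschitz m (a b : 'I_m -> R) :
  `|G (Num.max theta (\sum_k a k ^+ 2)) - G (Num.max theta (\sum_k b k ^+ 2))| <=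
  2 * lam / ka * (2 / (theta * Num.sqrt theta)) * \sum_k `|a k - b k|.
Proof.
have c0 : 0 <= 2 * lam / ka by rewrite divr_ge0 ?mulr_ge0// ltW.
set A := \sum_k a k ^+ 2; set B := \sum_k b k ^+ 2.
set s := Num.max theta A; set t := Num.max theta B.
have ts : theta <= s by rewrite le_max lexx.
have tt : theta <= t by rewrite le_max lexx.
have s0 : 0 < s := lt_le_trans theta0 ts.
have t0 : 0 < t := lt_le_trans theta0 tt.
have As : A <= s by rewrite le_max lexx orbT.
have Bt : B <= t by rewrite le_max lexx orbT.
apply: le_trans (argmin_density_inv_lip s0 t0) _.
rewrite -[leRHS]mulrA ler_wpM2l//.
set p := Num.sqrt s; set q := Num.sqrt t; set r := Num.sqrt theta.
have r0 : 0 < r by rewrite sqrtr_gt0.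
have rp : r <= p by exact: ler_wsqrtr.
have rq : r <= q by exact: ler_wsqrtr.
have p0 : 0 < p := lt_le_trans r0 rp.
have q0 : 0 < q := lt_le_trans r0 rq.
have sE : s = p ^+ 2 by rewrite sqr_sqrtr// ltW.
have tE : t = q ^+ 2 by rewrite sqr_sqrtr// ltW.
have thE : theta = r ^+ 2 by rewrite sqr_sqrtr// ltW.
have ap k : `|a k| <= p.
  rewrite -sqrtr_sqr; apply: ler_wsqrtr; rewrite (le_trans _ As)// /A (bigD1 k)//= lerDl.
  by apply: sumr_ge0 => j _; exact: sqr_ge0.
have bq k : `|b k| <= q.
  rewrite -sqrtr_sqr; apply: ler_wsqrtr; rewrite (le_trans _ Bt)// /B (bigD1 k)//= lerDl.
  by apply: sumr_ge0 => j _; exact: sqr_ge0.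
have stAB : `|s - t| <= `|A - B|.
  rewrite /s /t; case: (leP theta A) => ?; case: (leP theta B) => ? //;
    by rewrite ler_norml; apply/andP; split; rewrite ?subrr; have := ler_norm (A - B);
     have := ler_norm (B - A); rewrite distrC; lra.
set N := \sum_k `|a k - b k|.
have N0 : 0 <= N by exact: sumr_ge0.
have ABN : `|A - B| <= (p + q) * N.
  rewrite /A /B -sumrB (le_trans (ler_norm_sum _ _ _))// /N mulr_sumr.
  apply: ler_sum => k _; rewrite subr_sqr mulrC normrM ler_wpM2r//.
  by rewrite (le_trans (ler_normD _ _))// lerD.
have -> : s^-1 - t^-1 = (s * t)^-1 * (t - s) by field; rewrite !gt_eqF.
have st0 : 0 <= (s * t)^-1 by rewrite invr_ge0 mulr_ge0// ltW.
rewrite normrM (ger0_norm st0) distrC.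
apply: (@le_trans _ _ ((s * t)^-1 * ((p + q) * N))).
  by rewrite ler_wpM2l//; exact: le_trans ABN.
rewrite mulrA ler_wpM2r//.
have -> : (s * t)^-1 * (p + q) = (p * q ^+ 2)^-1 + (p ^+ 2 * q)^-1.
  by rewrite sE tE; field; rewrite !gt_eqF.
have -> : 2 / (theta * r) = (r * r ^+ 2)^-1 + (r ^+ 2 * r)^-1.
  by rewrite thE; field; rewrite !gt_eqF.
have mono (x y z w : R) : 0 < x -> 0 < y -> x <= z -> y <= w -> (z * w)^-1 <= (x * y)^-1.
  move=> x0 y0 xz yw; rewrite lef_pV2 ?posrE ?mulr_gt0//.
  - by rewrite ler_pM// ltW.
  - exact: lt_le_trans xz.
  - exact: lt_le_trans yw.
have rp2 : r ^+ 2 <= p ^+ 2 by rewrite lerXn2r// nnegrE ltW.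
have rq2 : r ^+ 2 <= q ^+ 2 by rewrite lerXn2r// nnegrE ltW.
by apply: lerD; apply: mono; rewrite ?exprn_gt0.
Qed.

End strong_convexity.

(** Only convexity of [F] and affinity of [V] along [comb] are used, so densities need no vector
    space or topology. The point with [V a < V0] is Slater's condition: it bounds the admissible
    slopes. *)
Lemma lagrange_multiplier (R : realType) (T : Type) (P : T -> Prop) (comb : R -> T -> T -> T)
    (F V : T -> R) (V0 m : R) :
  (forall t a b, 0 <= t <= 1 -> P a -> P b -> [/\ P (comb t a b),
     F (comb t a b) <= (1 - t) * F a + t * F b & V (comb t a b) = (1 - t) * V a + t * V b]) ->
  (forall a, P a -> V a <= V0 -> m <= F a) ->
  (exists2 a, P a & V a < V0) ->
  exists2 lam, 0 <= lam & forall a, P a -> m <= F a + lam * (V a - V0).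
Proof.
move=> comb_cvx Fm [b0 Pb0 Vb0].
(* Adjoining 0 makes the supremum nonnegative and covers the case where no point exceeds the
   constraint. *)
pose Q := [set (m - F a) / (V a - V0) | a in [set a | P a /\ V0 < V a]] `|` [set 0 : R].
have Q_ub b : P b -> V b < V0 -> ubound Q ((F b - m) / (V0 - V b)).
  move=> Pb Vb; have Fb := Fm b Pb (ltW Vb).
  have Vb' : 0 < V0 - V b by rewrite subr_gt0.
  move=> _ [[a [Pa Va] <-]|->]; last by rewrite divr_ge0 ?subr_ge0// ltW.
  have Va' : 0 < V a - V0 by rewrite subr_gt0.
  have Vab : 0 < V a - V b by rewrite subr_gt0 (lt_trans Vb).
  (* With this weight the mixture of [b] and [a] has volume exactly [V0], hence is feasible. *)
  pose t := (V0 - V b) / (V a - V b).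
  have t01 : 0 <= t <= 1.
    rewrite /t divr_ge0 ?(ltW Vb') ?(ltW Vab)//= ler_pdivrMr// mul1r.
    by rewrite lerD2r ltW.
  have [Pc Fc Vc] := comb_cvx t b a t01 Pb Pa.
  have Vc0 : V (comb t b a) = V0 by rewrite Vc /t; field; rewrite gt_eqF.
  have := le_trans (Fm _ Pc _) Fc; rewrite Vc0 => /(_ (lexx _)) H.
  rewrite ler_pdivrMr// mulrAC ler_pdivlMr//.
  have : m * (V a - V b) <= ((1 - t) * F b + t * F a) * (V a - V b) by rewrite ler_pM2r.
  have -> : ((1 - t) * F b + t * F a) * (V a - V b) = (V a - V0) * F b + (V0 - V b) * F a.
    by rewrite /t; field; rewrite gt_eqF.
  lra.
(* [lam] is the supremum of the slopes [(m - F a) / (V a - V0)] over [V0 < V a], which are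
   bounded by the slopes of the points with [V b < V0]. *)
have supQ : has_sup Q by split; [exists 0; right|eexists; exact: Q_ub Pb0 Vb0].
have [_ Qub] := supQ.
have sup0 : 0 <= sup Q by apply: (ub_le_sup Qub); right.
exists (sup Q) => // a Pa.
have [Va|Va|Va] := ltgtP (V a) V0.
- have : sup Q <= (F a - m) / (V0 - V a) by apply: ge_sup => //; [exists 0; right|exact: Q_ub].
  by rewrite ler_pdivlMr ?subr_gt0//; lra.
- have : (m - F a) / (V a - V0) <= sup Q by apply: (ub_le_sup Qub); left; exists a.
  by rewrite ler_pdivrMr ?subr_gt0//; lra.
- by rewrite Va subrr mulr0 addr0 Fm// Va.
Qed.

Section ae_integral.
Context d (T : measurableType d) (R : realType) (mu : {measure set T -> \bar R}).
Local Open Scope ereal_scope.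
Import HBNNSimple.

Let ge0_le_integral_off_null (f g : T -> \bar R) (N : set T) :
  (forall x, 0 <= f x) -> (forall x, 0 <= g x) -> measurable N -> mu N = 0 ->
  (forall x, ~ N x -> f x = g x) -> \int[mu]_x f x <= \int[mu]_x g x.
Proof.
move=> f0 g0 mN N0 fg; rewrite ge0_integralTE//; apply: ge_ereal_sup => _ [h hf <-].
have mCN := measurableC mN.
rewrite -integralT_nnsfun (ge0_negligible_integral _ _ _ _ N0)//; last 2 first.
- exact/measurable_EFinP.
- by move=> x _; rewrite lee_fin.
rewrite setTD integral_nnsfun// (mrestrict h mCN) ge0_integralTE//.
apply: ereal_sup_ubound; exists (proj_nnsfun h mCN) => // x.
have -> : proj_nnsfun h mCN x = (h \_ (~` N)) x by rewrite mrestrict.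
rewrite patchE; case: ifPn => [|_]; last exact: g0.
by rewrite inE => Nx; rewrite -fg//; exact: hf.
Qed.

(* Unlike [ae_eq_integral], no measurability is required: the integral is a
   supremum over simple functions, which can be cut off on a null set. *)
Lemma ae_eq_integralT (f g : T -> \bar R) (D : set T) :
  (\forall x \ae mu, D x -> f x = g x) -> \int[mu]_(x in D) f x = \int[mu]_(x in D) g x.
Proof.
move=> [N [mN N0 subN]]; rewrite integral_mkcond [RHS]integral_mkcond.
have fg x : ~ N x -> (f \_ D) x = (g \_ D) x.
  move=> Nx; rewrite !patchE; case: ifPn => //; rewrite inE => Dx.
  by apply: contrapT => fgx; apply: Nx; apply: subN => /= /(_ Dx).
rewrite integralE [RHS]integralE; congr (_ - _); apply/eqP; rewrite eq_le;
  apply/andP; split; apply: ge0_le_integral_off_null mN N0 _ => // x /fg;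
  by rewrite ?funeposE ?funenegE => ->.
Qed.

Lemma ae_bounded_integrable (D : set T) (h : T -> R) (c : R) : measurable D ->
  mu D < +oo -> measurable_fun D h -> (0 <= c)%R ->
  (\forall x \ae mu, D x -> (`|h x| <= c)%R) -> mu.-integrable D (EFin \o h).
Proof.
move=> mD Doo mh c0 hc; apply/integrableP; split; first exact/measurable_EFinP.
apply: (@le_lt_trans _ _ (\int[mu]_(x in D) c%:E)); last first.
  by rewrite integral_cst// lte_mul_pinfty.
apply: ae_ge0_le_integral => //.
by apply: measurableT_comp => //; exact/measurable_EFinP.
Qed.

End ae_integral.

Section density.
Context {R : realType}.

(* [alpha] is arbitrary, possibly not measurable, outside [0, 1]. *)
Definition clamp (y : R) : R := Num.max 0 (Num.min 1 y).

Lemma clamp01 y : 0 <= clamp y <= 1.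
Proof. by rewrite /clamp le_max lexx /= ge_max ler01 ge_min lexx. Qed.

Lemma clamp_id y : 0 <= y <= 1 -> clamp y = y.
Proof. by move=> /andP[y0 y1]; rewrite /clamp min_r// max_r. Qed.

Lemma clamp_continuous : continuous clamp.
Proof.
apply: (@continuous_of_increments R R^o 1 _ (fun _ => id) 1 ler01).
  by move=> _ x; exact: cvg_id.
move=> x y; rewrite big_ord1 mul1r /clamp.
case: (leP 1 x) => ?; case: (leP 1 y) => ?; rewrite ?(max_r ler01);
  try (case: (leP 0 x) => ?); try (case: (leP 0 y) => ?);
  by rewrite ler_norml; apply/andP; split; have := ler_norm (x - y);
   have := ler_norm (y - x); rewrite distrC; lra.
Qed.

Lemma continuous_clamp_comp (f : R -> R) : {within `[0, 1], continuous f} ->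
  continuous (fun y => f (clamp y)).
Proof.
move=> /subspace_continuousP cf x.
have c01 : `[0, 1]%classic (clamp x) by rewrite /= in_itv/= clamp01.
apply: (@cvg_comp _ _ _ clamp f _ (within `[0, 1] (nbhs (clamp x)))); last exact: cf.
move=> A; rewrite /within /= => HA.
have H : \forall y \near x, `[0, 1]%classic (clamp y) -> A (clamp y).
  exact: (clamp_continuous HA).
by apply: filterS H => y; apply; rewrite /= in_itv/= clamp01.
Qed.

End density.

(** * Pointwise characterization of the optimal density *)

Section optimal_density.
Context d (T : measurableType d) (R : realType) (mu : {measure set T -> \bar R}).
Variables (O : set T) (al al' al'' : R -> R) (al_hi ka : R) (s : T -> R).
Hypotheses (mO : measurable O) (Ooo : (mu O < +oo)%E).
Hypothesis dal : forall y, y \in `[0, 1] -> derivative_within `[0, 1] al y (al' y).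
Hypothesis dal' : forall y, y \in `[0, 1] -> derivative_within `[0, 1] al' y (al'' y).
Hypothesis al''_ge : forall y, y \in `[0, 1] -> ka <= al'' y.
Hypothesis ka_gt0 : 0 < ka.
Hypothesis al_bnd : forall y, y \in `[0, 1] -> 0 <= al y <= al_hi.
Hypotheses (s0 : forall x, 0 <= s x) (intS : mu.-integrable O (EFin \o s)).

(** The bounds hold at every point, so that [clamp] is the identity on densities and on their
    mixtures. *)
Definition density01 (eta : T -> R) := measurable_fun O eta /\ forall x, 0 <= eta x <= 1.

Let drag (eta : T -> R) : R := \int[mu]_(x in O) (al (clamp (eta x)) * s x).
Let volume (eta : T -> R) : R := \int[mu]_(x in O) (eta x).

Let ms : measurable_fun O s. Proof. exact: integrable_measurable intS. Qed.

Let al_clamp_bnd y : 0 <= al (clamp y) <= al_hi.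
Proof. by apply: al_bnd; rewrite in_itv/= clamp01. Qed.

Lemma measurable_al_clamp (eta : T -> R) : measurable_fun O eta ->
  measurable_fun O (fun x => al (clamp (eta x))).
Proof.
move=> meta; apply: (@measurableT_comp _ _ _ _ _ _ (fun y => al (clamp y))) => //.
apply: continuous_measurable_fun; apply: continuous_clamp_comp.
exact: strongly_convex_continuous dal.
Qed.

Lemma drag_integrable (eta : T -> R) : measurable_fun O eta ->
  mu.-integrable O (EFin \o (fun x => al (clamp (eta x)) * s x)).
Proof.
move=> meta; apply: (le_integrablef mO _ _ (integrable_scalef al_hi mO intS)).
  by apply: measurable_funM => //; exact: measurable_al_clamp.
move=> x _; have /andP[a0 a1] := al_clamp_bnd (eta x).
by rewrite ger0_norm ?mulr_ge0// ler_wpM2r.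
Qed.

Lemma density01_integrable eta : density01 eta -> mu.-integrable O (EFin \o eta).
Proof.
move=> [meta eta01]; apply: measurable_bounded_integrable => //.
exists 1; split => // y y1 x _ /=.
by have /andP[e0 e1] := eta01 x; rewrite ger0_norm// (le_trans e1)// ltW.
Qed.

Definition mix (t : R) (a b : T -> R) (x : T) := (1 - t) * a x + t * b x.

Lemma density01_mix t a b : 0 <= t <= 1 -> density01 a -> density01 b -> density01 (mix t a b).
Proof.
move=> /andP[t0 t1] [ma a01] [mb b01]; split.
  by apply: measurable_funD; apply: measurable_funM => //; exact: measurable_cst.
move=> x; have /andP[? ?] := a01 x; have /andP[? ?] := b01 x.
by rewrite /mix; apply/andP; split; nra.
Qed.

Lemma al_convex t x y : 0 <= t <= 1 -> 0 <= x <= 1 -> 0 <= y <= 1 ->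
  al ((1 - t) * x + t * y) <= (1 - t) * al x + t * al y.
Proof.
move=> t01 x01 y01; apply: le_trans (strongly_convex dal dal' al''_ge x01 y01 t01) _.
move: t01 => /andP[t0 t1].
have : 0 <= ka / 2 * t * (1 - t) * (x - y) ^+ 2.
  by rewrite mulr_ge0 ?sqr_ge0// mulr_ge0 ?subr_ge0// mulr_ge0// divr_ge0// ltW.
lra.
Qed.

Lemma drag_mix t a b : 0 <= t <= 1 -> density01 a -> density01 b ->
  drag (mix t a b) <= (1 - t) * drag a + t * drag b.
Proof.
move=> t01 da db; have [ma a01] := da; have [mb b01] := db.
have [mm m01] := density01_mix t01 da db.
have ia := drag_integrable ma; have ib := drag_integrable mb.
rewrite -RintegralZl// -RintegralZl// -RintegralD//; last 2 first.
- exact: integrable_scalef.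
- exact: integrable_scalef.
apply: le_Rintegral => //; first exact: drag_integrable.
  by apply: integrable_addf => //; exact: integrable_scalef.
move=> x _; rewrite !mulrA -mulrDl ler_wpM2r//.
by rewrite !clamp_id//; exact: al_convex.
Qed.

Lemma volume_mix t a b : density01 a -> density01 b ->
  volume (mix t a b) = (1 - t) * volume a + t * volume b.
Proof.
move=> /density01_integrable ia /density01_integrable ib.
rewrite -RintegralZl// -RintegralZl// -RintegralD//; exact: integrable_scalef.
Qed.

Variables (rho : T -> R) (V0 : R).
Hypotheses (drho : density01 rho) (V0_gt0 : 0 < V0) (Vrho : volume rho <= V0).
Hypothesis rho_min : forall eta, density01 eta -> volume eta <= V0 -> drag rho <= drag eta.

Lemma optimal_density : exists2 lam, 0 <= lam & forall (theta : R) (U : set T),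
  0 < theta -> measurable U -> U `<=` O ->
  (\forall x \ae mu, U x -> theta <= s x) ->
  \forall x \ae mu, U x -> rho x = argmin_density dal lam (Num.max theta (s x)).
Proof.
have [lam lam0 lamP] : exists2 lam, 0 <= lam &
    forall a, density01 a -> drag rho <= drag a + lam * (volume a - V0).
  apply: (@lagrange_multiplier R _ density01 mix drag volume V0 (drag rho)).
  - move=> t a b t01 da db; split; [exact: density01_mix|exact: drag_mix|exact: volume_mix].
  - exact: rho_min.
  - exists (cst 0); first by split => [|x]; [exact: measurable_cst|rewrite lexx ler01].
    by rewrite /volume Rintegral_cst// mul0r.
exists lam => // theta U theta0 mU UO Us.
set G := argmin_density dal lam.
have [mrho rho01] := drho.
(* Intersecting with the set where [theta <= s] turns the almost-everywhere lower bound into a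
   pointwise one. *)
pose U' := U `&` (O `&` s @^-1` `[theta, +oo[%classic).
have mU' : measurable U' by apply: measurableI => //; exact: ms.
have U'O : U' `<=` O by move=> x [/UO].
have U's x : U' x -> theta <= s x by move=> [_ [_]] /=; rewrite in_itv/= andbT.
pose g x := G (Num.max theta (s x)).
have mg : measurable_fun O g.
  apply: (@measurableT_comp _ _ _ _ _ _ (fun y => G (Num.max theta y))) => //.
  apply: continuous_measurable_fun.
  exact: (argmin_density_trunc_continuous dal' al''_ge ka_gt0 lam0 theta0).
have g01 x : 0 <= g x <= 1 by exact: argmin_density01.
(* [eta] improves on [rho] pointwise, by a multiple of [(rho - eta) ^+ 2]. *)
pose eta x := if x \in U' then g x else rho x.
have eta01 x : 0 <= eta x <= 1 by rewrite /eta; case: ifP.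
have meta : measurable_fun O eta.
  apply: measurable_fun_if => //.
  - apply: (measurable_fun_bool true); rewrite (_ : _ @^-1` _ = U').
      exact: measurableI.
    by apply/seteqP; split => x /= => [/set_mem|/mem_set].
  - exact: measurable_funS mg.
  - exact: measurable_funS mrho.
have deta : density01 eta by [].
pose c := theta * ka / 4.
have c0 : 0 < c by rewrite divr_gt0// mulr_gt0.
pose phi (y : R) x := al (clamp y) * s x + lam * y.
have iphi (h : T -> R) : density01 h -> mu.-integrable O (EFin \o (fun x => phi (h x) x)).
  move=> dh; apply: integrable_addf => //; first by apply: drag_integrable; case: dh.
  by apply: integrable_scalef => //; exact: density01_integrable.
have Iphi h : density01 h -> \int[mu]_(x in O) phi (h x) x = drag h + lam * volume h.
  move=> dh; rewrite -RintegralZl//; last exact: density01_integrable.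
  rewrite -RintegralD//; first by apply: drag_integrable; case: dh.
  by apply: integrable_scalef => //; exact: density01_integrable.
have growth x : O x -> c * (rho x - eta x) ^+ 2 + phi (eta x) x <= phi (rho x) x.
  move=> Ox; rewrite /eta; case: ifPn => [|_]; last by rewrite subrr expr0n mulr0 add0r.
  rewrite inE => /U's sx.
  have sm : Num.max theta (s x) = s x by rewrite max_r.
  have := @argmin_density_growth _ _ _ _ _ dal dal' al''_ge lam (s x) (rho x) (s0 x) (rho01 x).
  rewrite /phi /g sm !clamp_id//; last exact: argmin_density01.
  apply: le_trans; rewrite addrC lerD2l /c ler_wpM2r ?sqr_ge0//.
  by rewrite ler_wpM2r ?invr_ge0// ler_wpM2r// ltW.
(* Since [lam >= 0] and [volume rho <= V0], the multiplier inequality says that [rho] minimizes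
   [drag + lam * volume] among all densities. *)
have le_int : \int[mu]_(x in O) phi (rho x) x <= \int[mu]_(x in O) phi (eta x) x.
  rewrite !Iphi//; have := lamP _ deta; have := ler_wpM2l lam0 Vrho; lra.
have md2 : measurable_fun O (fun x => (rho x - eta x) ^+ 2).
  by apply: measurable_funX; exact: measurable_funB.
have id2 : mu.-integrable O (EFin \o (fun x => (rho x - eta x) ^+ 2)).
  apply: measurable_bounded_integrable => //; exists 1; split => // y y1 x _ /=.
  have /andP[? ?] := rho01 x; have /andP[? ?] := eta01 x.
  by rewrite ger0_norm ?sqr_ge0//; apply: le_trans (ltW y1); nra.
have int0 : \int[mu]_(x in O) ((rho x - eta x) ^+ 2) = 0.
  apply/eqP; rewrite eq_le Rintegral_ge0 ?andbT; last by move=> x _; exact: sqr_ge0.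
  have H : \int[mu]_(x in O) (c * (rho x - eta x) ^+ 2 + phi (eta x) x) <=
      \int[mu]_(x in O) phi (rho x) x.
    apply: le_Rintegral => //; [|exact: iphi].
    by apply: integrable_addf => //; [exact: integrable_scalef|exact: iphi].
  rewrite RintegralD// in H; [|exact: integrable_scalef|exact: iphi].
  rewrite RintegralZl// in H.
  rewrite -(pmulr_rle0 _ c0); lra.
have : ae_eq mu O (fun x => ((rho x - eta x) ^+ 2)%:E) (cst 0%E).
  apply/ae_eq_integral_abs => //; first exact/measurable_EFinP.
  under eq_integral do rewrite gee0_abs ?lee_fin ?sqr_ge0//.
  by rewrite -[LHS]fineK; [congr EFin|exact: integrable_fin_num].
move: Us; apply: filterS2 => x Us H Ux; have sx := Us Ux.
have Ox := UO _ Ux; have := H Ox => /= -[] /eqP; rewrite sqrf_eq0 subr_eq0 => /eqP ->.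
rewrite /eta mem_set//; split => //; split => //.
by rewrite /= in_itv/= andbT.
Qed.

End optimal_density.

(** * From minimizers of J to the pointwise form of the density *)

Section minimizers.
Context {R : realType} (n : nat).
Local Notation E := 'rV[R]_n.
Local Notation mu := (@lebesgue_rV R n).
Variable O : set E.
Hypotheses (oO : open O) (bO : bounded_set O).

Let mO : measurable O. Proof. exact: open_measurable_rV. Qed.
Let Ooo : (mu O < +oo)%E. Proof. exact: bounded_set_lty. Qed.

(** [wpartial] is a chosen representative, so the gradient of 0 is known to vanish only almost
    everywhere. The lemma puts competitors with the same velocity at H^1 distance 0. *)
Lemma H1norm2_cst0 : H1norm2 O (cst 0) = 0%E.
Proof.
have w0 i : weak_partial O i (cst 0 : E -> R) (cst 0).
  have := smooth_weak_partial i oO (fun k => @Ck_cst0 R n k).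
  by rewrite (_ : 'D_(e_ i) (cst 0 : E -> R) = cst 0)//; apply/funext => x; rewrite derive_cst.
have ae0 : \forall x \ae mu, forall i, O x -> wpartial O i (cst 0 : E -> R) x = 0.
  apply: filter_forall => i; exact: wpartial_ae (w0 i).
rewrite /H1norm2 (@ae_eq_integralT _ _ _ _ _ (cst 0%E)) ?integral0//.
apply: filterS ae0 => x H Ox; rewrite /sqgrad big1 ?addr0 ?expr0n// => i _.
by rewrite H// expr0n.
Qed.

Lemma H1norm_subrr (u : E -> E) : H1norm O (u \- u) = 0%E.
Proof.
rewrite /H1norm big1 ?poweR0r ?invr_eq0//= => k _.
rewrite (_ : vcomp _ k = cst 0) ?H1norm2_cst0//.
by apply/funext => x; rewrite /vcomp /= subrr mxE.
Qed.

Lemma Linfty_norm_le (h : E -> R) (c : R) : 0 <= c ->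
  (\forall x \ae mu, O x -> `|h x| <= c) -> (Linfty_norm O h <= c%:E)%E.
Proof.
move=> c0 hc; rewrite /Linfty_norm unlock /=; case: ifPn => // _.
apply/ess_supP; apply: filterS hc => x H.
by rewrite /= lee_fin patchE; case: ifPn => [/set_mem/H//|_]; rewrite normr0.
Qed.

Lemma Linfty_bounded (h : E -> R) (c : R) : 0 <= c -> measurable_fun O h ->
  (\forall x \ae mu, O x -> `|h x| <= c) -> Linfty O h.
Proof.
move=> c0 mh hc; rewrite /Linfty inE; apply/andP; split; rewrite inE /=.
  exact/(measurable_restrictT _ mO).
exact: le_lt_trans (Linfty_norm_le c0 hc) (ltry _).
Qed.

Lemma Linfty_measurable (h : E -> R) : Linfty O h -> measurable_fun O h.
Proof.
by rewrite /Linfty inE => /andP[/[!inE]/= mh _]; exact/(measurable_restrictT _ mO).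
Qed.

Variables (nu gamma : R) (f : E -> E).
Hypothesis hf : forall k, L2 O (vcomp f k).
Variables (al al' al'' : R -> R) (al_hi ka : R).
Hypothesis dal : forall y, y \in `[0, 1] -> derivative_within `[0, 1] al y (al' y).
Hypothesis dal' : forall y, y \in `[0, 1] -> derivative_within `[0, 1] al' y (al'' y).
Hypothesis al''_ge : forall y, y \in `[0, 1] -> ka <= al'' y.
Hypothesis ka_gt0 : 0 < ka.
Hypothesis al_bnd : forall y, y \in `[0, 1] -> 0 <= al y <= al_hi.
Variables (u : E -> E) (rho : E -> R).
Hypotheses (Hu : H10div O u) (Crho : Cgamma O gamma rho).

Let L2c (v : E -> R) : L2 O v -> measurable_fun O v /\
  mu.-integrable O (EFin \o (fun x => v x ^+ 2)).
Proof. exact: L2_sqr_integrable. Qed.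

Let Hu1 k : H1 O (vcomp u k). Proof. by case: Hu. Qed.

Lemma sqnorm_integrable : mu.-integrable O (EFin \o (fun x => sqnorm (u x))).
Proof.
have : mu.-integrable O (EFin \o (fun x => \sum_k vcomp u k x ^+ 2)).
  by apply: integrable_sumf => // k; have [/L2c[_ ?] _ _] := Hu1 k.
by apply: eq_integrable => // x _ /=; congr EFin; apply: eq_bigr => k _; rewrite expr2.
Qed.

Let rest x := nu * (\sum_k sqgrad O (vcomp u k) x) - 2 * dotmul (f x) (u x).

Let rest_integrable : mu.-integrable O (EFin \o rest).
Proof.
apply: integrable_subf => //; apply: integrable_scalef => //.
  apply: integrable_sumf => // k; apply: integrable_sumf => // i.
  by have [_ _ /(_ i)/L2c[_ ?]] := Hu1 k.
apply: integrable_sumf => // k.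
have [/L2c[mu_ iu] _ _] := Hu1 k; have [mf if_] := L2c (hf k).
exact: (sqr_integrable_mul mO mf mu_ if_ iu).
Qed.

Let drag (eta : E -> R) : R := \int[mu]_(x in O) (al (clamp (eta x)) * sqnorm (u x)).

Let sqnorm_ge0 x : 0 <= sqnorm (u x).
Proof. by apply: sumr_ge0 => k _; rewrite -expr2 sqr_ge0. Qed.

Let drag_int (eta : E -> R) : measurable_fun O eta ->
  mu.-integrable O (EFin \o (fun x => al (clamp (eta x)) * sqnorm (u x))).
Proof. by move=> meta; apply: (drag_integrable mO dal al_bnd) => //; exact: sqnorm_integrable. Qed.

(** With the velocity fixed, only the drag depends on the density. [alpha (eta x)] may fail to be
    measurable where [eta] leaves [0, 1], which is why an almost-everywhere equality of integrands
    free of measurability conditions is applied. *)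
Lemma J_drag (eta : E -> R) : measurable_fun O eta ->
  (\forall x \ae mu, O x -> 0 <= eta x <= 1) ->
  J O al nu f u eta = 2^-1 * (drag eta + \int[mu]_(x in O) rest x).
Proof.
move=> meta eta01; rewrite -RintegralD//; last exact: drag_int.
rewrite /J; congr (_ * fine _); apply: ae_eq_integralT.
apply: filterS eta01 => x /[apply] e01.
by rewrite clamp_id// /rest addrA.
Qed.

Let mrho : measurable_fun O rho.
Proof. by apply: Linfty_measurable; case: Crho. Qed.

(** A modification of [rho] on a null set, with values in [0, 1] everywhere. *)
Let crho x := clamp (rho x).

Let crho_ae : \forall x \ae mu, O x -> rho x = crho x.
Proof. by case: Crho => _ + _; apply: filterS => x /[apply] r01; rewrite /crho clamp_id. Qed.

Lemma clamp_density01 : density01 O crho.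
Proof.
split; last by move=> x; exact: clamp01.
apply: (@measurableT_comp _ _ _ _ _ _ clamp) => //.
by apply: continuous_measurable_fun; exact: clamp_continuous.
Qed.

Let V0 := gamma * fine (mu O).

Lemma volume_clamp_le : \int[mu]_(x in O) crho x <= V0.
Proof.
have i1 := density01_integrable mO Ooo clamp_density01.
rewrite -lee_fin fineK; last exact: integrable_fin_num.
rewrite /V0 EFinM fineK ?ge0_fin_numE//.
have [_ _] := Crho; apply: le_trans; rewrite le_eqVlt; apply/orP; left; apply/eqP.
by apply: ae_eq_integralT; apply: filterS crho_ae => x /[apply] ->.
Qed.

Lemma density01_Cgamma (eta : E -> R) : density01 O eta -> \int[mu]_(x in O) eta x <= V0 ->
  Cgamma O gamma eta.
Proof.
move=> deta Veta; have [meta eta01] := deta; split.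
- apply: (@Linfty_bounded _ 1) => //; apply: aeW => x _.
  by have /andP[? ?] := eta01 x; rewrite ger0_norm.
- by apply: aeW => x _.
- have i1 := density01_integrable mO Ooo deta.
  move: Veta; rewrite -lee_fin fineK; last exact: integrable_fin_num.
  by rewrite /V0 EFinM fineK ?ge0_fin_numE.
Qed.

Variable r : R.
Hypothesis r0 : 0 < r.
Hypothesis rho_min : forall w eta, admissible O gamma w eta ->
  (H1norm O (u \- w)%R + Linfty_norm O (rho \- eta)%R < r%:E)%E ->
  J O al nu f u rho <= J O al nu f w eta.

(** Any density is approached from [crho] along a segment of feasible densities; minimality near its
    start and convexity of the drag along it give, after division by [t], minimality at its end. *)
Lemma drag_minimal (eta : E -> R) : density01 O eta -> \int[mu]_(x in O) eta x <= V0 ->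
  drag crho <= drag eta.
Proof.
(* The mixture differs from [crho] by [t * (crho - eta)], of size at most [t], so [t < r] keeps it
   in the neighbourhood. *)
move=> deta Veta; pose t := Num.min 1 (r / 2).
have t0 : 0 < t by rewrite lt_min ltr01 divr_gt0.
have t1 : t <= 1 by rewrite ge_min lexx.
have tr : t < r.
  apply: (@le_lt_trans _ _ (r / 2)); first by rewrite ge_min lexx orbT.
  by rewrite ltr_pdivrMr// mulr_natr mulr2n ltrDl.
have t01 : 0 <= t <= 1 by rewrite ltW.
have dc := clamp_density01.
have dmix := density01_mix t01 dc deta.
have Vmix : \int[mu]_(x in O) mix t crho eta x <= V0.
  rewrite (volume_mix mO Ooo)//.
  have H1 := ler_wpM2l (ltW t0) Veta.
  have t1' : 0 <= 1 - t by rewrite subr_ge0.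
  by have := ler_wpM2l t1' volume_clamp_le; lra.
have Cmix := density01_Cgamma dmix Vmix.
have near_mix : (Linfty_norm O (rho \- mix t crho eta)%R <= t%:E)%E.
  apply: Linfty_norm_le; first exact: ltW.
  apply: filterS crho_ae => x /[apply] rx.
  rewrite /= rx /mix.
  have /andP[? ?] : 0 <= crho x <= 1 by exact: clamp01.
  have /andP[? ?] := deta.2 x.
  by rewrite ler_norml; apply/andP; split; nra.
have lt_r : (H1norm O (u \- u)%R + Linfty_norm O (rho \- mix t crho eta)%R < r%:E)%E.
  by rewrite H1norm_subrr add0e; apply: le_lt_trans near_mix _; rewrite lte_fin.
have := rho_min (conj Hu Cmix) lt_r.
have [mmix mix01] := dmix.
rewrite J_drag//; last by case: Crho.
rewrite J_drag//; last by apply: aeW => x _; exact: mix01.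
rewrite ler_pM2l ?invr_gt0// lerD2r => H.
have H2 := drag_mix mO dal dal' al''_ge ka_gt0 al_bnd sqnorm_ge0 sqnorm_integrable t01 dc deta.
have Ec : drag rho = drag crho.
  apply: eq_Rintegral => x _; congr (al _ * _).
  by rewrite [RHS]clamp_id//; exact: clamp01.
have H3 : drag crho <= (1 - t) * drag crho + t * drag eta.
  by rewrite -{1}Ec; exact: le_trans H H2.
rewrite -(ler_pM2l t0); lra.
Qed.

Hypothesis gamma0 : 0 < gamma.
Hypothesis mO_gt0 : (0 < mu O)%E.

Lemma minimizer_structure : exists2 lam, 0 <= lam & forall (theta : R) (U : set E),
  0 < theta -> measurable U -> U `<=` O ->
  (\forall x \ae mu, U x -> theta <= sqnorm (u x)) ->
  \forall x \ae mu, U x -> rho x = argmin_density dal lam (Num.max theta (sqnorm (u x))).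
Proof.
have V0_gt0 : 0 < V0 by rewrite mulr_gt0// fine_gt0// mO_gt0.
have [lam lam0 H] := optimal_density mO Ooo dal dal' al''_ge ka_gt0 al_bnd sqnorm_ge0
  sqnorm_integrable clamp_density01 V0_gt0 volume_clamp_le drag_minimal.
exists lam => // theta U theta0 mU UO Us.
have := H theta U theta0 mU UO Us; move: crho_ae; apply: filterS2 => x r1 r2 Ux.
by rewrite r1 ?r2//; exact: UO.
Qed.

End minimizers.

Unset Implicit Arguments.

Theorem theorem3 (R : realType) (d : nat) (hd : d = 2%N \/ d = 3%N)
  (Omega : set 'rV[R]_d) (hOmega : bounded_lipschitz_domain Omega)
  (nu gamma : R) (hnu : 0 < nu) (hgamma : 0 < gamma < 1)
  (f : 'rV[R]_d -> 'rV[R]_d) (hf : forall k, L2 Omega (vcomp f k))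
  (alpha alpha' alpha'' : R -> R) (alpha_lo alpha_hi alpha_min : R)
  (halpha_lo : 0 <= alpha_lo)
  (halpha_cod : forall y, y \in `[0, 1] -> alpha_lo <= alpha y <= alpha_hi)
  (halpha_convex : convex_function (`[0, 1]%classic : set R) alpha)
  (halpha_decr : {in `[0, 1] &, {homo alpha : x y /~ x <= y}})
  (halpha' : forall y, y \in `[0, 1] ->
     derivative_within `[0, 1] alpha y (alpha' y))
  (halpha'' : forall y, y \in `[0, 1] ->
     derivative_within `[0, 1] alpha' y (alpha'' y))
  (halpha''_cont : {within `[0, 1], continuous alpha''})
  (halpha0 : alpha 0 = alpha_hi) (halpha1 : alpha 1 = alpha_lo)
  (halpha_min : 0 < alpha_min)
  (halpha''_min : forall y, y \in `[0, 1] -> alpha_min <= alpha'' y)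
  (u : 'rV[R]_d -> 'rV[R]_d) (rho : 'rV[R]_d -> R)
  (hmin : local_minimizer Omega alpha nu f gamma u rho \/
          global_minimizer Omega alpha nu f gamma u rho)
  (hu : ~ (\forall x \ae lebesgue_rV d, Omega x -> u x = 0))
  (theta : R) (Ubar : set 'rV[R]_d) (htheta : 0 < theta)
  (hUbar_closed : closed Ubar) (hUbar_sub : Ubar `<=` Omega)
  (hUbar_int : Ubar° !=set0)
  (hUbar : \forall x \ae lebesgue_rV d, Ubar x -> theta <= sqnorm (u x)) :
  let U := Ubar° in
  [/\ weakly_differentiable U rho, Cgamma Omega gamma rho & H1 U rho].
Proof.
move=> U.
have [_ oO _ bO _] := hOmega.
have oU : open U by exact: open_interior.
have UUbar : U `<=` Ubar by exact: interior_subset.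
have UO : U `<=` Omega by move=> x /UUbar /hUbar_sub.
have mO := open_measurable_rV oO; have mU := open_measurable_rV oU.
have [[Hu Crho] [r r0 rho_min]] : admissible Omega gamma u rho /\
    exists2 r : R, 0 < r & forall w eta, admissible Omega gamma w eta ->
    (H1norm Omega (u \- w)%R + Linfty_norm Omega (rho \- eta)%R < r%:E)%E ->
    J Omega alpha nu f u rho <= J Omega alpha nu f w eta.
  (* A global minimizer is a local one for any radius, here 1. *)
  case: hmin => [//|[adm gmin]]; split => //.
  by exists 1 => // w eta Hw _; exact: gmin.
(* If [Omega] were null, [u] would vanish almost everywhere in it vacuously, against [hu]. *)
have mO_gt0 : (0 < lebesgue_rV d Omega)%E.
  rewrite lt0e measure_ge0 andbT; apply/eqP => O_null; apply: hu.
  by exists Omega; split => // x /= /not_implyP[].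
have alpha_bnd y : y \in `[0, 1] -> 0 <= alpha y <= alpha_hi.
  by move=> /halpha_cod /andP[a0 ->]; rewrite (le_trans halpha_lo a0).
have gamma0 : 0 < gamma by case/andP: hgamma.
have [lam lam0 rhoG] := minimizer_structure oO bO hf halpha' halpha'' halpha''_min
  halpha_min alpha_bnd Hu Crho r0 rho_min gamma0 mO_gt0.
have hU : \forall x \ae lebesgue_rV d, U x -> theta <= sqnorm (u x).
  by apply: filterS hUbar => x H /UUbar /H.
have rhoE := rhoG theta U htheta mU UO hU.
have [Hu1 Htr _] := Hu.
have htr k := cid (Htr k).
pose phi k := sval (htr k).
have sphi k j : smooth (phi k j) by rewrite /phi; case: (htr k) => /= ? [].
have phi_cvg k : H1norm2 Omega (phi k j \- vcomp u k)%R @[j --> \oo] --> 0%E.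
  by rewrite /phi; case: (htr k) => /= ? [].
pose F (a : 'I_d -> R) := argmin_density halpha' lam (Num.max theta (\sum_k a k ^+ 2)).
pose L := 2 * lam / alpha_min * (2 / (theta * Num.sqrt theta)).
have L0 : 0 <= L.
  rewrite /L mulr_ge0// divr_ge0//; [exact: mulr_ge0|exact: ltW|].
  by rewrite mulr_ge0 ?sqrtr_ge0// ltW.
have FL a b : `|F a - F b| <= L * \sum_k `|a k - b k|.
  exact: (argmin_density_lipschitz halpha' halpha'' halpha''_min halpha_min lam0 htheta).
have rhoF : \forall x \ae lebesgue_rV d, U x -> rho x = F (fun k => vcomp u k x).
  apply: filterS rhoE => x /[apply] ->; rewrite /F.
  have -> // : \sum_k vcomp u k x ^+ 2 = sqnorm (u x).
  by apply: eq_bigr => k _; rewrite expr2.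
have [LinfR rho01 _] := Crho.
have mrhoO := Linfty_measurable oO LinfR.
have mrho : measurable_fun U rho by exact: measurable_funS mrhoO.
have bU : bounded_set U.
  by move: bO => [M [Mr HM]]; exists M; split => // x /HM H y /UO; exact: H.
have rho_le1 : \forall x \ae lebesgue_rV d, U x -> `|rho x| <= 1.
  apply: filterS rho01 => x H /UO /H /andP[rho0 rho1].
  by rewrite ger0_norm.
have L2rho : L2 U rho.
  apply: sqr_integrable_L2 => //.
  apply: (@ae_bounded_integrable _ _ _ _ _ _ 1) => //.
  - exact: bounded_set_lty.
  - exact: measurable_funX.
  - apply: filterS rho_le1 => x H /H rho1; rewrite normrX exprn_ile1//.
have lrho : L1loc U rho.
  split => // K cK KU; have mK := compact_measurable_rV cK.
  have : (lebesgue_rV d).-integrable K (EFin \o rho).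
    apply: (@ae_bounded_integrable _ _ _ _ _ _ 1) => //.
    - exact: compact_lty.
    - exact: measurable_funS mrho.
    - by apply: filterS rho_le1 => x H /KU /H.
  by move=> /integrableP[].
have wP i := lipschitz_comp_weak_partial oO bO oU UO Hu1 sphi phi_cvg L0 FL lrho rhoF i.
have wd : weakly_differentiable U rho by move=> i; have [w [rw _]] := wP i; exists w.
split => //; split => // i.
(* [H1] asks for square integrability of the representative chosen by [wpartial]; it is transferred
   from the Riesz representative, to which it is equal almost everywhere. *)
have [w [rw L2w]] := wP i.
have [_ [mwp _] _] := wpartialP (wd i).
have [mw /integrableP[_ iw2]] := L2_sqr_integrable mU L2w.
apply: sqr_integrable_L2 => //.
apply/integrableP; split; first by apply/measurable_EFinP; exact: measurable_funX.
apply: le_lt_trans iw2; rewrite le_eqVlt; apply/orP; left; apply/eqP.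
by apply: ae_eq_integralT; apply: filterS (wpartial_ae oU rw) => x /[apply] /= ->.
Qed.
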